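(* Consider a sequence of finite connected graphs $G$ with $n\to\infty$ vertices and origins $v\in V(G)$, and fix constants $\alpha,\beta>0$. If $n^{\alpha}\le\tau_{par}^v(G)$ holds with probability at least $1-n^{-\beta}$, then $\tau_{c\text{-}unif}^v(G)=\tau_{par}^v(G)(1+o(1))$ with probability $1-o(1)$ and in expectation.
   Context: Let $G=(V,E)$ be a finite connected graph with $n$ vertices and $v\in V$. Parallel-IDLA from $v$: all $n$ particles start at $v$ at time $0$, one of them settling at $v$ immediately; at each time step every unsettled particle simultaneously takes one simple random walk step; if one or more particles jump to a vertex not occupied by a settled particle, exactly one of them (the one of smallest index) settles there, the others continue; $\tau_{par}^v(G)$ is the first time all particles are settled. Continuous-time Uniform-IDLA from $v$: all $n$ particles start at $v$, one settles at $v$ immediately; each other particle has an independent exponential clock of rate $1$, and whenever its clock rings, if the particle is unsettled, it jumps to a uniformly random neighbour and settles there if that vertex is unoccupied; $\tau_{c\text{-}unif}^v(G)$ is the (continuous) time until all particles are settled. *)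

(* Defs.v *)
From HB Require Import structures.
From mathcomp Require Export all_boot all_order all_algebra.
From mathcomp Require Export all_classical all_reals all_analysis.
From mathcomp Require Export measurable_realfun.
Export Order.TTheory GRing.Theory Num.Theory.
Export numFieldNormedType.Exports.

Set Implicit Arguments.
Unset Strict Implicit.
Unset Printing Implicit Defensive.

Local Open Scope classical_set_scope.
Local Open Scope ring_scope.

Definition connected_graph (V : finType) (e : rel V) : Prop :=
  [/\ symmetric e, irreflexive e & forall x y, connect e x y].

Definition deg (V : finType) (e : rel V) (x : V) : nat := #|[pred y | e x y]|.

(* An isolated vertex (possible in a connected graph only when #|V| = 1) is
   made absorbing, so that a random walk exists on the one-vertex graph too. *)
Definition srw {R : realType} (V : finType) (e : rel V) (x y : V) : R :=
  if deg e x == 0%N then (x == y)%:R else (e x y)%:R / (deg e x)%:R.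

Definition path_prob {R : realType} (V : finType) (e : rel V) (v : V)
    (m : nat) (p : nat -> V) : R :=
  (p 0%N == v)%:R * \prod_(t < m) srw e (p t) (p t.+1).

(* The finite-dimensional distributions below determine the joint law: the
   trajectories [X i] are independent simple random walks started at [v]. *)
Definition indep_walks {R : realType} d (O : measurableType d)
    (P : probability O R) (V : finType) (e : rel V) (v : V)
    (I : finType) (X : I -> nat -> O -> V) : Prop :=
  (forall i t x, measurable [set w | X i t w = x]) /\
  (forall (m : nat) (p : I -> nat -> V),
    P [set w | forall i t, (t <= m)%N -> X i t w = p i t] =
      (\prod_i path_prob e v m (p i))%:E).

(* The trajectories [X i] are independent simple random walks started at [v],
   and the [S i k] are i.i.d. exponential variables of rate 1 independent of
   the trajectories; [S i k] is the waiting time between the k-th and the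
   (k+1)-st rings of the clock of particle i. *)
Definition indep_walks_clocks {R : realType} d (O : measurableType d)
    (P : probability O R) (V : finType) (e : rel V) (v : V)
    (I : finType) (X : I -> nat -> O -> V) (S : I -> nat -> O -> R) : Prop :=
  [/\ forall i t x, measurable [set w | X i t w = x],
      forall i k, measurable_fun setT (S i k) &
      forall (m : nat) (p : I -> nat -> V) (B : I -> nat -> set R),
        (forall i k, measurable (B i k)) ->
        P [set w | (forall i t, (t <= m)%N -> X i t w = p i t) /\
                   (forall i k, (k < m)%N -> B i k (S i k w))] =
          ((\prod_i path_prob e v m (p i))%:E *
           \prod_i \prod_(k < m) exponential_prob 1 (B i k))%E].

Section dynamics.
Variable V : finType.
Let I := 'I_#|V|.

(* Number of jumps made so far by each particle, and set of settled particles.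
   When particle i follows the trajectory [x i], its position is [x i (s.1 i)];
   the counter of a particle is frozen once the particle is settled. *)
Definition state : Type := ({ffun I -> nat} * {set I})%type.

(* Particle 0 settles at the origin at time 0. *)
Definition init_state : state :=
  ([ffun=> 0%N], [set i : I | i == 0%N :> nat]%SET).

Variable x : I -> nat -> V.

Definition occupied (s : state) : {set V} :=
  [set x j (s.1 j) | j in s.2]%SET.

Definition par_step (s : state) : state :=
  let c : {ffun I -> nat} :=
    [ffun i => if i \in s.2 then s.1 i else (s.1 i).+1] in
  let on_free i := (i \notin s.2) && (x i (c i) \notin occupied s) in
  (c, s.2 :|: [set i | on_free i &&
        [forall j, on_free j && (x j (c j) == x i (c i)) ==> (i <= j)%N]]%SET).

Definition par_state (t : nat) : state := iter t par_step init_state.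

Definition tau_par {R : realType} : \bar R :=
  ereal_inf [set t%:R%:E | t in [set t | (par_state t).2 = [set: I]%SET]].

Variables (R : realType) (a : I -> nat -> R).

(* Time of the k-th ring of the clock of particle i, given waiting times [a]. *)
Definition ring_time (i : I) (k : nat) : R := \sum_(l < k) a i l.

(* The next jump is made by the unsettled particle whose clock rings first;
   rings of settled particles have no effect, and ties have probability 0. *)
Definition next_particle (s : state) : option I :=
  [pick i | (i \notin s.2) &&
    [forall j, (j \notin s.2) ==>
      (ring_time i (s.1 i).+1 <= ring_time j (s.1 j).+1)]].

Definition cunif_step (s : state) : state :=
  if next_particle s is Some i then
    let k := (s.1 i).+1 in
    ([ffun j => if j == i then k else s.1 j],
     if x i k \in occupied s then s.2 else i |: s.2)
  else s.

(* State after m jumps. *)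
Definition cunif_state (m : nat) : state := iter m cunif_step init_state.

(* Once all particles are settled, [ring_time i (s.1 i)] is the time at which
   particle i settled. *)
Definition tau_cunif : \bar R :=
  ereal_inf [set (\big[Num.max/0]_i ring_time i ((cunif_state m).1 i))%:E |
             m in [set m | (cunif_state m).2 = [set: I]%SET]].

End dynamics.

Definition coupling {R : realType} d1 d2 (O1 : measurableType d1)
    (O2 : measurableType d2) (P1 : probability O1 R) (P2 : probability O2 R)
    (T1 : O1 -> \bar R) (T2 : O2 -> \bar R)
    (Q : probability (\bar R * \bar R)%type R) : Prop :=
  forall B : set (\bar R), measurable B ->
    Q (B `*` setT) = P1 (T1 @^-1` B) /\ Q (setT `*` B) = P2 (T2 @^-1` B).

(* Main.v *)
(** Let the jumps be made in the order of clocks [a] while the time is measured by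
    clocks [r]. The settling time of the Uniform-IDLA corresponds to [a = r = S], with
    exponential waiting times [S], and that of the Parallel-IDLA to [a = r = 1]. By an
    exchange argument, measuring the time by [r] while ordering the jumps by [r]
    itself is, in distribution, slower than ordering them by independent clocks [a].
    On the other hand, since a sum of [k] exponential variables is [k (1 + o(1))], up
    to an additive error of order [log n] for all particles and all [k] at once,
    replacing the clocks [r] that measure the time (for a fixed order) changes the
    settling time by a factor [1 + o(1)]. Hence each of the two times is, in
    distribution and up to such a factor, dominated by the other one, as [log n] is
    negligible with respect to [n ^ alpha]. The quantile coupling turns these
    inequalities between tails into a comparison of the variables, by a union bound over
    a geometric grid from [n ^ alpha] to [n ^ (n + 4)], a level that the Parallel-IDLA
    rarely exceeds because its expected settling time is at most [n ^ (n + 3)]. *)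

From HB Require Import structures.
Require Import Defs.
From mathcomp Require Import perm ring lra zify.

Set Implicit Arguments.
Unset Strict Implicit.
Unset Printing Implicit Defensive.

Local Open Scope ring_scope.

(** * Ordering the jumps by the measuring clocks is the worst choice *)

(** The exchange cannot be run on two given trajectories: when two particles reach the same free
    vertex, swapping their jumps changes which of them goes on. What survives is a statement in law,
    hence [game_value], a probability computed backwards with fresh randomness at each turn, where
    particles may be relabelled and innovations permuted inside the sum. Every jump must then draw
    from a finite set, with a law that does not depend on the position: walks are driven by random
    maps, and clocks are rounded to finitely many values. The exponential clocks are recovered in
    the limit because their ring times almost surely have no ties; the unit clocks do tie, but need
    no rounding. The sizes fit as follows. With [K = (4 / theta) ln n], the comparison of the two
    tails at one level fails with probability [O(n^-3)], and the grid has [O(n^2)] points, so the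
    union bound costs [O(1/n)]. A bound as crude as [n ^ (n + 3)] on the expectation suffices, since
    only its logarithm enters the size of the grid. *)

Lemma pick_sub (T : finType) (P Q : pred T) i :
  (forall j, Q j -> P j) -> [pick j | P j] = Some i -> Q i ->
  [pick j | Q j] = Some i.
Proof.
move=> QP; rewrite /pick /enum_mem.
elim: (Finite.enum T) => //= j s IH.
rewrite /in_mem/=.
have [Pj|nPj] := boolP (P j).
  by case=> ->; move=> Qi; rewrite Qi.
rewrite (contraNF (QP j) nPj). exact: IH.
Qed.

Section first.
Variables (R : realType) (I : finType).
Implicit Types (A : {set I}) (e : I -> R).

Definition first_of A e : option I :=
  [pick i | (i \in A) && [forall j, (j \in A) ==> (e i <= e j)]].

Lemma first_ofP A e i : first_of A e = Some i ->
  i \in A /\ forall j, j \in A -> e i <= e j.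
Proof.
rewrite /first_of; case: pickP => // k /andP[kA /forallP kmin] [<-].
by split=> // j jA; have /implyP := kmin j; exact.
Qed.

Lemma first_of_None A e : (first_of A e == None) = (A == finset.set0).
Proof.
rewrite /first_of; case: pickP => [k /andP[kA _]|nA].
  by apply/esym/negbTE/finset.set0Pn; exists k.
rewrite eqxx; apply/esym; apply: contraT => /finset.set0Pn[k kA].
case: (@arg_minP _ _ _ k (mem A) e kA) => i iA imin.
have := nA i; rewrite (iA : i \in A) /= => /forallP[] j.
by apply/implyP => jA; exact: imin.
Qed.

(** Ties are broken by the enumeration, so [i] must remain the first minimizer and not just a
    minimizer. The minimizers for [A'], [e'] are among those for [A], [e], and [pick] keeps its
    choice when the predicate shrinks around it. *)
Lemma first_of_stable A A' e e' i : first_of A e = Some i -> i \in A' ->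
  {subset A' <= A} -> e' i = e i -> (forall j, e j <= e' j) ->
  first_of A' e' = Some i.
Proof.
move=> fi iA' AA' ei ee'; have [iA imin] := first_ofP fi.
apply: pick_sub fi _ => [j /andP[jA' /forallP jmin]|].
- rewrite AA' //=; apply/forallP => k; apply/implyP => kA.
  apply: le_trans (imin _ kA); rewrite (le_trans (ee' j))// -ei.
  by have /implyP := jmin i; exact.
- rewrite iA' /=; apply/forallP => j; apply/implyP => jA'.
  by rewrite ei (le_trans (imin _ (AA' _ jA'))).
Qed.
End first.

Section game.
Variables (R : realType) (V I F G : finType).
Variables (omF : F -> R) (omG : G -> R) (act : F -> V -> V) (c : G -> R).
Hypotheses (omF0 : forall f, 0 <= omF f) (omG0 : forall g, 0 <= omG g).
Hypothesis (c0 : forall g, 0 <= c g).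
Variable t : R.

(** Only what the future depends on is kept. Jump counts are dropped, so that two jumps made in
    either order can lead to equal configurations. *)
Record config := Config {
  occ : {set V}; uns : {set I}; pos : {ffun I -> V}; nxt : {ffun I -> R} }.

Definition move (i : I) (z : F * G) (s : config) : config :=
  let y := act z.1 (pos s i) in
  Config (y |: occ s) (if y \in occ s then uns s else uns s :\ i)
    [ffun k => if k == i then y else pos s k]
    [ffun k => if k == i then nxt s k + c z.2 else nxt s k].

Definition om (z : F * G) : R := omF z.1 * omG z.2.

Lemma om_ge0 z : 0 <= om z. Proof. exact: mulr_ge0. Qed.

(* At each turn the unsettled particle whose next ring, at time [nxt], is the earliest
   moves, and the game is lost if that ring comes after time [t]. This is the
   probability of having all particles settled within [n] turns. *)
Fixpoint game_value (n : nat) (s : config) : R :=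
  if n is n'.+1 then
    if first_of (uns s) (nxt s) is Some i then
      (nxt s i <= t)%R%:R * \sum_z om z * game_value n' (move i z s)
    else 1
  else (uns s == finset.set0)%:R.

(* The value when [j] is forced to move now and the order of the rings is followed
   afterwards. *)
Definition turn_value (n : nat) (j : I) (s : config) : R :=
  (nxt s j <= t)%R%:R * \sum_z om z * game_value n (move j z s).

(* Up to a relabelling of the unsettled particles, the next rings come later in [s']. *)
Definition config_le (s s' : config) := exists p : {perm I},
  [/\ occ s = occ s', forall i, (p i \in uns s') = (i \in uns s),
      forall i, i \in uns s -> pos s' (p i) = pos s i &
      forall i, i \in uns s -> nxt s i <= nxt s' (p i)].

(** Given the same innovation, [k] and its counterpart [p k] reach the same vertex and see the same
    occupied set, hence settle or not together. *)
Lemma config_le_move s s' (p : {perm I}) k z : occ s = occ s' ->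
  (forall i, (p i \in uns s') = (i \in uns s)) ->
  (forall i, i \in uns s -> pos s' (p i) = pos s i) ->
  (forall i, i \in uns s -> nxt s i <= nxt s' (p i)) ->
  k \in uns s -> config_le (move k z s) (move (p k) z s').
Proof.
move=> oE uE pE nE kA; exists p; split=> /=.
- by rewrite pE// oE.
- move=> i; rewrite pE// oE; case: ifP => // _.
  by rewrite !inE uE (inj_eq perm_inj).
- move=> i iA; rewrite !ffunE (inj_eq perm_inj) pE//.
  have {}iA : i \in uns s by move: iA; case: ifP => // _; rewrite inE => /andP[].
  by rewrite pE.
- move=> i iA; rewrite !ffunE (inj_eq perm_inj).
  have {}iA : i \in uns s by move: iA; case: ifP => // _; rewrite inE => /andP[].
  by case: eqP => [->|_]; rewrite ?lerD2r nE.
Qed.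

(** Only a common free target makes one jump feel the other: the particle that comes second then
    finds it occupied. *)
Lemma move_comm i j z z' s : i != j ->
  ~~ ((act z.1 (pos s i) == act z'.1 (pos s j)) && (act z.1 (pos s i) \notin occ s)) ->
  move j z' (move i z s) = move i z (move j z' s).
Proof.
move=> ij; have jiF : (j == i) = false by rewrite eq_sym (negbTE ij).
rewrite /move/= !ffunE (negbTE ij) jiF => col.
set y := act z.1 _ in col *; set y' := act z'.1 _ in col *.
congr Config.
- by rewrite finset.setUCA.
- rewrite !inE (eq_sym y' y); move: col.
  case: (eqVneq y y') => [->|] /=; last first.
    by case: ifP; case: ifP => // _ _ _; rewrite !finset.setDDl finset.setUC.
  by rewrite negbK => ->.
- apply/ffunP => k; rewrite !ffunE.
  by case: (eqVneq k j) => [->|//]; rewrite eq_sym (negbTE ij).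
- apply/ffunP => k; rewrite !ffunE.
  by case: (eqVneq k j) => [->|//]; rewrite eq_sym (negbTE ij).
Qed.

(* When [i] and [j] reach the same free vertex, whoever comes first settles and
   the other one stays there: the order decides which time is retained. *)
Lemma move_collide i j z z' s : i != j -> i \in uns s -> j \in uns s ->
  act z.1 (pos s i) = act z'.1 (pos s j) -> act z.1 (pos s i) \notin occ s ->
  nxt s i <= nxt s j ->
  config_le (move i z (move j z' s))
         (move j (z'.1, z.2) (move i (z.1, z'.2) s)).
Proof.
move=> ij iA jA yE yU le_ij; exists (tperm i j).
have jiF : (j == i) = false by rewrite eq_sym (negbTE ij).
rewrite /move/= !ffunE (negbTE ij) jiF -!yE !inE eqxx/= (negbTE yU).
have tE k : k != i -> k != j -> tperm i j k = k.
  by move=> ki kj; rewrite tpermD// eq_sym.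
split=> [//|k|k|k].
- rewrite !inE; have [->|ki] := eqVneq k i.
    by rewrite tpermL jA jiF ij iA.
  have [->|kj] := eqVneq k j; first by rewrite tpermR eqxx.
  by rewrite tE// ki.
- rewrite !inE !ffunE; have [->|ki] := eqVneq k i; first by rewrite tpermL eqxx.
  by have [->//|kj] := eqVneq k j; rewrite tE// (negbTE ki) (negbTE kj).
- rewrite !inE !ffunE; have [->|ki] := eqVneq k i.
    by rewrite tpermL eqxx (negbTE ij) jiF lerD2r.
  by have [->//|kj] := eqVneq k j; rewrite tE// (negbTE ki) (negbTE kj).
Qed.

(* If the earliest particle [i] is not [j], letting [j] jump before [i] leads to the
   same configuration, or to a better one when both reach the same free vertex: the
   order of the rings is the worst one. *)
Lemma game_value_mono_and_turn n :
  (forall s s', config_le s s' -> game_value n s' <= game_value n s) /\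
  (forall s j, j \in uns s -> game_value n.+1 s <= turn_value n j s).
Proof.
(* The two claims feed each other: each of them with one more turn uses the second claim with [n]
   turns to replace the earliest particle by a forced one, then monotonicity with [n] turns to
   compare the configurations reached. *)
elim: n => [|n [mono sub]]; split.
- move=> s s' [p [_ uE _ _]] /=.
  suff -> : (uns s' == finset.set0) = (uns s == finset.set0) by [].
  apply/eqP/eqP => u0; apply/finset.setP => i.
    by rewrite -uE u0 !inE.
  by have := uE ((p^-1)%g i); rewrite permKV u0 !inE.
- move=> s j jA /=; case fE : first_of => [i|]; last first.
    by move/eqP: fE; rewrite first_of_None => /eqP u0; rewrite u0 inE in jA.
  have [<-//|ij] := eqVneq i j.
  (* The only turn is spent on [i], so [j] stays unsettled and the game is lost. *)
  rewrite big1 ?mulr0; last first.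
    move=> z _; suff -> : (uns (move i z s) == finset.set0) = false by rewrite mulr0.
    apply/negbTE/finset.set0Pn; exists j; rewrite /move/=.
    by case: ifP => _; rewrite ?inE 1?eq_sym ?ij.
  rewrite /turn_value mulr_ge0// sumr_ge0// => z _.
  by rewrite mulr_ge0 ?om_ge0//= ler0n.
- move=> s s' [p [oE uE pE nE]]; rewrite [leRHS]/=.
  case fE : first_of => [k|]; last first.
    suff fE' : first_of (uns s') (nxt s') = None by rewrite /= fE'.
    apply/eqP; rewrite first_of_None.
    move/eqP: fE; rewrite first_of_None => /eqP u0; apply/eqP/setP => i.
    by have := uE ((p^-1)%g i); rewrite permKV u0 !inE.
  have [kA _] := first_ofP fE.
  (* The earliest particle of [s'] need not be [p k], but forcing [p k] to move can only raise the
     value. *)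
  apply: le_trans (sub s' (p k) _) _; first by rewrite uE.
  rewrite /turn_value; apply: ler_pM => //.
  + by apply: sumr_ge0 => z _; rewrite mulr_ge0 ?om_ge0//; elim: n {mono sub} (move _ _ _) => /= [|n IH] s1; rewrite ?ler0n//; case: first_of => // i; rewrite mulr_ge0// sumr_ge0// => z1 _; rewrite mulr_ge0 ?om_ge0.
  + have := nE k kA; case: (leP (nxt s' (p k)) t) => // h1 h2.
    by rewrite (le_trans h2 h1).
  + apply: ler_sum => z _; apply: ler_wpM2l; first exact: om_ge0.
    exact/mono/config_le_move.
- move=> s j jA; rewrite [leLHS]/=.
  case fE : first_of => [i|]; last first.
    by move/eqP: fE; rewrite first_of_None => /eqP u0; rewrite u0 inE in jA.
  have [<-//|ij] := eqVneq i j.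
  have [iA imin] := first_ofP fE.
  have jA' z : j \in uns (move i z s).
    by rewrite /move/=; case: ifP => _; rewrite ?inE 1?eq_sym ?ij.
  (* A jump of [j] only delays its own next ring, so [i] is still the earliest. Both sides thus
     consist of one jump of [i] and one of [j], in opposite orders. *)
  have fE' z' : first_of (uns (move j z' s)) (nxt (move j z' s)) = Some i.
    apply: (first_of_stable fE); rewrite /move/=.
    - by case: ifP => _; rewrite ?inE ?ij.
    - by move=> k; case: ifP => // _; rewrite inE => /andP[].
    - by rewrite ffunE (negbTE ij).
    - by move=> k; rewrite ffunE; case: eqP => [->|//]; rewrite lerDl.
  have -> : turn_value n.+1 j s = (nxt s i <= t)%R%:R * ((nxt s j <= t)%R%:R *
      \sum_z \sum_z' om z * om z' * game_value n (move i z (move j z' s))).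
    rewrite /turn_value mulrCA; congr (_ * _); rewrite exchange_big/= mulr_sumr.
    apply: eq_bigr => z' _; rewrite fE' {1}/move/= ffunE (negbTE ij).
    rewrite mulrCA; congr (_ * _); rewrite mulr_sumr; apply: eq_bigr => z _.
    by ring.
  apply: (@le_trans _ _ ((nxt s i <= t)%R%:R * ((nxt s j <= t)%R%:R *
      \sum_z \sum_z' om z * om z' * game_value n (move j z' (move i z s))))).
    apply: ler_wpM2l => //; rewrite mulr_sumr; apply: ler_sum => z _.
    apply: (le_trans (ler_wpM2l (om_ge0 z) (sub _ _ (jA' z)))).
    rewrite /turn_value {1}/move/= ffunE eq_sym (negbTE ij) mulrCA le_eqVlt.
    by apply/orP; left; apply/eqP; congr (_ * _); rewrite mulr_sumr; apply: eq_bigr => z' _; ring.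
  apply: ler_wpM2l => //; apply: ler_wpM2l => //.
  rewrite !pair_bigA/=.
  pose col (w : (F * G) * (F * G)) :=
    (act w.1.1 (pos s i) == act w.2.1 (pos s j)) && (act w.1.1 (pos s i) \notin occ s).
  rewrite (bigID col) [leRHS](bigID col)/=; apply: lerD; last first.
    by rewrite le_eqVlt; apply/orP; left; apply/eqP; apply: eq_bigr => w wc; rewrite move_comm.
  (* In a collision the two waiting times are exchanged, so that the particle that goes on waits
     [c z.2] in both orders. The weight is unchanged because [om] is a product. *)
  pose sw (w : (F * G) * (F * G)) := ((w.1.1, w.2.2), (w.2.1, w.1.2)).
  rewrite (reindex_inj (can_inj (_ : involutive sw))); last by case=> [[? ?] [? ?]].
  apply: ler_sum => -[z z'] /andP[/eqP yE yU] /=.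
  have -> : om (z.1, z'.2) * om (z'.1, z.2) = om z * om z' by rewrite /om/=; ring.
  apply: ler_wpM2l; first by rewrite mulr_ge0 ?om_ge0.
  by apply/mono/move_collide => //; exact: imin.
Qed.

Lemma game_value_le_turn n s j : j \in uns s -> game_value n.+1 s <= turn_value n j s.
Proof. exact: (game_value_mono_and_turn n).2. Qed.

End game.

(** * The jump-by-jump process and what it reads *)

Section cunif_general.
Variables (R : realType) (V : finType).
Local Notation I := 'I_#|V|.
Implicit Types (x : I -> nat -> V) (a : I -> nat -> R) (s : state V).

Lemma next_particleE a s : next_particle a s =
  first_of (~: s.2)%SET (fun i => ring_time a i (s.1 i).+1).
Proof.
rewrite /next_particle /first_of; apply: eq_pick => i /=.
by rewrite inE; congr (_ && _); apply: eq_forallb => j; rewrite inE.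
Qed.

Lemma next_particle_unsettled a s i : next_particle a s = Some i -> i \notin s.2.
Proof. by rewrite next_particleE => /first_ofP[]; rewrite inE. Qed.

Lemma next_particle_None a s : (next_particle a s == None) = (s.2 == [set: I]%SET).
Proof.
by rewrite next_particleE first_of_None -finset.setCT (inj_eq (@finset.setC_inj _)).
Qed.

Lemma cunif_step_settled x a s : s.2 = [set: I]%SET -> cunif_step x a s = s.
Proof.
move=> sT; rewrite /cunif_step.
by have /eqP -> : next_particle a s == None by rewrite next_particle_None sT.
Qed.

Lemma cunif_stateS x a m : cunif_state x a m.+1 = cunif_step x a (cunif_state x a m).
Proof. by []. Qed.

Lemma cunif_state_settled x a m m' : (m <= m')%N ->
  (cunif_state x a m).2 = [set: I]%SET -> cunif_state x a m' = cunif_state x a m.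
Proof.
move=> /subnKC <- sT; elim: (_ - _)%N => [|d IH]; first by rewrite addn0.
by rewrite addnS cunif_stateS IH cunif_step_settled.
Qed.

Lemma cunif_step_count x a s i : (s.1 i <= (cunif_step x a s).1 i)%N.
Proof.
rewrite /cunif_step; case: next_particle => [j|//] /=.
by rewrite ffunE; case: eqP => [->|_]; rewrite ?leqnSn.
Qed.

Lemma cunif_state_count x a m m' i : (m <= m')%N ->
  ((cunif_state x a m).1 i <= (cunif_state x a m').1 i)%N.
Proof.
move=> /subnKC <-; elim: (_ - _)%N => [|d IH]; first by rewrite addn0.
by rewrite addnS cunif_stateS (leq_trans IH) ?cunif_step_count.
Qed.

Lemma cunif_state_le x a m i : ((cunif_state x a m).1 i <= m)%N.
Proof.
elim: m => [|m IH]; first by rewrite /cunif_state/= ffunE.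
rewrite cunif_stateS /cunif_step; case: next_particle => [j|] /=.
  by rewrite ffunE; case: eqP => [<-|_]; rewrite ?ltnS// leqW.
exact: leqW.
Qed.

Lemma eq_ring_time a a' i k : (forall l, (l < k)%N -> a i l = a' i l) ->
  ring_time a i k = ring_time a' i k.
Proof. by move=> aa'; apply: eq_bigr => l _; rewrite aa'. Qed.

Lemma ring_timeS a i k : ring_time a i k.+1 = ring_time a i k + a i k.
Proof. by rewrite /ring_time big_ord_recr. Qed.

Lemma eq_next_particle a a' s :
  (forall i, ring_time a i (s.1 i).+1 = ring_time a' i (s.1 i).+1) ->
  next_particle a s = next_particle a' s.
Proof.
move=> aa'; apply: eq_pick => i /=; congr (_ && _).
by apply: eq_forallb => j; rewrite !aa'.
Qed.

Lemma eq_occupied x x' s : (forall i, i \in s.2 -> x i (s.1 i) = x' i (s.1 i)) ->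
  occupied x s = occupied x' s.
Proof.
move=> xx'; apply/finset.setP => u; apply/imsetP/imsetP => -[i iA ->];
  by exists i; rewrite ?xx'.
Qed.

(** A run is determined by what it has read: trajectories up to the current counts, and waiting
    times up to the next rings that were compared. Hence the first cell not yet read can be redrawn
    without altering the past. *)
Lemma cunif_state_local x x' a a' m :
  (forall i l, (l <= (cunif_state x a m).1 i)%N -> x i l = x' i l) ->
  (forall i l, (l < (cunif_state x a m).1 i)%N -> a i l = a' i l) ->
  (forall k i, (k < m)%N -> i \notin (cunif_state x a k).2 ->
     ring_time a i ((cunif_state x a k).1 i).+1 =
     ring_time a' i ((cunif_state x a k).1 i).+1) ->
  cunif_state x a m = cunif_state x' a' m.
Proof.
elim: m => [//|m IH] xx' aa' rr'.
have le_m i := cunif_state_count x a i (leqnSn m).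
rewrite !cunif_stateS -IH; first last.
- by move=> k i km; apply: rr'; rewrite ltnW.
- by move=> i l lm; apply: aa'; rewrite (leq_trans lm)// le_m.
- by move=> i l lm; apply: xx'; rewrite (leq_trans lm)// le_m.
have Nn : next_particle a (cunif_state x a m) = next_particle a' (cunif_state x a m).
  apply: eq_pick => i /=; case: (boolP (i \in _)) => //= iU.
  apply: eq_forallb => j; case: (boolP (j \in _)) => //= jU.
  by rewrite !rr'.
have xx'm i l : (l <= (cunif_step x a (cunif_state x a m)).1 i)%N -> x i l = x' i l := xx' i l.
clear xx' rr' aa'; move: xx'm; rewrite /cunif_step -Nn.
case: next_particle => [j|//] /= xx'.
rewrite (xx' j) ?ffunE ?eqxx//; rewrite (@eq_occupied x x')// => i _; apply: xx'.
by rewrite ffunE; case: eqP => // ->.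
Qed.

End cunif_general.

(** * Arrays of innovations, and the exchange carried out along a run *)

Section resampling.
Variables (R : realType) (J Z : finType) (om : Z -> R).
Hypothesis om1 : \sum_z om z = 1.

Definition update_cell (q : {ffun J -> Z}) (p : J) (z : Z) : {ffun J -> Z} :=
  [ffun k => if k == p then z else q k].

Definition weight (q : {ffun J -> Z}) : R := \prod_p om (q p).

Lemma weight_update_cell q p z : weight (update_cell q p z) * om (q p) = weight q * om z.
Proof.
rewrite /weight (bigD1 p)//= [in RHS](bigD1 p)//= ffunE eqxx.
rewrite (eq_bigr (fun k => om (q k))); last by move=> k /negbTE kp; rewrite ffunE kp.
by ring.
Qed.

(* Exchanging the new value [z] with the one stored in the cell preserves the weight. *)
Lemma resample (next_cell : {ffun J -> Z} -> J) (Psi : {ffun J -> Z} -> R) :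
  (forall q z, next_cell (update_cell q (next_cell q) z) = next_cell q) ->
  \sum_q weight q * Psi q = \sum_q weight q * \sum_z om z * Psi (update_cell q (next_cell q) z).
Proof.
(* By [locE] the cell is chosen without looking at its content, so it is still the chosen one after
   the swap; this makes [h] an involution. *)
move=> locE; pose h (w : {ffun J -> Z} * Z) := (update_cell w.1 (next_cell w.1) w.2, w.1 (next_cell w.1)).
have hK : involutive h.
  case=> q z; rewrite /h/= locE ffunE eqxx; congr pair.
  by apply/ffunP => k; rewrite !ffunE; case: eqP => // ->.
transitivity (\sum_w weight w.1 * om w.2 * Psi w.1).
  rewrite -(pair_bigA _ (fun q z => weight q * om z * Psi q))/=.
  apply: eq_bigr => q _; rewrite -mulr_suml -mulr_sumr om1; ring.
rewrite (reindex_inj (can_inj hK)) /= -(pair_bigA _ (fun q z =>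
  weight (update_cell q (next_cell q) z) * om (q (next_cell q)) * Psi (update_cell q (next_cell q) z)))/=.
apply: eq_bigr => q _; rewrite mulr_sumr; apply: eq_bigr => z _.
by rewrite weight_update_cell mulrA.
Qed.

End resampling.

Section domination.
Variables (R : realType) (V F G : finType).
Local Notation I := 'I_#|V|.
Variables (omF : F -> R) (omG : G -> R) (act : F -> V -> V) (v : V).
Hypotheses (omF0 : forall f, 0 <= omF f) (omG0 : forall g, 0 <= omG g).
Hypotheses (omF1 : \sum_f omF f = 1) (omG1 : \sum_g omG g = 1).
Variables (T : nat) (t : R).
Local Notation J := (I * 'I_T.+1)%type.
Local Notation arr := {ffun J -> F * G}.
Local Notation om := (om omF omG).
Implicit Types (q : arr) (c : G -> R) (s : state V).

(** Cell [(i, l)] holds the map of the [l]-th jump of [i] together with its waiting time after the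
    [l]-th ring. A jump thus reads exactly one new cell, just as [move] consumes one [z]. *)
Fixpoint walk q (i : I) (l : nat) : V :=
  if l is l'.+1 then act (q (i, inord l)).1 (walk q i l') else v.

Definition clock c q (i : I) (l : nat) : R := c (q (i, inord l)).2.

Lemma om_sum1 : \sum_z om z = 1.
Proof.
rewrite -(pair_bigA _ (fun f g => omF f * omG g))/=.
by under eq_bigr do rewrite -mulr_sumr omG1 mulr1.
Qed.

Definition jump_state c q k := cunif_state (walk q) (clock c q) k.

Definition config_of c q s : config R V I := Config (occupied (walk q) s) (~: s.2)%SET
  [ffun i => walk q i (s.1 i)] [ffun i => ring_time (clock c q) i (s.1 i).+1].

Definition intime c q s : bool := [forall i, ring_time (clock c q) i (s.1 i) <= t].

(** When all particles are settled there is nothing to read, and a cell of the last column is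
    returned: it has not been read, since at most [k < T] jumps were made. *)
Definition next_cell c k q : J :=
  let s := jump_state c q k in
  if next_particle (clock c q) s is Some j then (j, inord (s.1 j).+1)
  else (enum_rank v, ord_max).

Lemma inord_neq k l : (k < l <= T)%N -> inord k == inord l :> 'I_T.+1 = false.
Proof.
move=> /andP[kl lT]; apply/negbTE/eqP => /(congr1 (@nat_of_ord _)).
by rewrite !inordK ?ltnS// ?(leq_trans (ltnW kl))// => kE; rewrite kE ltnn in kl.
Qed.

Lemma eq_walk q q' i l :
  (forall k, (0 < k <= l)%N -> q (i, inord k) = q' (i, inord k)) ->
  walk q i l = walk q' i l.
Proof.
elim: l => //= l IH qq'; rewrite qq' ?ltnS ?leqnn// IH// => k /andP[k0 kl].
by rewrite qq'// k0 leqW.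
Qed.

Lemma eq_ring_clock c q q' i l :
  (forall k, (k < l)%N -> q (i, inord k) = q' (i, inord k)) ->
  ring_time (clock c q) i l = ring_time (clock c q') i l.
Proof. by move=> qq'; apply: eq_ring_time => k kl; rewrite /clock qq'. Qed.

Lemma next_cell_fresh c k q i l z : (k < T)%N -> (l <= (jump_state c q k).1 i)%N ->
  update_cell q (next_cell c k q) z (i, inord l) = q (i, inord l).
Proof.
move=> kT li; rewrite /update_cell ffunE /next_cell.
have lk j : ((jump_state c q k).1 j <= k)%N by exact: cunif_state_le.
case: next_particle => [j|].
  rewrite xpair_eqE; case: (eqVneq i j) => [ij|//]; subst j => /=.
  by rewrite inord_neq// ltnS li (leq_ltn_trans (lk i)).
rewrite xpair_eqE -[ord_max]inord_val /= inord_neq ?andbF//.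
by rewrite leqnn andbT (leq_ltn_trans li)// (leq_ltn_trans (lk i)).
Qed.

Lemma fresh_walk c k q i l z : (k < T)%N -> (l <= (jump_state c q k).1 i)%N ->
  walk (update_cell q (next_cell c k q) z) i l = walk q i l.
Proof.
move=> kT li; apply: eq_walk => n /andP[_ nl].
by rewrite (@next_cell_fresh _ _ _ _ n)// (leq_trans nl).
Qed.

Lemma fresh_clock c c' k q i l z : (k < T)%N -> (l <= (jump_state c q k).1 i)%N ->
  clock c' (update_cell q (next_cell c k q) z) i l = clock c' q i l.
Proof. by move=> kT li; rewrite /clock next_cell_fresh. Qed.

Lemma fresh_ring c c' k q i l z : (k < T)%N -> (l <= ((jump_state c q k).1 i).+1)%N ->
  ring_time (clock c' (update_cell q (next_cell c k q) z)) i l = ring_time (clock c' q) i l.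
Proof.
move=> kT li; apply: eq_ring_clock => n nl.
by rewrite (@next_cell_fresh _ _ _ _ n)// -ltnS (leq_trans nl).
Qed.

Lemma fresh_jump_state c k q z : (k < T)%N -> jump_state c (update_cell q (next_cell c k q) z) k = jump_state c q k.
Proof.
move=> kT; apply/esym/cunif_state_local.
- by move=> i l li; rewrite fresh_walk.
- by move=> i l li; rewrite (@fresh_clock c)// ltnW.
- move=> k' i kk' _; rewrite (@fresh_ring c)// ltnS.
  by apply: cunif_state_count; exact: ltnW.
Qed.

Lemma fresh_next c k q z : (k < T)%N ->
  next_particle (clock c (update_cell q (next_cell c k q) z)) (jump_state c q k) =
  next_particle (clock c q) (jump_state c q k).
Proof. by move=> kT; apply: eq_next_particle => i; rewrite (@fresh_ring c). Qed.

Lemma fresh_next_cell c k q z : (k < T)%N -> next_cell c k (update_cell q (next_cell c k q) z) = next_cell c k q.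
Proof. by move=> kT; rewrite {1}/next_cell fresh_jump_state// fresh_next. Qed.

Lemma config_of_step c c' k q z j : (k < T)%N ->
  next_particle (clock c q) (jump_state c q k) = Some j ->
  let q' := update_cell q (next_cell c k q) z in
  config_of c' q' (jump_state c q' k.+1) = move act c' j z (config_of c' q (jump_state c q k)).
Proof.
move=> kT nj q'; have jU := next_particle_unsettled nj.
have q'E : q' (j, inord ((jump_state c q k).1 j).+1) = z.
  by rewrite /q' /update_cell /next_cell nj ffunE eqxx.
have xE : walk q' j ((jump_state c q k).1 j).+1 = act z.1 (walk q j ((jump_state c q k).1 j)).
  by rewrite /= q'E fresh_walk.
have oE : occupied (walk q') (jump_state c q k) = occupied (walk q) (jump_state c q k).
  by apply: eq_occupied => i _; rewrite fresh_walk.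
have -> : jump_state c q' k.+1 = cunif_step (walk q') (clock c q') (jump_state c q k).
  by rewrite -(fresh_jump_state c q z kT).
rewrite /cunif_step fresh_next// nj xE oE /move /config_of/= ffunE.
have neqj i : i \in (jump_state c q k).2 -> (i == j) = false.
  by move=> iS; apply: contraNF jU => /eqP <-.
congr Config.
- case: ifP => [yU|yU].
    rewrite (finset.setUidPr _) ?finset.sub1set// -oE; apply/finset.setP => u.
    by apply/imsetP/imsetP => -[i iS ->]; exists i => //; rewrite /= ?ffunE neqj.
  apply/finset.setP => u; rewrite !inE; apply/imsetP/idP => /=.
    move=> [i]; rewrite !inE => /orP[/eqP-> ->|iS ->]; rewrite ffunE.
      by rewrite eqxx xE eqxx.
    by rewrite neqj// -oE; apply/orP; right; apply/imsetP; exists i.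
  move=> /orP[/eqP->|]; first by exists j; rewrite ?inE ?eqxx// ffunE eqxx xE.
  by rewrite -oE => /imsetP[i iS ->]; exists i; rewrite ?inE ?iS ?orbT// ffunE neqj.
- by case: ifP => // _; apply/finset.setP => i; rewrite !inE negb_or.
- apply/ffunP => i; rewrite !ffunE; case: eqP => [->|_]; last by rewrite fresh_walk.
  exact: xE.
- apply/ffunP => i; rewrite !ffunE; case: eqP => [->|_]; last by rewrite (@fresh_ring c).
  by rewrite ring_timeS (@fresh_ring c)// {2}/clock q'E.
Qed.

(** The ring times of a particle are nondecreasing, so checking the new ring of [j] also covers its
    earlier ones. *)
Lemma intime_step c c' k q z j : (forall g, 0 <= c' g) -> (k < T)%N ->
  next_particle (clock c q) (jump_state c q k) = Some j ->
  let q' := update_cell q (next_cell c k q) z in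
  intime c' q' (jump_state c q' k.+1) =
  intime c' q (jump_state c q k) && (nxt (config_of c' q (jump_state c q k)) j <= t).
Proof.
move=> c'0 kT nj q'; rewrite /= ffunE.
rewrite {2}/q' fresh_jump_state// /cunif_step fresh_next// nj /=.
apply/forallP/andP => /= [H|[/forallP H Hj] i].
  have Hj : ring_time (clock c' q) j ((jump_state c q k).1 j).+1 <= t.
    by have := H j; rewrite ffunE eqxx (@fresh_ring c).
  split => //; apply/forallP => i; have := H i; rewrite ffunE.
  case: eqP => [-> _|_]; last by rewrite (@fresh_ring c)// leqW.
  by apply: le_trans Hj; rewrite ring_timeS lerDl c'0.
rewrite ffunE; case: eqP => [->|_]; first by rewrite (@fresh_ring c).
by rewrite (@fresh_ring c) ?leqW.
Qed.

(* The first [k] jumps follow the clocks [c] and the next [n] the clocks [c'], which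
   measure the time in both cases. *)
Definition stage c c' n k : R := \sum_(q : arr) weight om q *
  ((intime c' q (jump_state c q k))%:R * game_value omF omG act c' t n (config_of c' q (jump_state c q k))).

Lemma game_value_settled c n (s : config R V I) : uns s = finset.set0 -> game_value omF omG act c t n s = 1.
Proof.
move=> u0; case: n => [|n] /=; first by rewrite u0 eqxx.
by have /eqP-> : first_of (uns s) (nxt s) == None by rewrite first_of_None u0.
Qed.

Lemma stage_resample c c' n k : (k < T)%N ->
  stage c c' n k.+1 = \sum_(q : arr) weight om q * \sum_z om z *
   ((intime c' (update_cell q (next_cell c k q) z) (jump_state c (update_cell q (next_cell c k q) z) k.+1))%:R *
    game_value omF omG act c' t n (config_of c' (update_cell q (next_cell c k q) z) (jump_state c (update_cell q (next_cell c k q) z) k.+1))).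
Proof.
move=> kT; rewrite /stage (resample om_sum1 (next_cell := next_cell c k))// => q z.
exact: fresh_next_cell.
Qed.

Lemma stage_turn c c' n k q : (forall g, 0 <= c' g) -> (k < T)%N ->
  \sum_z om z *
   ((intime c' (update_cell q (next_cell c k q) z) (jump_state c (update_cell q (next_cell c k q) z) k.+1))%:R *
    game_value omF omG act c' t n (config_of c' (update_cell q (next_cell c k q) z) (jump_state c (update_cell q (next_cell c k q) z) k.+1))) =
  (intime c' q (jump_state c q k))%:R *
   (if next_particle (clock c q) (jump_state c q k) is Some j
    then turn_value omF omG act c' t n j (config_of c' q (jump_state c q k)) else 1).
Proof.
move=> c'0 kT; case nj : next_particle => [j|].
  rewrite /turn_value mulrA -natrM mulnb mulr_sumr; apply: eq_bigr => z _.
  by rewrite (intime_step _ c'0 kT nj) (config_of_step _ _ kT nj); ring.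
move/eqP: (nj); rewrite next_particle_None => /eqP sT.
have stE z : jump_state c (update_cell q (next_cell c k q) z) k.+1 = jump_state c q k.
  by rewrite -[LHS]/(cunif_step _ _ (jump_state c _ k)) fresh_jump_state// cunif_step_settled.
under eq_bigr => z _.
  rewrite stE game_value_settled ?mulr1; last by rewrite /= sT finset.setCT.
  rewrite (_ : intime _ _ _ = intime c' q (jump_state c q k)); last first.
    by apply: eq_forallb => i; rewrite (@fresh_ring c)// leqW.
  over.
by rewrite -mulr_suml om_sum1 mul1r mulr1.
Qed.

Lemma weight_ge0 q : 0 <= weight om q.
Proof. by apply: prodr_ge0 => p _; exact: om_ge0. Qed.

(** For the game measured by [c'], the particle designated by [c] makes a forced move, which is at
    least as good as a move of the earliest one. When [c = c'] the two particles coincide, whence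
    the equality in [stage_eq]. *)
Lemma stage_le c c' n k : (forall g, 0 <= c' g) -> (k < T)%N ->
  stage c c' n.+1 k <= stage c c' n k.+1.
Proof.
move=> c'0 kT; rewrite stage_resample//; apply: ler_sum => q _.
rewrite stage_turn// ler_wpM2l ?weight_ge0// ler_wpM2l ?ler0n//.
case nj : next_particle => [j|].
  by apply: game_value_le_turn => //; rewrite inE (next_particle_unsettled nj).
move/eqP: (nj); rewrite next_particle_None => /eqP sT.
by rewrite game_value_settled//= sT finset.setCT.
Qed.

Lemma stage_eq c n k : (forall g, 0 <= c g) -> (k < T)%N ->
  stage c c n.+1 k = stage c c n k.+1.
Proof.
move=> c0 kT; rewrite stage_resample//; apply: eq_bigr => q _.
rewrite stage_turn//; do 2 congr (_ * _).
rewrite next_particleE /=.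
rewrite (_ : first_of _ [ffun i => ring_time (clock c q) i ((jump_state c q k).1 i).+1] =
  first_of (~: (jump_state c q k).2)%SET (fun i => ring_time (clock c q) i ((jump_state c q k).1 i).+1))//.
by apply: eq_pick => i /=; congr (_ && _); apply: eq_forallb => j; rewrite !ffunE.
Qed.

Lemma stage_last c c' m : stage c c' 0 m = \sum_(q : arr) weight om q *
  (((jump_state c q m).2 == [set: I]%SET) && intime c' q (jump_state c q m))%:R.
Proof.
apply: eq_bigr => q _; congr (_ * _); rewrite -natrM mulnb /= andbC.
by rewrite -finset.setCT (inj_eq (@finset.setC_inj _)).
Qed.

Theorem domination_arr c c' m : (forall g, 0 <= c' g) -> (m <= T)%N ->
  \sum_(q : arr) weight om q *
    (((jump_state c' q m).2 == [set: I]%SET) && intime c' q (jump_state c' q m))%:R <=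
  \sum_(q : arr) weight om q *
    (((jump_state c q m).2 == [set: I]%SET) && intime c' q (jump_state c q m))%:R.
Proof.
move=> c'0 mT; rewrite -!stage_last.
have stE k : (k <= m)%N -> stage c' c' (m - k) k = stage c' c' m 0.
  elim: k => [|k IH] km; first by rewrite subn0.
  by rewrite -IH ?(ltnW km)// -[in RHS](subnSK km) stage_eq// (leq_trans km).
have stL k : (k <= m)%N -> stage c c' m 0 <= stage c c' (m - k) k.
  elim: k => [|k IH] km; first by rewrite subn0.
  by rewrite (le_trans (IH (ltnW km)))// -(subnSK km) stage_le// (leq_trans km).
(* Before the first jump the two orders cannot be told apart: [stage c c' m 0] and [stage c' c' m 0]
   are convertible. *)
by have := stE _ (leqnn m); have := stL _ (leqnn m); rewrite !subnn => h ->.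
Qed.

End domination.

Local Open Scope classical_set_scope.
Local Open Scope ring_scope.

(** * From finite arrays of innovations to walks and exponential clocks *)

Section expo.
Variable R : realType.

(* The exponential law of rate 1, on the canonical measurable space of [R]. *)
Definition expo (A : set R) : \bar R := exponential_prob 1 A.

Let ex :=
  @exponential_distribution_exponential_prob__canonical__probability_measure_Probability
    R 1 ltr01.
Let expo0 : expo set0 = 0%E. Proof. exact: (measure0 ex). Qed.
Let expo_ge0 A : (0 <= expo A)%E. Proof. exact: (measure_ge0 ex). Qed.
Let expo_sigma : semi_sigma_additive expo.
Proof. exact: (@measure_semi_sigma_additive _ _ _ ex). Qed.
HB.instance Definition _ := isMeasure.Build _ _ _ expo expo0 expo_ge0 expo_sigma.
Let expoT : expo setT = 1%E. Proof. exact: (probability_setT ex). Qed.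
HB.instance Definition _ := Measure_isProbability.Build _ _ R expo expoT.
End expo.
Arguments expo R : clear implicits.

Lemma probability_finType d (O : measurableType d) (R : realType)
    (P : probability O R) (U : finType) (X : O -> U) (Q : pred U) :
  (forall u, measurable [set w | X w = u]) ->
  P [set w | Q (X w)] = (\sum_(u | Q u) P [set w | X w = u])%E.
Proof.
move=> mX.
have -> : [set w | Q (X w)] = \bigcup_(u in [set u | Q u]) [set w | X w = u].
  by apply/seteqP; split => [w Qw|w [u Qu /= ->]//]; exists (X w).
rewrite measure_fin_bigcup//; [|exact: finite_finset|].  2: {
  apply/trivIsetP => u u' _ _ uu'; apply/seteqP; split => // w [/= uE u'E].
  by move: uu'; rewrite -uE -u'E eqxx. }
rewrite (@fsbigE _ _ _ _ _ (enum Q)) ?enum_uniq//.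
- rewrite big_enum_cond/=; apply: eq_bigl => u.
  by rewrite mem_setE andbb.
- by move=> u; rewrite /= mem_enum.
- by move=> u Qu; rewrite mem_enum => /negP; case.
Qed.

Lemma measurable_finType_pred d (O : measurableType d) (U : finType) (X : O -> U)
    (Q : pred U) :
  (forall u, measurable [set w | X w = u]) -> measurable [set w | Q (X w)].
Proof.
move=> mX.
have -> : [set w | Q (X w)] = \bigcup_(u in [set u | Q u]) [set w | X w = u].
  by apply/seteqP; split => [w Qw|w [u Qu /= ->]//]; exists (X w).
by apply: fin_bigcup_measurable => //; exact: finite_finset.
Qed.

Lemma prod_nat_forall (U : finType) (b : pred U) :
  (\prod_u b u)%N = [forall u, b u] :> nat.
Proof.
have [/forallP H|] := boolP [forall u, b u]; first by rewrite big1// => u _; rewrite H.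
by rewrite negb_forall => /existsP[u /negbTE bu]; rewrite (bigD1 u)//= bu mul0n.
Qed.

Section srw.
Variables (R : realType) (V : finType) (e : rel V).

Lemma srw_ge0 x y : 0 <= srw e x y :> R.
Proof. by rewrite /srw; case: ifP => // _; rewrite divr_ge0. Qed.

Lemma srw_sum1 x : \sum_y srw e x y = 1 :> R.
Proof.
rewrite /srw; have [d0|d0] := eqVneq (deg e x) 0%N.
  rewrite (bigD1 x)//= eqxx big1 ?addr0// => y /negbTE.
  by rewrite eq_sym => ->.
rewrite -mulr_suml -natr_sum (_ : (\sum_y _)%N = deg e x) ?divff ?pnatr_eq0//.
rewrite /deg -sum1_card [RHS]big_mkcond; apply: eq_bigr => y _.
by rewrite inE; case: (e x y).
Qed.

(* The walks are driven by independent random maps [V -> V], so that the source of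
   randomness of a jump does not depend on the current position. *)
Definition map_weight (f : {ffun V -> V}) : R := \prod_x srw e x (f x).

Lemma map_weight_ge0 f : 0 <= map_weight f.
Proof. by apply: prodr_ge0 => x _; exact: srw_ge0. Qed.

Lemma map_weight_sum1 : \sum_f map_weight f = 1.
Proof.
by rewrite -(bigA_distr_bigA (fun x y => srw e x y)) big1// => x _; exact: srw_sum1.
Qed.

Lemma map_weight_at x y : \sum_f map_weight f * (f x == y)%:R = srw e x y.
Proof.
pose F z u : R := srw e z u * (if z == x then (u == y)%:R else 1).
transitivity (\sum_(f : {ffun V -> V}) \prod_z F z (f z)).
  apply: eq_bigr => f _; rewrite big_split/=; congr (_ * _).
  by rewrite (bigD1 x)//= eqxx big1 ?mulr1// => z /negbTE ->.
rewrite -bigA_distr_bigA (bigD1 x)//= [X in _ * X]big1 ?mulr1; last first.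
  by move=> z /negbTE zx; rewrite /F zx; under eq_bigr do rewrite mulr1; exact: srw_sum1.
rewrite /F eqxx (bigD1 y)//= eqxx mulr1 big1 ?addr0// => z /negbTE ->.
by rewrite mulr0.
Qed.

End srw.

Section transfer.
Variables (R : realType) (V : finType) (e : rel V) (v : V).
Local Notation I := 'I_#|V|.
Variables (d : measure_display) (O : measurableType d) (P : probability O R).
Variables (Y : I -> nat -> O -> V) (S : I -> nat -> O -> R).
Hypothesis YS : indep_walks_clocks P e v Y S.
Variables (G : finType) (D : R -> G).
Hypothesis mD : forall g, measurable (D @^-1` [set g]).

Definition mark_weight (g : G) : R := fine (expo R (D @^-1` [set g])).

Lemma mark_weight_ge0 g : 0 <= mark_weight g.
Proof. exact: fine_ge0. Qed.

Lemma mark_weightE g : exponential_prob 1 (D @^-1` [set g]) = (mark_weight g)%:E.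
Proof.
by rewrite /mark_weight fineK//; apply: fin_num_measure; exact: mD.
Qed.

Lemma mark_weight_sum1 : \sum_g mark_weight g = 1.
Proof.
apply: EFin_inj; rewrite -sumEFin; under eq_bigr do rewrite -mark_weightE.
have := @probability_finType _ _ _ (expo R) _ D xpredT mD.
by rewrite (_ : [set w | _] = setT)// => [<-|]; [exact: probability_setT|exact/seteqP].
Qed.

Variable T : nat.
Local Notation J := (I * 'I_T.+2)%type.
Local Notation arr := {ffun J -> {ffun V -> V} * G}.
Local Notation om := (om (map_weight R e) mark_weight).
Local Notation walk := (walk (fun f : {ffun V -> V} => f : V -> V) v).

(** The two index ranges are those of [indep_walks_clocks] for [m = T.+1]: positions at times up to
    [T.+1], but only the waiting times of index less than [T.+1]. The marks in the last column of an
    array are therefore summed out. *)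
Definition paths (w : O) : {ffun J -> V} := [ffun p : J => Y p.1 p.2 w].
Definition marks (w : O) : {ffun I * 'I_T.+1 -> G} := [ffun p : I * 'I_T.+1 => D (S p.1 p.2 w)].
Definition arr_paths (q : arr) : {ffun J -> V} := [ffun p : J => walk q p.1 p.2].
Definition arr_marks (q : arr) : {ffun I * 'I_T.+1 -> G} :=
  [ffun p : I * 'I_T.+1 => (q (p.1, widen_ord (leqnSn _) p.2)).2].

Definition data_weight (u : {ffun J -> V} * {ffun I * 'I_T.+1 -> G}) : R :=
  (\prod_i path_prob e v T.+1 (fun t => u.1 (i, inord t))) *
  \prod_p mark_weight (u.2 p).

Lemma paths_marks_law u : measurable [set w | (paths w, marks w) = u] /\
  P [set w | (paths w, marks w) = u] = (data_weight u)%:E.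
Proof.
have [mY mS PYS] := YS.
pose B (i : I) (k : nat) := D @^-1` [set u.2 (i, inord k)].
have E : [set w | (paths w, marks w) = u] =
  [set w | (forall i t, (t <= T.+1)%N -> Y i t w = u.1 (i, inord t)) /\
           (forall i k, (k < T.+1)%N -> B i k (S i k w))].
  rewrite /B {B}; apply/seteqP; split => w /=.
    by move=> <-/=; split=> i t tT; rewrite ffunE/= inordK.
  case: u => u1 u2 [/= uY uS]; congr pair; apply/ffunP => -[i t]; rewrite ffunE/=.
    by rewrite uY ?inord_val// -ltnS.
  by rewrite uS// inord_val.
split.
  rewrite E (_ : [set w | _ /\ _] =
     (\bigcap_(i in setT) \bigcap_(t in [set t | (t <= T.+1)%N])
        [set w | Y i t w = u.1 (i, inord t)]) `&`
     (\bigcap_(i in setT) \bigcap_(k in [set k | (k < T.+1)%N])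
        (S i k @^-1` B i k))); last first.
    by apply/seteqP; split => w [H1 H2]; split => i; [move=> _ t|move=> _ t|move=> t|move=> t] => ?;
      [exact: H1|exact: H2|exact: H1|exact: H2].
  apply: measurableI; apply: fin_bigcap_measurable => // i _;
    apply: bigcap_measurableType => t _; first exact: mY.
  by rewrite -[X in measurable X]setTI; apply: mS => //; exact: mD.
rewrite E PYS; last by move=> i k; exact: mD.
rewrite /data_weight EFinM; congr (_ * _)%E.
rewrite (eq_bigr (fun p => mark_weight (u.2 (p.1, p.2)))); last by case.
rewrite -(pair_bigA _ (fun i k => mark_weight (u.2 (i, k))))/= -prodEFin.
apply: eq_bigr => i _; rewrite -prodEFin; apply: eq_bigr => k _.
by rewrite /B mark_weightE inord_val.
Qed.

Lemma arr_paths_marks_law u :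
  \sum_(q : arr) weight om q * ((arr_paths q, arr_marks q) == u)%:R = data_weight u.
Proof.
case: u => p g; rewrite /data_weight/=.
under [X in X * _]eq_bigr do rewrite /path_prob.
rewrite big_split/=.
have [p0|] := boolP [forall i, p (i, inord 0) == v]; last first.
  rewrite negb_forall => /existsP[i pi]; rewrite (bigD1 i)//= (negbTE pi) !mul0r.
  rewrite big1// => q _; case: eqP => [[pE _]|]; last by rewrite mulr0.
  by move: pi; rewrite -pE ffunE/= inordK// eqxx.
rewrite [X in _ = X * _ * _]big1 ?mul1r; last by move=> i _; rewrite (forallP p0).
(* For a fixed target [p] the event factorizes over the cells: the walk follows [p] exactly when
   each map sends the previous vertex of [p] to the next one. *)
pose cond1 (x : J) (f : {ffun V -> V}) : bool :=
  if nat_of_ord x.2 is n'.+1 then f (p (x.1, inord n')) == p x else true.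
pose cond2 (x : J) (h : G) : bool := (x.2 < T.+1)%N ==> (h == g (x.1, inord x.2)).
pose cell (x : J) (z : {ffun V -> V} * G) : R := om z * ((cond1 x z.1)%:R * (cond2 x z.2)%:R).
transitivity (\sum_(q : arr) \prod_x cell x (q x)).
  apply: eq_bigr => q _; rewrite /cell big_split/=; congr (_ * _).
  rewrite xpair_eqE -mulnb natrM big_split/= -!natr_prod; congr (_ * _).
    have walkE : (arr_paths q == p) = [forall x, cond1 x (q x).1].
      apply/eqP/forallP => [pE [i [[//|n] nT]]|H].
        rewrite /cond1 /= -pE !ffunE/= inordK; last by rewrite ltnW.
        by rewrite (_ : inord n.+1 = Ordinal nT)//; apply: val_inj; rewrite /= inordK.
      apply/ffunP => -[i t]; rewrite ffunE/=.
      suff : forall n, (n < T.+2)%N -> walk q i n = p (i, inord n).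
        by move=> /(_ t (ltn_ord t)) ->; rewrite inord_val.
      elim => [_|n IH nT] /=; first by rewrite (eqP (forallP p0 i)).
      rewrite IH ?(ltnW nT)//; have := H (i, Ordinal nT); rewrite /cond1/= => /eqP.
      by rewrite (_ : inord n.+1 = Ordinal nT)//; apply: val_inj; rewrite /= inordK.
    by rewrite walkE prod_nat_forall.
  have markE : (arr_marks q == g) = [forall x, cond2 x (q x).2].
    apply/eqP/forallP => [gE [i t]|H].
      rewrite /cond2/=; apply/implyP => tT; rewrite -gE ffunE/=.
      by rewrite (_ : widen_ord _ _ = t)//; apply: val_inj; rewrite /= inordK.
    apply/ffunP => -[i t]; rewrite ffunE/=.
    by have := H (i, widen_ord (leqnSn _) t); rewrite /cond2/= ltn_ord/= inord_val => /eqP.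
  by rewrite markE prod_nat_forall.
rewrite -bigA_distr_bigA.
have cellE x : \sum_z cell x z =
    (\sum_f map_weight R e f * (cond1 x f)%:R) * (\sum_h mark_weight h * (cond2 x h)%:R).
  rewrite mulr_suml (eq_bigr (fun z => cell x (z.1, z.2))); last by case.
  rewrite -(pair_bigA _ (fun f h => cell x (f, h)))/=.
  apply: eq_bigr => f _; rewrite mulr_sumr; apply: eq_bigr => h _.
  by rewrite /cell /om/=; ring.
under eq_bigr do rewrite cellE.
rewrite big_split/=; congr (_ * _).
  rewrite (eq_bigr (fun p => \sum_f map_weight R e f * (cond1 (p.1, p.2) f)%:R)); last by case.
  rewrite -(pair_bigA _ (fun i t => \sum_f map_weight R e f * (cond1 (i, t) f)%:R))/=.
  apply: eq_bigr => i _; rewrite big_ord_recl/= [X in X * _](_ : _ = 1) ?mul1r.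
    apply: eq_bigr => t _; rewrite /cond1/= map_weight_at.
    congr (srw _ _ (p (_, _))); apply: val_inj; by rewrite /= inordK // ltnS.
  rewrite /cond1/=; under eq_bigr do rewrite mulr1; exact: map_weight_sum1.
rewrite (eq_bigr (fun p => \sum_h mark_weight h * (cond2 (p.1, p.2) h)%:R)); last by case.
rewrite [RHS](eq_bigr (fun p => mark_weight (g (p.1, p.2)))); last by case.
rewrite -(pair_bigA _ (fun i t => \sum_h mark_weight h * (cond2 (i, t) h)%:R))/=.
rewrite -(pair_bigA _ (fun i t => mark_weight (g (i, t))))/=.
apply: eq_bigr => i _; rewrite big_ord_recr/= [X in _ * X](_ : _ = 1) ?mulr1.
  apply: eq_bigr => t _; rewrite /cond2/= ltn_ord/= (bigD1 (g (i, t)))//= inord_val eqxx mulr1.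
  by rewrite big1 ?addr0// => h /negbTE ->; rewrite mulr0.
rewrite /cond2/= ltnn/=; under eq_bigr do rewrite mulr1; exact: mark_weight_sum1.
Qed.

Lemma transfer (Q : pred ({ffun J -> V} * {ffun I * 'I_T.+1 -> G})) :
  P [set w | Q (paths w, marks w)] =
  (\sum_(q : arr) weight om q * (Q (arr_paths q, arr_marks q))%:R)%:E.
Proof.
rewrite (@probability_finType _ _ _ _ _ (fun w => (paths w, marks w))); last first.
  by move=> u; have [] := paths_marks_law u.
under eq_bigr => u _ do rewrite (paths_marks_law u).2 -arr_paths_marks_law.
rewrite sumEFin; congr (_%:E).
rewrite exchange_big/=; apply: eq_bigr => q _; rewrite -mulr_sumr; congr (_ * _).
have [Qq|nQq] := boolP (Q _).
  rewrite (bigD1 _ Qq)/= eqxx big1 ?addr0// => u /andP[_].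
  by rewrite eq_sym => /negbTE ->.
rewrite big1// => u Qu; case: eqP => // uE.
by move: nQq; rewrite uE Qu.
Qed.

End transfer.

Section done_by.
Variables (R : realType) (V : finType).
Local Notation I := 'I_#|V|.
Implicit Types (x : I -> nat -> V) (a r : I -> nat -> R).

(* All particles settle within [m] jumps when the clocks [a] determine the order
   of the jumps, and at times at most [t] as measured by the clocks [r]. *)
Definition done_by x a r m (t : R) : bool :=
  ((cunif_state x a m).2 == [set: I]%SET) &&
  [forall i, ring_time r i ((cunif_state x a m).1 i) <= t].

Lemma eq_cunif_state x x' a a' m :
  (forall i l, (l <= m)%N -> x i l = x' i l) ->
  (forall i l, (l < m)%N -> a i l = a' i l) ->
  cunif_state x a m = cunif_state x' a' m.
Proof.
move=> xx' aa'; apply: cunif_state_local.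
- by move=> i l lm; apply: xx'; rewrite (leq_trans lm)// cunif_state_le.
- by move=> i l lm; apply: aa'; rewrite (leq_trans lm)// cunif_state_le.
- move=> k i km _; apply: eq_ring_time => l lk; apply: aa'.
  by rewrite (leq_trans lk)// (leq_ltn_trans (cunif_state_le _ _ _ _)).
Qed.

Lemma eq_done_by x x' a a' r r' m t :
  (forall i l, (l <= m)%N -> x i l = x' i l) ->
  (forall i l, (l < m)%N -> a i l = a' i l) ->
  (forall i l, (l < m)%N -> r i l = r' i l) ->
  done_by x a r m t = done_by x' a' r' m t.
Proof.
move=> xx' aa' rr'; rewrite /done_by (eq_cunif_state xx' aa'); congr (_ && _).
apply: eq_forallb => i; rewrite (@eq_ring_time _ _ r r')// => l lk.
by rewrite rr'// (leq_trans lk)// cunif_state_le.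
Qed.

End done_by.

Section dominance_discrete.
Variables (R : realType) (V : finType) (e : rel V) (v : V).
Local Notation I := 'I_#|V|.
Variables (d : measure_display) (O : measurableType d) (P : probability O R).
Variables (Y : I -> nat -> O -> V) (S : I -> nat -> O -> R).
Hypothesis YS : indep_walks_clocks P e v Y S.
Variables (G : finType) (D : R -> G).
Hypothesis mD : forall g, measurable (D @^-1` [set g]).

Let cl (c : G -> R) w i k := c (D (S i k w)).

Lemma dominance_discrete (c c' : G -> R) m t : (forall g, 0 <= c' g) ->
  (P [set w | done_by (fun i l => Y i l w) (cl c' w) (cl c' w) m t] <=
   P [set w | done_by (fun i l => Y i l w) (cl c w) (cl c' w) m t])%E.
Proof.
move=> c'0.
pose px (p : {ffun I * 'I_m.+2 -> V}) (i : I) (l : nat) := p (i, inord l).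
pose gx (c : G -> R) (g : {ffun I * 'I_m.+1 -> G}) (i : I) (l : nat) := c (g (i, inord l)).
pose Q c u := done_by (px u.1) (gx c u.2) (gx c' u.2) m t.
have QP c0 : [set w | done_by (fun i l => Y i l w) (cl c0 w) (cl c' w) m t] =
    [set w | Q c0 (paths Y m w, marks S D m w)].
  have E w : done_by (fun i l => Y i l w) (cl c0 w) (cl c' w) m t = Q c0 (paths Y m w, marks S D m w).
    rewrite /Q; apply: eq_done_by => i l lm; rewrite /px /gx /cl ffunE/= inordK//.
    - by rewrite ltnS leqW.
    - exact: ltnW.
    - exact: ltnW.
  by apply/seteqP; split => w /=; rewrite E.
rewrite (QP c') (QP c) (transfer YS mD (Q c')) (transfer YS mD (Q c)) lee_fin.
have QA c0 q : Q c0 (arr_paths v q, arr_marks q) =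
    (((jump_state (fun f : {ffun V -> V} => f : V -> V) v c0 q m).2 == [set: I]%SET) &&
     intime t c' q (jump_state (fun f : {ffun V -> V} => f : V -> V) v c0 q m)).
  rewrite /Q/=; apply: (@eq_done_by _ _ _ (walk (fun f : {ffun V -> V} => f : V -> V) v q)
    _ (clock c0 q) _ (clock c' q)) => i l lm; rewrite /px /gx /clock ffunE/=.
  - by rewrite inordK// ltnS leqW.
  - congr (c0 (q (_, _)).2); apply: val_inj => /=.
    by rewrite !inordK//; lia.
  - congr (c' (q (_, _)).2); apply: val_inj => /=.
    by rewrite !inordK//; lia.
under eq_bigr do rewrite QA; under [leRHS]eq_bigr do rewrite QA.
apply: domination_arr => //.
- exact: map_weight_ge0.
- exact: mark_weight_ge0.
- exact: map_weight_sum1.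
- exact: mark_weight_sum1.
Qed.

End dominance_discrete.

Lemma expo_setT (R : realType) : exponential_prob 1 [set: R] = 1%E.
Proof. exact: (probability_setT (expo R)). Qed.

(** * Independence of one waiting time from all the others *)

Section clocks.
Variables (R : realType) (V : finType) (e : rel V) (v : V).
Local Notation I := 'I_#|V|.
Variables (d : measure_display) (O : measurableType d) (P : probability O R).
Variables (Y : I -> nat -> O -> V) (S : I -> nat -> O -> R).
Hypothesis YS : indep_walks_clocks P e v Y S.

Definition clock_box (B : I -> nat -> set R) : set O :=
  [set w | forall i k, B i k (S i k w)].

Lemma measurable_clock i k (A : set R) : measurable A -> measurable (S i k @^-1` A).
Proof. by move=> mA; rewrite -[X in measurable X]setTI; have [_ mS _] := YS; apply: mS. Qed.

Lemma measurable_clock_box B : (forall i k, measurable (B i k)) -> measurable (clock_box B).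
Proof.
move=> mB; rewrite (_ : clock_box B = \bigcap_(i in setT) \bigcap_(k in setT) (S i k @^-1` B i k)).
  apply: fin_bigcap_measurable => [|i _]; first exact: finite_finset.
  by apply: bigcap_measurableType => k _; apply: measurable_clock; exact: mB.
by apply/seteqP; split => w H i; [move=> _ k _; exact: H|move=> k; exact: H].
Qed.

Lemma clock_box_law B m : (forall i k, measurable (B i k)) ->
  (forall i k, (m <= k)%N -> B i k = setT) ->
  P (clock_box B) = (\prod_i \prod_(k < m) exponential_prob 1 (B i k))%E.
Proof.
move=> mB BT; have [mY mS PYS] := YS.
pose X w : {ffun I * 'I_m.+1 -> V} := [ffun p : I * 'I_m.+1 => Y p.1 p.2 w].
have XE u (B' : I -> nat -> set R) : (forall i k, (m <= k)%N -> B' i k = setT) ->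
  [set w | X w = u] `&` clock_box B' =
  [set w | (forall i t, (t <= m)%N -> Y i t w = u (i, inord t)) /\
           (forall i k, (k < m)%N -> B' i k (S i k w))].
  move=> BT'; apply/seteqP; split => w /= [H1 H2]; split => //.
  - by move=> i t tm; rewrite -H1 ffunE/= inordK.
  - by apply/ffunP => -[i t]; rewrite ffunE/= H1 ?inord_val// -ltnS.
  - move=> i k; case: (ltnP k m) => km; first exact: H2.
    by rewrite BT'.
have mX u : measurable [set w | X w = u].
  rewrite (_ : [set w | X w = u] = \bigcap_(i in setT) \bigcap_(t in setT)
    [set w | Y i (nat_of_ord t) w = u (i, t)]).
    apply: fin_bigcap_measurable => [|i _]; first exact: finite_finset.
    apply: fin_bigcap_measurable => [|t _]; [exact: finite_finset|exact: mY].
  apply/seteqP; split => w /= H.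
    by move=> i _ t _; rewrite /= -H ffunE.
  by apply/ffunP => -[i t]; rewrite ffunE; exact: H.
pose pp (u : {ffun I * 'I_m.+1 -> V}) : R := \prod_i path_prob e v m (fun t => u (i, inord t)).
have pp0 u : 0 <= pp u.
  by rewrite prodr_ge0// => i _; rewrite mulr_ge0// prodr_ge0// => t _; exact: srw_ge0.
have PB' B' : (forall i k, measurable (B' i k)) ->
    (forall i k, (m <= k)%N -> B' i k = setT) ->
    P (clock_box B') = ((\sum_u (pp u)%:E) * \prod_i \prod_(k < m) exponential_prob 1 (B' i k))%E.
  move=> mB' BT'.
  rewrite (_ : clock_box B' = \bigcup_(u in setT) ([set w | X w = u] `&` clock_box B')).
    rewrite measure_fin_bigcup//; [|exact: finite_finset| |].
    - rewrite (@fsbigE _ _ _ _ _ (enum {ffun I * 'I_m.+1 -> V})) ?enum_uniq//.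
        rewrite ge0_sume_distrl//; last by move=> u _; rewrite lee_fin.
        rewrite big_enum_cond/=; apply: eq_big => [u|u _]; first by rewrite in_setT.
        by rewrite XE// PYS.
      by move=> u _; rewrite mem_enum.
    - apply/trivIsetP => u u' _ _ uu'; apply/seteqP; split => // w [[/= uE _] [u'E _]].
      by move: uu'; rewrite -uE -u'E eqxx.
    - by move=> u _; apply: measurableI => //; exact: measurable_clock_box.
  by apply/seteqP; split => [w H|w [u _ []]//]; exists (X w).
(* The total mass of the path weights is read off from the box without constraints, which has
   probability 1. *)
have pp1 : (\sum_u (pp u)%:E = 1)%E.
  have := PB' (fun _ _ => setT) (fun _ _ => measurableT) (fun _ _ _ => erefl).
  rewrite (_ : clock_box _ = setT); last exact/seteqP.
  rewrite probability_setT [X in (_ * X)%E]big1 ?mule1// => i _.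
  by rewrite big1// => k _; rewrite expo_setT.
by rewrite PB'// pp1// mul1e.
Qed.

Section cell.
Variables (i0 : I) (k0 : nat).

(* Events determined by the waiting times other than [S i0 k0]. *)
Definition other_clocks : set (set O) := [set E | exists m (B : I -> nat -> set R),
  [/\ forall i k, measurable (B i k), forall i k, (m <= k)%N -> B i k = setT,
      B i0 k0 = setT & E = clock_box B]].

Lemma other_clocks_measurable : other_clocks `<=` measurable.
Proof. by move=> _ [m [B [mB _ _ ->]]]; exact: measurable_clock_box. Qed.

Lemma other_clocksI : setI_closed other_clocks.
Proof.
move=> _ _ [m [B [mB BT B0 ->]]] [m' [B' [mB' BT' B0' ->]]].
exists (maxn m m'), (fun i k => B i k `&` B' i k); split.
- by move=> i k; exact: measurableI.
- by move=> i k; rewrite geq_max => /andP[mk m'k]; rewrite BT// BT'// setIT.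
- by rewrite B0 B0' setIT.
- apply/seteqP; split => [w [H H'] i k|w H]; first by split.
  by split => i k; have [] := H i k.
Qed.

Lemma other_clocksT : other_clocks setT.
Proof. by exists 0%N, (fun _ _ => setT); split => //; exact/esym/seteqP. Qed.

(** As functions of [E], both sides are finite measures that agree on the boxes, which are stable
    under intersection. *)
Lemma cell_indep E A : measurable A -> <<s other_clocks >> E ->
  P (E `&` S i0 k0 @^-1` A) = (P E * exponential_prob 1 A)%E.
Proof.
move=> mA; have mSA := measurable_clock i0 k0 mA.
have xA0 : (0 <= exponential_prob 1 A)%E by exact: (measure_ge0 (expo R)).
have xAf : exponential_prob 1 A \is a fin_num by exact: (fin_num_measure (expo R)).
pose r : {nonneg R} := NngNum (fine_ge0 xA0).
move=> sE; rewrite muleC.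
have scaleE E' : (mscale r P E' = exponential_prob 1 A * P E')%E by rewrite /mscale/= fineK.
rewrite -scaleE.
rewrite -[LHS]/(mrestr P mSA E).
apply: (@g_sigma_algebra_measure_unique _ _ _ other_clocks _ (fun=> setT)) => //.
- exact: other_clocks_measurable.
- by move=> _; exact: other_clocksT.
- by rewrite bigcup_const//; exists 0%N.
- exact: other_clocksI.
- move=> _ [m [B [mB BT B0 ->]]]; rewrite [RHS]scaleE.
  pose M := maxn m k0.+1.
  pose B' i k := if (i == i0) && (k == k0) then A else B i k.
  have mB' i k : measurable (B' i k) by rewrite /B'; case: ifP.
  have BT'M i k : (M <= k)%N -> B' i k = setT.
    rewrite geq_max => /andP[mk kk]; rewrite /B'; case: eqP => //=; last by rewrite BT.
    by rewrite gtn_eqF// BT.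
  have BTM i k : (M <= k)%N -> B i k = setT by rewrite geq_max => /andP[mk kk]; rewrite BT.
  have EB : clock_box B `&` S i0 k0 @^-1` A = clock_box B'.
    apply/seteqP; split => w.
      by move=> [H HA] i k; rewrite /B'; case: andP => [[/eqP-> /eqP->]|].
    move=> H; split => [i k|]; last by have := H i0 k0; rewrite /B' !eqxx.
    have := H i k; rewrite /B'; case: andP => [[/eqP-> /eqP->]|//].
    by rewrite B0.
  transitivity (P (clock_box B')); first by rewrite -EB.
  rewrite (clock_box_law mB' BT'M) (clock_box_law mB BTM) !pair_bigA/=.
  have k0M : (k0 < M)%N by rewrite leq_max leqnn orbT.
  rewrite (bigD1 (i0, Ordinal k0M))//= [in RHS](bigD1 (i0, Ordinal k0M))//=.
  rewrite /B' !eqxx/= B0 expo_setT mul1e; congr (_ * _)%E; apply: eq_bigr => -[i k].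
  by rewrite xpair_eqE/= -val_eqE/= => /negbTE ->.
- move=> _; apply: le_lt_trans (ltry 1); apply: (probability_le1 P).
  exact: measurableI.
Qed.

Definition other_clocks_type := g_sigma_algebraType other_clocks.

Lemma measurable_clock_other i k : (i, k) != (i0, k0) ->
  measurable_fun [set: other_clocks_type] (S i k : other_clocks_type -> R).
Proof.
move=> ik _ A mA; rewrite setTI; apply: sub_sigma_algebra.
exists k.+1, (fun i' k' => if (i' == i) && (k' == k) then A else setT); split.
- by move=> i' k'; case: ifP.
- by move=> i' k' kk; rewrite [k' == k]gtn_eqF ?andbF.
- by move: ik; rewrite xpair_eqE eq_sym (eq_sym k) => /negbTE ->.
- apply/seteqP; split => w /=; first by move=> H i' k'; case: andP => // -[/eqP-> /eqP->].
  by move=> /(_ i k); rewrite !eqxx.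
Qed.

Variable Z : O -> R.
Hypothesis mZ : measurable_fun [set: other_clocks_type] (Z : other_clocks_type -> R).

Lemma measurable_other : measurable_fun [set: O] Z.
Proof.
move=> _ A mA; rewrite setTI.
have : <<s other_clocks >> (Z @^-1` A) by have := mZ measurableT mA; rewrite setTI.
by apply: smallest_sub; [exact: sigma_algebra_measurable|exact: other_clocks_measurable].
Qed.

Let Z' : {mfun O >-> R} := HB.pack Z (isMeasurableFun.Build _ _ _ _ Z measurable_other).

Let mZS : measurable_fun [set: O] (fun w => (Z w, S i0 k0 w)).
Proof.
by have [_ mS _] := YS; apply: measurable_fun_pair; [exact: measurable_other|exact: mS].
Qed.

Let ZS' : {mfun O >-> (R * R)%type} := HB.pack (fun w => (Z w, S i0 k0 w))
  (isMeasurableFun.Build _ _ _ _ (fun w => (Z w, S i0 k0 w)) mZS).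

Lemma cell_joint_law X : measurable X ->
  ((distribution P Z') \x (expo R))%E X = P [set w | X (Z w, S i0 k0 w)].
Proof.
move=> mX; transitivity (distribution P ZS' X); last by [].
apply: product_measure_unique => //.
move=> A B mA mB; rewrite /distribution /pushforward/=.
rewrite -[RHS]cell_indep//; first by have := mZ measurableT mA; rewrite setTI.
Qed.

Lemma cell_expectation (f h : R -> R) :
  measurable_fun setT f -> measurable_fun setT h ->
  (forall x, 0 <= f x) -> (forall x, 0 <= h x) ->
  (\int[P]_w (f (Z w) * h (S i0 k0 w))%:E =
   (\int[P]_w (f (Z w))%:E) * (\int[expo R]_x (h x)%:E))%E.
Proof.
move=> mf mh f0 h0.
pose F (x : R * R) := (f x.1 * h x.2)%:E.
have mF : measurable_fun setT F.
  by apply/measurable_EFinP; apply: measurable_funM; apply: measurableT_comp.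
have F0 x : (0 <= F x)%E by rewrite lee_fin mulr_ge0.
transitivity (\int[distribution P ZS']_x F x)%E.
  by rewrite ge0_integral_distribution.
transitivity (\int[((distribution P Z') \x (expo R))%E]_x F x)%E.
  by apply: eq_measure_integral => A mA _; exact/esym/cell_joint_law.
rewrite fubini_tonelli1// /fubini_F /F/=.
under eq_integral => x _.
  under eq_integral do rewrite EFinM.
  rewrite ge0_integralZl//; last 3 first.
  - exact/measurable_EFinP.
  - by move=> y _; rewrite lee_fin.
  - by rewrite lee_fin.
  over.
rewrite ge0_integralZr//; last 3 first.
- exact/measurable_EFinP.
- by move=> x _; rewrite lee_fin.
- by apply: integral_ge0 => x _; rewrite lee_fin.
rewrite ge0_integral_distribution//; exact/measurable_EFinP.
Qed.

(** By independence and Fubini it is enough that single points are null for the exponential law,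
    which has a density. *)
Lemma cell_no_tie : P [set w | S i0 k0 w = Z w] = 0%E.
Proof.
pose X : set (R * R) := [set x | x.2 = x.1].
have mX : measurable X.
  rewrite (_ : X = setT `&` (fun x : R * R => x.2 - x.1) @^-1` [set 0]); last first.
    by apply/seteqP; split => x /=; [move=> ->; rewrite subrr|move=> [_ /eqP]; rewrite subr_eq0 => /eqP].
  have mf : measurable_fun setT (fun x : R * R => x.2 - x.1).
    by apply: measurable_funB.
  exact: mf.
rewrite -[LHS]/(P [set w | X (Z w, S i0 k0 w)]) -cell_joint_law//=.
rewrite /product_measure1/=; apply: integral0_eq => x _.
rewrite (_ : xsection X x = [set x]); last first.
  by apply/seteqP; split => y; rewrite /xsection/= in_setE.
rewrite /= /exponential_prob; apply: null_set_integral => //=.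
- apply/measurable_funTS/measurable_EFinP; exact: measurable_exponential_pdf.
- exact: lebesgue_measure_set1.
Qed.

End cell.
End clocks.

(** * Concentration of the ring times *)

Section density.
Variables (d : measure_display) (T : measurableType d) (R : realType).
Variables (mu nu : {measure set T -> \bar R}) (g : T -> R).
Hypotheses (mg : measurable_fun setT g) (g0 : forall x, 0 <= g x).
Hypothesis nuE : forall A, measurable A -> nu A = (\int[mu]_(x in A) (g x)%:E)%E.

Import HBNNSimple.

Let integral_density_nnsfun (f : {nnsfun T >-> R}) :
  (\int[nu]_x (f x)%:E = \int[mu]_x (f x * g x)%:E)%E.
Proof.
under [LHS]eq_integral do rewrite fimfunE -fsumEFin//.
rewrite [LHS]ge0_integral_fsum//; last 2 first.
  - by move=> r; exact/measurable_EFinP/measurableT_comp.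
  - by move=> n x _; rewrite EFinM nnfun_muleindic_ge0.
under [RHS]eq_integral.
  move=> x xD; rewrite EFinM muleC fimfunE -fsumEFin// ge0_mule_fsumr; last first.
    by move=> r; rewrite EFinM nnfun_muleindic_ge0.
  over.
rewrite [RHS]ge0_integral_fsum//; last 2 first.
  - move=> r; apply: emeasurable_funM; first exact/measurable_EFinP.
    exact/measurable_EFinP/measurableT_comp.
  - by move=> r x _; apply: mule_ge0; [rewrite lee_fin|rewrite EFinM nnfun_muleindic_ge0].
apply: eq_fsbigr => r _.
rewrite integralZl_indic_nnsfun//= integral_indic// setIT nuE// integral_mkcond.
have [r0|r0] := leP 0 r; last first.
  rewrite preimage_nnfun0//= integral0_eq ?mule0; last first.
    by move=> x _; rewrite patchE memNset.
  by rewrite integral0_eq// => x _; rewrite indicE memNset// mulr0 mule0.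
rewrite -ge0_integralZl//; last 2 first.
- apply/(measurable_restrictT _ _).1 => //.
  by apply: measurable_funTS; apply/measurable_EFinP; exact: mg.
- by move=> x _; rewrite patchE; case: ifPn => // _; rewrite lee_fin.
apply: eq_integral => x _; rewrite patchE indicE; case: ifPn => _ /=.
  by rewrite mulr1 muleC.
by rewrite mulr0 !mule0.
Qed.

(** Simple functions first, then monotone convergence. *)
Lemma integral_density (f : T -> R) : measurable_fun setT f -> (forall x, 0 <= f x) ->
  (\int[nu]_x (f x)%:E = \int[mu]_x (f x * g x)%:E)%E.
Proof.
move=> mf f0.
have mf' : measurable_fun setT (EFin \o f) by exact/measurable_EFinP.
have f0' x : [set: T] x -> (0 <= (EFin \o f) x)%E by rewrite lee_fin.
pose f_ := nnsfun_approx measurableT mf'.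
transitivity (lim (\int[nu]_x (f_ n x)%:E @[n --> \oo])%E).
  rewrite -monotone_convergence//=.
  - by apply: eq_integral => x xD; apply/esym/cvg_lim => //=; exact: cvg_nnsfun_approx.
  - by move=> n; exact/measurable_EFinP/measurable_funTS.
  - by move=> n ? _; rewrite lee_fin.
  - by move=> ? _ ? ? mn; rewrite lee_fin; exact/lefP/nd_nnsfun_approx.
transitivity (lim (\int[mu]_x (f_ n x * g x)%:E @[n --> \oo])%E); last first.
  rewrite -monotone_convergence//=.
  - apply: eq_integral => x xD; apply/cvg_lim => //=.
    under eq_fun do rewrite EFinM.
    rewrite EFinM; apply: cvgeZr => //; exact: cvg_nnsfun_approx.
  - by move=> n; apply/measurable_EFinP; apply: measurable_funM => //; exact/measurable_funTS.
  - by move=> n ? _; rewrite lee_fin mulr_ge0.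
  - move=> ? _ ? ? mn; rewrite lee_fin ler_wpM2r//; exact/lefP/nd_nnsfun_approx.
by apply: congr_lim; apply/funext => n /=; exact: integral_density_nnsfun.
Qed.

End density.

Section mgf.
Variable R : realType.

Let ex :=
  @exponential_distribution_exponential_prob__canonical__probability_measure_Probability
    R 1 ltr01.

(** [ex] lives on the copy [measurableTypeR R] of the reals and [expo R] on the canonical space; the
    identity transports one to the other. *)
Let integral_expoE (f : R -> R) : measurable_fun [set: R] f -> (forall x, 0 <= f x) ->
  (\int[expo R]_x (f x)%:E = \int[ex]_x (f x)%:E)%E.
Proof.
move=> mf f0.
have mid : measurable_fun [set: measurableTypeR R] (id : measurableTypeR R -> R).
  by move=> _ A mA; rewrite setTI preimage_id.
pose idm : {mfun measurableTypeR R >-> R} := HB.pack (id : measurableTypeR R -> R)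
  (isMeasurableFun.Build _ _ _ _ (id : measurableTypeR R -> R) mid).
transitivity (\int[distribution ex idm]_x (f x)%:E)%E; first exact: eq_measure_integral.
rewrite ge0_integral_distribution//; exact/measurable_EFinP.
Qed.

(** Multiplying the density of rate 1 by [exp (th x)] gives [(1 - th)^-1] times the density of rate
    [1 - th]. *)
Lemma expo_mgf (th : R) : th < 1 -> (\int[expo R]_x (expR (th * x))%:E = ((1 - th)^-1)%:E)%E.
Proof.
move=> th1; have r0 : 0 < 1 - th by rewrite subr_gt0.
rewrite integral_expoE; last 2 first.
- by apply: measurableT_comp => //; apply: measurable_funM.
- by move=> x; exact: expR_ge0.
rewrite (@integral_density _ _ _ (@lebesgue_measure R) ex (exponential_pdf 1)); first last.
- by move=> x; exact: expR_ge0.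
- by apply: measurableT_comp => //; apply: measurable_funM.
- by [].
- by move=> x; exact: exponential_pdf_ge0.
- exact: measurable_exponential_pdf.
transitivity (\int[lebesgue_measure]_x (((1 - th)^-1)%:E * (exponential_pdf (1 - th) x)%:E))%E.
  apply: eq_integral => x _; rewrite -EFinM; congr (_%:E).
  have [x0|x0] := leP 0 x; last by rewrite !lt0_exponential_pdf ?mulr0.
  rewrite !exponential_pdfE// mul1r mulKf ?gt_eqF// -expRD; congr expR; ring.
rewrite ge0_integralZl//; last 3 first.
- by apply/measurable_EFinP; exact: measurable_exponential_pdf.
- by move=> x _; rewrite lee_fin exponential_pdf_ge0// ltW.
- by rewrite lee_fin invr_ge0 ltW.
by rewrite integral_exponential_pdf// mule1.
Qed.

End mgf.

Section concentration_constants.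
Variables (R : realType) (dl : R).
Hypothesis dl01 : 0 < dl < 1.

(** This choice gives [theta (1 + dl) < dl] and [theta < dl], from which [qup < 1] and [qlo < 1]
    follow by [1 + x <= exp x]. *)
Definition theta : R := dl / 4.
(* [qup] and [qlo] are the expectations of [exp (theta (S - (1 + dl)))] and of
   [exp (theta ((1 - dl) - S))] for [S] exponential of rate 1. *)
Definition qup : R := expR (- theta * (1 + dl)) / (1 - theta).
Definition qlo : R := expR (theta * (1 - dl)) / (1 + theta).
Definition cdev : R := (1 - qup)^-1 + (1 - qlo)^-1.

Lemma theta_gt0 : 0 < theta.
Proof. by move: dl01 => /andP[? ?]; rewrite /theta; lra. Qed.

Lemma theta_lt1 : theta < 1.
Proof. by move: dl01 => /andP[? ?]; rewrite /theta; lra. Qed.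

Lemma qup_bounds : 0 <= qup < 1.
Proof.
move: dl01 => /andP[d0 d1]; have t0 := theta_gt0; have t1 := theta_lt1.
rewrite /qup divr_ge0 ?expR_ge0//=; last by rewrite subr_ge0 ltW.
rewrite ltr_pdivrMr ?mul1r ?subr_gt0// mulNr expRN.
rewrite invf_plt ?posrE ?expR_gt0// ?subr_gt0//.
apply: lt_le_trans (expR_ge1Dx _).
rewrite -[_^-1]mul1r ltr_pdivrMr ?subr_gt0// /theta; nra.
Qed.

Lemma qlo_bounds : 0 <= qlo < 1.
Proof.
move: dl01 => /andP[d0 d1]; have t0 := theta_gt0; have t1 := theta_lt1.
rewrite /qlo divr_ge0 ?expR_ge0//=; last by rewrite addr_ge0 ?ltW.
rewrite ltr_pdivrMr ?mul1r ?addr_gt0//.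
rewrite -[_ * _]opprK expRN invf_plt ?posrE ?expR_gt0// ?addr_gt0//.
apply: lt_le_trans (expR_ge1Dx _).
rewrite -[_^-1]mul1r ltr_pdivrMr ?addr_gt0// /theta; nra.
Qed.

Lemma cdev_ge0 : 0 <= cdev.
Proof.
have /andP[_ h1] := qup_bounds; have /andP[_ h2] := qlo_bounds.
by rewrite addr_ge0// invr_ge0 subr_ge0 ltW.
Qed.

Lemma nneseries_geometric_le (q : R) : 0 <= q < 1 ->
  (\sum_(0 <= k <oo) (q ^+ k)%:E <= ((1 - q)^-1)%:E)%E.
Proof.
move=> /andP[q0 q1]; apply: lime_le.
  by apply: is_cvg_nneseries => k _ _; rewrite lee_fin exprn_ge0.
apply: nearW => N; rewrite sumEFin lee_fin -[leRHS]mul1r ler_pdivlMr ?subr_gt0//.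
rewrite mulrC big_mkord.
have -> : (1 - q) * \sum_(i < N) q ^+ i = 1 - q ^+ N.
  by rewrite -[RHS]opprB subrX1; ring.
by rewrite lerBlDr lerDl exprn_ge0.
Qed.

End concentration_constants.

Section concentration.
Variables (R : realType) (V : finType) (e : rel V) (v : V).
Local Notation I := 'I_#|V|.
Variables (d : measure_display) (O : measurableType d) (P : probability O R).
Variables (Y : I -> nat -> O -> V) (S : I -> nat -> O -> R).
Hypothesis YS : indep_walks_clocks P e v Y S.
Local Notation Sw w := (fun i k => S i k w).

Lemma measurable_ring_time i k : measurable_fun setT (fun w => ring_time (Sw w) i k).
Proof. by apply: measurable_sum => l; have [_ mS _] := YS; exact: mS. Qed.

Lemma measurable_ring_time_other i k : measurable_fun [set: other_clocks_type S i k]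
  (fun w => ring_time (Sw w) i k).
Proof.
apply: measurable_sum => l; apply: measurable_clock_other.
by rewrite xpair_eqE eqxx/= ltn_eqF.
Qed.

Lemma ring_mgf i k (th : R) : th < 1 ->
  (\int[P]_w (expR (th * ring_time (Sw w) i k))%:E = ((1 - th)^-1 ^+ k)%:E)%E.
Proof.
move=> th1; elim: k => [|k IH].
  rewrite expr0; under eq_integral do rewrite /ring_time big_ord0 mulr0 expR0.
  by rewrite integral_cst// mul1e; exact: probability_setT.
under eq_integral do rewrite ring_timeS mulrDr expRD.
have mE : measurable_fun [set: R] (fun x => expR (th * x)).
  by apply: measurableT_comp => //; apply: measurable_funM.
rewrite (cell_expectation YS (@measurable_ring_time_other i k) mE mE).
- by rewrite IH expo_mgf// -EFinM exprSr.
- by move=> x; exact: expR_ge0.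
- by move=> x; exact: expR_ge0.
Qed.

Variable dl : R.
Hypothesis dl01 : 0 < dl < 1.
Local Notation th := (theta dl).

Definition dev (i : I) (k : nat) (w : O) : R :=
  expR (th * (ring_time (Sw w) i k - (1 + dl) * k%:R)) +
  expR (th * ((1 - dl) * k%:R - ring_time (Sw w) i k)).

(** A sum rather than a supremum: it dominates every [dev i k], and the geometric decay in [k] keeps
    its expectation linear in the number of particles. *)
Definition total_dev (w : O) : \bar R := (\sum_i \sum_(0 <= k <oo) (dev i k w)%:E)%E.

Lemma dev_ge0 i k w : 0 <= dev i k w.
Proof. by rewrite addr_ge0// expR_ge0. Qed.

Lemma measurable_dev i k : measurable_fun setT (dev i k).
Proof.
have mr := @measurable_ring_time i k.
by apply: measurable_funD; apply: measurableT_comp => //; apply: measurable_funM => //;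
  apply: measurable_funB.
Qed.

Lemma total_dev_ge0 w : (0 <= total_dev w)%E.
Proof.
by apply: sume_ge0 => i _; apply: nneseries_ge0 => k _ _; rewrite lee_fin dev_ge0.
Qed.

Lemma dev_le_total i k w : ((dev i k w)%:E <= total_dev w)%E.
Proof.
rewrite /total_dev (bigD1 i)//=.
apply: (@le_trans _ _ (\sum_(0 <= k <oo) (dev i k w)%:E)%E); last first.
  apply: leeDl; apply: sume_ge0 => j _; apply: nneseries_ge0 => l _ _.
  by rewrite lee_fin dev_ge0.
have := @nneseries_lim_ge R (fun k => (dev i k w)%:E) xpredT 0 k.+1.
move=> h; apply: le_trans (h _) => [|l _ _]; last by rewrite lee_fin dev_ge0.
rewrite big_nat_recr//= leeDr// sume_ge0// => l _.
by rewrite lee_fin dev_ge0.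
Qed.

Lemma measurable_total_dev : measurable_fun setT total_dev.
Proof.
apply: emeasurable_sum => i; apply: ge0_emeasurable_sum => k.
  by move=> w _ _; rewrite lee_fin dev_ge0.
by move=> _; apply/measurable_EFinP; exact: measurable_dev.
Qed.

Lemma integral_dev i k : (\int[P]_w (dev i k w)%:E = (qup dl ^+ k + qlo dl ^+ k)%:E)%E.
Proof.
have t0 := theta_gt0 dl01; have t1 := theta_lt1 dl01.
have mr := @measurable_ring_time i k.
under eq_integral.
  move=> w _; rewrite /dev.
  rewrite (_ : th * (_ - _) = th * ring_time (Sw w) i k + (- th * (1 + dl)) * k%:R); last by ring.
  rewrite (_ : th * (_ - ring_time _ _ _) = - th * ring_time (Sw w) i k + (th * (1 - dl)) * k%:R); last by ring.
  rewrite !expRD EFinD !EFinM; over.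
have mE c : measurable_fun [set: O] (fun w => (expR (c * ring_time (Sw w) i k))%:E).
  apply/measurable_EFinP; apply: measurableT_comp => //; exact: measurable_funM.
rewrite ge0_integralD//; first last.
- by apply: emeasurable_funM.
- by apply: emeasurable_funM.
rewrite !ge0_integralZr//; try by [move=> w _; rewrite lee_fin expR_ge0|rewrite lee_fin expR_ge0].
rewrite !ring_mgf//; last by rewrite (lt_trans _ t1)// gtrN.
rewrite -!EFinM -EFinD; congr (_%:E).
by rewrite /qup /qlo !(mulrC (expR _) _^-1) !exprMn -!expRM_natr opprK.
Qed.

Lemma integral_total_dev : (\int[P]_w total_dev w <= (#|V|%:R * cdev dl)%:E)%E.
Proof.
have /andP[q0 q1] := qup_bounds dl01; have /andP[p0 p1] := qlo_bounds dl01.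
rewrite ge0_integral_sum//; last 2 first.
- move=> i; apply: ge0_emeasurable_sum => k.
    by move=> w _ _; rewrite lee_fin dev_ge0.
  by move=> _; apply/measurable_EFinP; exact: measurable_dev.
- by move=> i w _; apply: nneseries_ge0 => k _ _; rewrite lee_fin dev_ge0.
apply: (@le_trans _ _ (\sum_(i : I) (cdev dl)%:E)%E); last first.
  by rewrite sumEFin sumr_const card_ord mulr_natl.
apply: lee_sum => i _; rewrite integral_nneseries//; last 2 first.
- by move=> k; apply/measurable_EFinP; exact: measurable_dev.
- by move=> k w _; rewrite lee_fin dev_ge0.
under eq_eseriesr do rewrite integral_dev EFinD.
rewrite nneseriesD//; last 2 first.
- by move=> k _ _; rewrite lee_fin exprn_ge0.
- by move=> k _ _; rewrite lee_fin exprn_ge0.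
by rewrite /cdev EFinD leeD// nneseries_geometric_le// ?q0 ?p0.
Qed.

(* Since [x <= exp (theta x) / theta], one random variable controls all the
   deviations of the ring times at once. *)
Lemma ring_time_dev i k w (K : R) :
  ((ring_time (Sw w) i k - ((1 + dl) * k%:R + K))%:E <=
     (expR (- th * K) / th)%:E * total_dev w)%E /\
  (((1 - dl) * k%:R - ring_time (Sw w) i k - K)%:E <=
     (expR (- th * K) / th)%:E * total_dev w)%E.
Proof.
have t0 := theta_gt0 dl01.
have E x : x - K <= expR (- th * K) / th * expR (th * x).
  rewrite mulrAC -expRD ler_pdivlMr// (_ : - th * K + th * x = th * (x - K)); last by ring.
  by apply: le_trans (expR_ge1Dx _); rewrite mulrC lerDr.
have E' x : x <= dev i k w -> ((expR (- th * K) / th * x)%:E <=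
    (expR (- th * K) / th)%:E * total_dev w)%E.
  move=> xd; rewrite EFinM; apply: lee_wpmul2l.
  - by rewrite lee_fin divr_ge0 ?expR_ge0// ltW.
  - by apply: le_trans (dev_le_total i k w); rewrite lee_fin.
split.
- apply: le_trans (E' (expR (th * (ring_time (Sw w) i k - (1 + dl) * k%:R))) _).
    by rewrite lee_fin; apply: le_trans (E _); rewrite opprD addrA.
  by rewrite lerDl expR_ge0.
- apply: le_trans (E' (expR (th * ((1 - dl) * k%:R - ring_time (Sw w) i k))) _).
    by rewrite lee_fin.
  by rewrite lerDr expR_ge0.
Qed.

End concentration.

(** * Removing the discretization of the clocks *)

(** Up to null sets [A] lies in the lower limit of the [A_ n], and the upper limit of the [B_ n]
    lies in [B]. The tails [C k] and [D j] of these limits are compared through the common index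
    [maxn k j]. *)
Lemma probability_le_liminf d (O : measurableType d) (R : realType)
    (P : probability O R) (A B : set O) (A_ B_ : nat -> set O) :
  measurable A -> measurable B ->
  (forall n, measurable (A_ n)) -> (forall n, measurable (B_ n)) ->
  (forall n, (P (A_ n) <= P (B_ n))%E) ->
  {ae P, forall w, A w -> \forall n \near \oo, A_ n w} ->
  {ae P, forall w, ~ B w -> \forall n \near \oo, ~ B_ n w} ->
  (P A <= P B)%E.
Proof.
move=> mA mB mA_ mB_ AB [N [mN PN NA]] [M [mM PM MB]].
pose C k := \bigcap_(n in [set n | (k <= n)%N]) A_ n.
pose D k := \bigcup_(n in [set n | (k <= n)%N]) B_ n.
have mC k : measurable (C k) by apply: bigcap_measurableType.
have mD k : measurable (D k) by apply: bigcup_measurable.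
have CD k j : (P (C k) <= P (D j))%E.
  apply: (@le_trans _ _ (P (A_ (maxn k j)))).
    by apply: le_measure; rewrite ?inE// => w; apply; rewrite /= leq_maxl.
  apply: (le_trans (AB _)); apply: le_measure; rewrite ?inE// => w Bw.
  by exists (maxn k j); rewrite //= leq_maxr.
have mUC : measurable (\bigcup_k C k) by exact: bigcupT_measurable.
have mID : measurable (\bigcap_k D k) by exact: bigcap_measurableType.
have AC : (P A <= P (\bigcup_k C k))%E.
  apply: (@le_trans _ _ (P ((\bigcup_k C k) `|` N))).
    apply: le_measure; rewrite ?inE//; first exact: measurableU.
    move=> w Aw; case: (pselect (N w)) => Nw; [by right|left].
    have [k _ H] : \forall n \near \oo, A_ n w.
      by apply: contrapT => H; apply: Nw; apply: NA => /= /(_ Aw).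
    by exists k => // n kn; apply: H.
  by rewrite measureU0.
have BD : (P (\bigcap_k D k) <= P B)%E.
  apply: (@le_trans _ _ (P (B `|` M))).
    apply: le_measure; rewrite ?inE//; first exact: measurableU.
    move=> w Dw; case: (pselect (M w)) => Mw; [by right|left].
    apply: contrapT => nB.
    have [k _ H] : \forall n \near \oo, ~ B_ n w.
      by apply: contrapT => H; apply: Mw; apply: MB => /= /(_ nB).
    by have [n kn Bn] := Dw k Logic.I; exact: (H n kn Bn).
  by rewrite measureU0.
apply: le_trans AC _; apply: le_trans BD.
have ndC : {homo C : n m / (n <= m)%N >-> (n <= m)%O}.
  move=> n m nm; apply/subsetPset => w Cw l ml; apply: Cw.
  exact: leq_trans ml.
have niD : {homo D : n m / (n <= m)%N >-> (m <= n)%O}.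
  move=> n m nm; apply/subsetPset => w [l ml Bl]; exists l => //.
  exact: leq_trans ml.
have cC := nondecreasing_cvg_mu mC mUC ndC (mu := P).
have cD : (P \o D) x @[x --> \oo] --> P (\bigcap_n D n).
  by apply: nonincreasing_cvg_mu => //; rewrite (le_lt_trans (probability_le1 _ _))// ltry.
rewrite -(cvg_lim _ cC)// -(cvg_lim _ cD)//.
apply: lime_le; first by apply/cvg_ex; eexists; exact: cC.
apply: nearW => k; apply: lime_ge; first by apply/cvg_ex; eexists; exact: cD.
by apply: nearW => j; exact: CD.
Qed.

Lemma measurable_ffun d (O : measurableType d) (J : finType) (U : J -> eqType)
    (f : forall j, O -> U j) :
  (forall j u, measurable [set w | f j w = u]) ->
  forall u : forall j, U j, measurable [set w | forall j, f j w = u j].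
Proof.
move=> mf u; rewrite (_ : [set w | _] = \bigcap_(j in setT) [set w | f j w = u j]).
  by apply: fin_bigcap_measurable => // ; exact: finite_finset.
by apply/seteqP; split => w H j //=; exact: H.
Qed.

Section state_measurable.
Variables (R : realType) (V : finType).
Local Notation I := 'I_#|V|.
Variables (d : measure_display) (O : measurableType d).
Variables (x : I -> nat -> O -> V) (a : I -> nat -> O -> R).
Hypothesis mx : forall i t u, measurable [set w | x i t w = u].
Hypothesis ma : forall i k, measurable_fun setT (a i k).
Local Notation xw w := (fun i t => x i t w).
Local Notation aw w := (fun i k => a i k w).

Lemma measurable_ring_time_of i k : measurable_fun setT (fun w => ring_time (aw w) i k).
Proof. by apply: measurable_sum => l; exact: ma. Qed.

Lemma measurable_ring_le (i j : I) k l :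
  measurable [set w | ring_time (aw w) i k <= ring_time (aw w) j l].
Proof.
rewrite -[X in measurable X]setTI.
exact: (@measurable_fun_le _ _ _ _ _ _ measurableT (@measurable_ring_time_of i k)
  (@measurable_ring_time_of j l)).
Qed.

Lemma measurable_cunif_step (s s' : state V) :
  measurable [set w | cunif_step (xw w) (aw w) s = s'].
Proof.
(* For a fixed state the step depends on finitely many discrete data: the comparisons [M] of the
   next rings, and the positions [X] before and after a jump. *)
pose M w : {ffun I * I -> bool} :=
  [ffun p => ring_time (aw w) p.1 (s.1 p.1).+1 <= ring_time (aw w) p.2 (s.1 p.2).+1].
pose X w : {ffun I * bool -> V} := [ffun p => x p.1 (if p.2 then (s.1 p.1).+1 else s.1 p.1) w].
pose next (m : {ffun I * I -> bool}) := [pick i | (i \notin s.2) &&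
  [forall j, (j \notin s.2) ==> m (i, j)]].
pose step (u : {ffun I * I -> bool} * {ffun I * bool -> V}) : state V :=
  if next u.1 is Some i then
    ([ffun j => if j == i then (s.1 i).+1 else s.1 j],
     if u.2 (i, true) \in [set u.2 (j, false) | j in s.2]%SET then s.2 else (i |: s.2)%SET)
  else s.
rewrite (_ : [set w | _] = [set w | [pred u | step u == s'] (M w, X w)]).
  apply: measurable_finType_pred => -[m u].
  rewrite (_ : [set w | _] = [set w | forall p, M w p = m p] `&` [set w | forall p, X w p = u p]).
    apply: measurableI; apply: measurable_ffun => p b.
      rewrite (_ : [set w | _] = [set w | (M w p) == b]); last first.
        by apply/seteqP; split => w /= /eqP.
      have mMp : measurable [set w | M w p].
        rewrite (_ : [set w | _] = [set w | ring_time (aw w) p.1 (s.1 p.1).+1 <= ring_time (aw w) p.2 (s.1 p.2).+1]).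
          exact: measurable_ring_le.
        by apply/seteqP; split => w /=; rewrite ffunE.
      case: b.
        by rewrite (_ : [set w | _] = [set w | M w p])//; apply/seteqP; split => w /=; rewrite eqb_id.
      rewrite (_ : [set w | _] = ~` [set w | M w p]); first exact: measurableC.
      by apply/seteqP; split => w /=; rewrite eqbF_neg => /negP.
    rewrite (_ : [set w | _] = [set w | x p.1 (if p.2 then (s.1 p.1).+1 else s.1 p.1) w = b]); first exact: mx.
    by apply/seteqP; split => w /=; rewrite ffunE.
  apply/seteqP; split => w /=; first by case=> <- <-.
  by move=> [H1 H2]; congr pair; apply/ffunP.
have E w : cunif_step (xw w) (aw w) s = step (M w, X w).
  rewrite /cunif_step /step/=.
  have -> : next_particle (aw w) s = next (M w).
    by apply: eq_pick => i /=; congr (_ && _); apply: eq_forallb => j; rewrite ffunE.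
  have -> : occupied (xw w) s = [set X w (j, false) | j in s.2]%SET.
    by apply/finset.setP => u; apply/imsetP/imsetP => -[j js ->]; exists j; rewrite ?ffunE.
  by case: (next _) => // i; rewrite !ffunE.
by apply/seteqP; split => w /=; rewrite E => /eqP.
Qed.

Lemma countable_state : countable [set: state V].
Proof. exact: (@countableP ({ffun I -> nat} * {set I})%type). Qed.

Lemma measurable_by_state m (Q : state V -> set O) :
  (forall s, measurable [set w | cunif_state (xw w) (aw w) m = s]) ->
  (forall s, measurable (Q s)) -> measurable [set w | Q (cunif_state (xw w) (aw w) m) w].
Proof.
move=> mst mQ.
rewrite (_ : [set w | _] = \bigcup_s ([set w | cunif_state (xw w) (aw w) m = s] `&` Q s)).
  apply: countable_bigcupT_measurable; first exact: countable_state.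
  by move=> s; exact: measurableI.
apply/seteqP; split => [w Qw|w [s _ [/= ->]]//].
by exists (cunif_state (xw w) (aw w) m).
Qed.

Lemma measurable_cunif_state m s : measurable [set w | cunif_state (xw w) (aw w) m = s].
Proof.
elim: m s => [|m IH] s.
  have [<-|ns] := pselect (init_state V = s).
    by rewrite (_ : [set w | _] = setT)//; exact/seteqP.
  by rewrite (_ : [set w | _] = set0)//; apply/seteqP; split => w // /ns.
exact: (@measurable_by_state m (fun s' => [set w | cunif_step (xw w) (aw w) s' = s])
  IH (fun s' => measurable_cunif_step s' s)).
Qed.

Variables (r : I -> nat -> O -> R).
Hypothesis mr : forall i k, measurable_fun setT (r i k).
Local Notation rw w := (fun i k => r i k w).

Lemma measurable_settled m :
  measurable [set w | (cunif_state (xw w) (aw w) m).2 = [set: I]%SET].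
Proof.
apply: (@measurable_by_state m (fun s => [set w | s.2 = [set: I]%SET])).
  exact: measurable_cunif_state.
move=> s; have [sT|sT] := pselect (s.2 = [set: I]%SET).
  by rewrite (_ : [set w | _] = setT)//; apply/seteqP; split => w.
by rewrite (_ : [set w | _] = set0)//; apply/seteqP; split => w // /sT.
Qed.

Lemma measurable_last_ring m i :
  measurable_fun setT (fun w => ring_time (rw w) i ((cunif_state (xw w) (aw w) m).1 i)).
Proof.
move=> _ A mA; rewrite setTI.
apply: (@measurable_by_state m (fun s => [set w | A (ring_time (rw w) i (s.1 i))])).
  exact: measurable_cunif_state.
move=> s; have : measurable_fun setT (fun w => ring_time (rw w) i (s.1 i)).
  by apply: measurable_sum => l; exact: mr.
by move=> /(_ measurableT _ mA); rewrite setTI.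
Qed.

Lemma measurable_last_ring_le m t :
  measurable [set w | forall i, ring_time (rw w) i ((cunif_state (xw w) (aw w) m).1 i) <= t].
Proof.
rewrite (_ : [set w | _] = \bigcap_(i in setT)
   [set w | ring_time (rw w) i ((cunif_state (xw w) (aw w) m).1 i) <= t]).
  apply: fin_bigcap_measurable => [|i _]; first exact: finite_finset.
  rewrite -[X in measurable X]setTI.
  by apply: (measurable_fun_le measurableT (@measurable_last_ring m i)); exact: measurable_cst.
by apply/seteqP; split => w H i; [move=> _; exact: H|exact: H].
Qed.

Lemma measurable_last_ring_lt m t :
  measurable [set w | forall i, ring_time (rw w) i ((cunif_state (xw w) (aw w) m).1 i) < t].
Proof.
rewrite (_ : [set w | _] = \bigcap_(i in setT)
   [set w | ring_time (rw w) i ((cunif_state (xw w) (aw w) m).1 i) < t]).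
  apply: fin_bigcap_measurable => [|i _]; first exact: finite_finset.
  rewrite (_ : [set w | _] = ~` [set w | t <= ring_time (rw w) i ((cunif_state (xw w) (aw w) m).1 i)]).
    apply: measurableC; rewrite -[X in measurable X]setTI.
    by apply: (measurable_fun_le measurableT _ (@measurable_last_ring m i)); exact: measurable_cst.
  by apply/seteqP; split => w /=; rewrite ltNge => /negP.
by apply/seteqP; split => w H i; [move=> _; exact: H|exact: H].
Qed.

Lemma measurable_done_by m t : measurable [set w | done_by (xw w) (aw w) (rw w) m t].
Proof.
rewrite (_ : [set w | _] = [set w | (cunif_state (xw w) (aw w) m).2 = [set: I]%SET] `&`
  [set w | forall i, ring_time (rw w) i ((cunif_state (xw w) (aw w) m).1 i) <= t]).
  by apply: measurableI; [exact: measurable_settled|exact: measurable_last_ring_le].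
apply/seteqP; split => w.
  by move=> /andP[/eqP ? /forallP].
by move=> [? ?]; apply/andP; split; [exact/eqP|exact/forallP].
Qed.

End state_measurable.

Section discretization.
Variables (R : realType) (N : nat).
Let K := (N.+1 ^ 2)%N.

(** Rounding down to a multiple of [1 / (N + 1)], capped at [K / (N + 1) = N + 1]: the mesh and the
    cap improve together, with finitely many values for each [N]. *)
Definition disc (s : R) : 'I_K.+1 := inord (minn (Num.truncn (s * N.+1%:R)) K).
Definition disc_val (g : 'I_K.+1) : R := g%:R / N.+1%:R.

Lemma disc_val_ge0 g : 0 <= disc_val g.
Proof. by rewrite divr_ge0. Qed.

Lemma discE s : disc s = minn (Num.truncn (s * N.+1%:R)) K :> nat.
Proof. by rewrite inordK// ltnS geq_minr. Qed.

Lemma measurable_disc g : measurable (disc @^-1` [set g]).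
Proof.
have mge n : measurable [set s : R | (n <= Num.truncn (s * N.+1%:R))%N].
  case: n => [|n]; first by rewrite (_ : [set s | _] = setT)//; apply/seteqP; split.
  rewrite (_ : [set s | _] = `[n.+1%:R / N.+1%:R, +oo[%classic)//.
  by apply/seteqP; split => s /=; rewrite truncn_gt_nat in_itv/= andbT ler_pdivrMr.
have mdge n : measurable [set s | (n <= disc s)%N].
  rewrite (_ : [set s | _] = [set s : R | (n <= Num.truncn (s * N.+1%:R))%N] `&` [set s | (n <= K)%N]).
    apply: measurableI => //; have [nK|nK] := boolP (n <= K)%N.
      by rewrite (_ : [set s | _] = setT)//; apply/seteqP; split.
    by rewrite (_ : [set s | _] = set0)//; apply/seteqP; split.
  by apply/seteqP; split => s /=; rewrite discE leq_min => /andP.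
rewrite (_ : disc @^-1` _ = [set s | (g <= disc s)%N] `\` [set s | (g < disc s)%N]).
  exact: measurableD.
apply/seteqP; split => s /=; first by move=> ->; rewrite leqnn ltnn.
move=> [h1 /negP]; rewrite -leqNgt => h2; apply: val_inj => /=; apply/eqP.
by rewrite eqn_leq h1 h2.
Qed.

Lemma disc_close s : 0 <= s <= N.+1%:R -> `|disc_val (disc s) - s| <= N.+1%:R^-1.
Proof.
move=> /andP[s0 sN]; have N0 : 0 < N.+1%:R :> R by [].
have sN0 : 0 <= s * N.+1%:R by rewrite mulr_ge0.
have /andP[t1 t2] := truncn_itv sN0.
have tK : (Num.truncn (s * N.+1%:R) <= K)%N.
  rewrite -(ler_nat R) (le_trans t1)// /K natrX expr2 ler_wpM2r//.
rewrite /disc_val discE (minn_idPl tK).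
rewrite -(ler_pM2r N0) mulVf ?gt_eqF// -[X in _ * X]gtr0_norm// -normrM mulrBl divfK ?gt_eqF//.
by rewrite ler_norml; apply/andP; split; move: t1 t2; rewrite -natr1; lra.
Qed.

End discretization.

Lemma disc_cvg (R : realType) (s : R) : 0 <= s -> disc_val R (disc N s) @[N --> \oo] --> s.
Proof.
move=> s0; apply/cvgrPdist_le => eps e0.
near=> N; rewrite distrC.
have Ns : s <= N.+1%:R.
  have h : (Num.truncn s < N.+1)%N by near: N; exists (Num.truncn s).
  by rewrite ltW// -truncn_lt_nat.
apply: (le_trans (disc_close _)); first by rewrite s0.
have h : (Num.truncn eps^-1 < N.+1)%N by near: N; exists (Num.truncn eps^-1).
rewrite -[leRHS]invrK lef_pV2 ?posrE ?invr_gt0//.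
by rewrite ltW// -truncn_lt_nat// invr_ge0 ltW.
Unshelve. all: by end_near. Qed.

Section order_limit.
Variables (R : realType) (V : finType).
Local Notation I := 'I_#|V|.
Variables (x : I -> nat -> V) (a : I -> nat -> R) (a_ : nat -> I -> nat -> R).
Hypothesis a_a : forall i k, a_ N i k @[N --> \oo] --> a i k.

Lemma ring_time_cvg i k : ring_time (a_ N) i k @[N --> \oo] --> ring_time a i k.
Proof.
elim: k => [|k IH].
  rewrite /ring_time big_ord0; under eq_fun do rewrite big_ord0.
  exact: cvg_cst.
rewrite ring_timeS; under eq_fun do rewrite ring_timeS.
exact: cvgD.
Qed.

Hypothesis no_tie : forall i j k l, i != j -> ring_time a i k.+1 != ring_time a j l.+1.

(** Finitely many comparisons decide the first [m] jumps, and without ties each of them is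
    eventually correct along the approximation. *)
Lemma cunif_state_cvg m :
  \forall N \near \oo, cunif_state x (a_ N) m = cunif_state x a m.
Proof.
elim: m => [|m IH]; first exact: nearW.
pose c := (cunif_state x a m).1.
have cmp : \forall N \near \oo, forall i j,
    (ring_time (a_ N) i (c i).+1 <= ring_time (a_ N) j (c j).+1) =
    (ring_time a i (c i).+1 <= ring_time a j (c j).+1).
  apply: filter_forall => i; apply: filter_forall => j.
  have [->|ij] := eqVneq i j; first by apply: nearW => N; rewrite !lexx.
  have cD : ring_time (a_ N) i (c i).+1 - ring_time (a_ N) j (c j).+1 @[N --> \oo] -->
      ring_time a i (c i).+1 - ring_time a j (c j).+1.
    by apply: cvgB; exact: ring_time_cvg.
  have := no_tie (c i) (c j) ij; rewrite neq_lt => /orP[h|h].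
    have h' : ring_time a i (c i).+1 - ring_time a j (c j).+1 < 0 by rewrite subr_lt0.
    apply: filterS (cvgr_lt _ cD _ h') => N; rewrite subr_lt0 => hN.
    by rewrite !ltW.
  have h' : 0 < ring_time a i (c i).+1 - ring_time a j (c j).+1 by rewrite subr_gt0.
  apply: filterS (cvgr_gt _ cD _ h') => N; rewrite subr_gt0 => hN.
  by rewrite !leNgt h hN.
apply: filterS2 IH cmp => N IH cmp.
rewrite !cunif_stateS IH /cunif_step.
suff -> : next_particle (a_ N) (cunif_state x a m) = next_particle a (cunif_state x a m) by [].
apply: eq_pick => i /=; congr (_ && _); apply: eq_forallb => j.
by rewrite -/c cmp.
Qed.

End order_limit.

Section good_clocks.
Variables (R : realType) (V : finType) (e : rel V) (v : V).
Local Notation I := 'I_#|V|.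
Variables (d : measure_display) (O : measurableType d) (P : probability O R).
Variables (Y : I -> nat -> O -> V) (S : I -> nat -> O -> R).
Hypothesis YS : indep_walks_clocks P e v Y S.
Local Notation Sw w := (fun i k => S i k w).

Lemma clock_nonneg : {ae P, forall w, forall i k, 0 <= S i k w}.
Proof.
apply: filter_forall => i; apply: ae_foralln => k.
exists (S i k @^-1` `]-oo, 0[); split.
- exact: (measurable_clock YS).
- transitivity (P setT * exponential_prob 1 `]-oo, (0%R:R)[%classic)%E.
    rewrite -(cell_indep YS (i0 := i) (k0 := k))//; first by rewrite setTI.
    by apply: (@measurableT _ (other_clocks_type S i k)).
  rewrite [X in (_ * X)%E]integral0_eq ?mule0// => x; rewrite /= in_itv/= => x0.
  by rewrite lt0_exponential_pdf.
- by move=> w /=; rewrite in_itv/= ltNge => /negP.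
Qed.

Lemma clock_no_tie : {ae P, forall w, forall i j k l, i != j ->
  ring_time (Sw w) i k.+1 != ring_time (Sw w) j l.+1}.
Proof.
apply: filter_forall => i; apply: filter_forall => j.
apply: ae_foralln => k; apply: ae_foralln => l.
have [->|ij] := eqVneq i j; first by apply: nearW => w.
(* A tie would force [S i k] to equal [Z], which involves only other waiting times. *)
pose Z w := ring_time (Sw w) j l.+1 - ring_time (Sw w) i k.
have mZ : measurable_fun [set: other_clocks_type S i k] (Z : other_clocks_type S i k -> R).
  apply: measurable_funB; apply: measurable_sum => n; apply: measurable_clock_other.
    by rewrite xpair_eqE eq_sym (negbTE ij).
  by rewrite xpair_eqE eqxx/= ltn_eqF.
exists [set w | S i k w = Z w]; split.
- have mSf : measurable_fun setT (S i k) by have [_ ? _] := YS.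
  have mZf := measurable_other YS mZ.
  rewrite (_ : [set w | _] = (fun w => S i k w - Z w) @^-1` [set 0]); last first.
    by apply/seteqP; split => w /=; [move=> ->; rewrite subrr|move=> /eqP; rewrite subr_eq0 => /eqP].
  by rewrite -[X in measurable X]setTI; apply: (measurable_funB mSf mZf).
- exact: (cell_no_tie YS mZ).
- move=> w /= H; apply: contrapT => nE; apply: H => _.
  apply/eqP; rewrite ring_timeS => H; apply: nE.
  by rewrite /Z -H addrC addKr.
Qed.

Definition clk (b : bool) (w : O) : I -> nat -> R := if b then Sw w else fun _ _ => 1.

(** Unit clocks are constant functions of the same marks, so the comparison for finite arrays
    handles both kinds of clocks, for ordering as well as for measuring. *)
Let cost N (b : bool) (g : 'I_(N.+1 ^ 2).+1) : R := if b then disc_val R g else 1.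
Let clk_ N b w : I -> nat -> R := fun i k => cost b (disc N (S i k w)).

Lemma measurable_clk b i k : measurable_fun setT (fun w => clk b w i k).
Proof. by have [_ mS _] := YS; case: b; [exact: mS|exact: measurable_cst]. Qed.

Let measurable_clk_ N b i k : measurable_fun setT (fun w => clk_ N b w i k).
Proof.
move=> _ A mA; rewrite setTI.
have mD g : measurable [set w | disc N (S i k w) = g].
  exact: (measurable_clock YS i k (@measurable_disc R N g)).
rewrite (_ : _ @^-1` A = [set w | [pred g | `[< A (cost b g) >]] (disc N (S i k w))]).
  exact: measurable_finType_pred.
by apply/seteqP; split => w /= /asboolP.
Qed.

(** Strict on the left and weak on the right is the form that passes to the limit: times below [t]
    are eventually below [t] for the approximations, and a time above [t] is eventually above it. *)
Lemma clk_dominance_strict (b b' : bool) m t :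
  (P ([set w | (cunif_state (fun i l => Y i l w) (clk b w) m).2 = [set: I]%SET] `&`
      [set w | forall i, (ring_time (clk b w) i
         ((cunif_state (fun i l => Y i l w) (clk b w) m).1 i) < t)%R]) <=
   P [set w | done_by (fun i l => Y i l w) (clk b' w) (clk b w) m t])%E.
Proof.
have [mY _ _] := YS.
have good : {ae P, forall w, (forall b i k, clk_ N b w i k @[N --> \oo] --> clk b w i k) /\
   (forall b m, \forall N \near \oo,
     cunif_state (fun i l => Y i l w) (clk_ N b w) m = cunif_state (fun i l => Y i l w) (clk b w) m)}.
  apply: filterS2 clock_nonneg clock_no_tie => w S0 nt.
  have c b0 i k : clk_ N b0 w i k @[N --> \oo] --> clk b0 w i k.
    by case: b0; [exact: disc_cvg|exact: cvg_cst].
  split => // -[] m'; first by apply: cunif_state_cvg => // i k; exact: c.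
  (* Unit clocks do have ties, but here the approximation is exact. *)
  by apply: nearW.
apply: (@probability_le_liminf _ _ _ P _ _
  (fun N => [set w | done_by (fun i l => Y i l w) (clk_ N b w) (clk_ N b w) m t])
  (fun N => [set w | done_by (fun i l => Y i l w) (clk_ N b' w) (clk_ N b w) m t])).
- apply: measurableI.
    apply: measurable_settled => // i k; exact: measurable_clk.
  by apply: measurable_last_ring_lt => // i k; exact: measurable_clk.
- by apply: measurable_done_by => // i k; exact: measurable_clk.
- by move=> N; apply: measurable_done_by => // i k; exact: measurable_clk_.
- by move=> N; apply: measurable_done_by => // i k; exact: measurable_clk_.
- move=> N; apply: (dominance_discrete YS (@measurable_disc R N)) => g.
  by rewrite /cost; case: (b); rewrite ?disc_val_ge0.
- apply: filterS good => w [cl jump_state] [sT rt].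
  have H : \forall N \near \oo, forall i, ring_time (clk_ N b w) i
     ((cunif_state (fun i l => Y i l w) (clk b w) m).1 i) < t.
    by apply: filter_forall => i; apply: cvgr_lt (rt i); exact: ring_time_cvg.
  apply: filterS2 (jump_state b m) H => N E H; apply/andP; rewrite E sT; split => //.
  by apply/forallP => i; exact: ltW.
- apply: filterS good => w [cl jump_state] /negP; rewrite /done_by negb_and => /orP[sT|].
    apply: filterS (jump_state b' m) => N E; rewrite /= /done_by E.
    by apply/negP; rewrite (negbTE sT).
  rewrite negb_forall => /existsP[i]; rewrite -ltNge => ti.
  have H : \forall N \near \oo, t < ring_time (clk_ N b w) i
     ((cunif_state (fun i l => Y i l w) (clk b' w) m).1 i).
    by apply: cvgr_gt ti; exact: ring_time_cvg.
  apply: filterS2 (jump_state b' m) H => N E {}H; rewrite /= /done_by E.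
  by apply/negP; rewrite negb_and negb_forall; apply/orP; right; apply/existsP; exists i; rewrite -ltNge.
Qed.

End good_clocks.

(** * The parallel process as the jump-by-jump process with unit clocks *)

Lemma pick_ord_first n (P : pred 'I_n) i : P i -> (forall j : 'I_n, (j < i)%N -> ~~ P j) ->
  [pick j | P j] = Some i.
Proof.
move=> Pi Pj; rewrite /pick /enum_mem -enumT.
have si : i \in enum 'I_n by rewrite mem_enum.
have : sorted (fun j k : 'I_n => (j < k)%N) (enum 'I_n).
  by have := iota_ltn_sorted 0 n; rewrite -val_enum_ord sorted_map.
elim: (enum 'I_n) si => //= k s IH; rewrite inE => /orP[/eqP<- _|si sS].
  by rewrite [i \in _]Pi.
have ki : (k < i)%N.
  have tr : transitive (fun j k : 'I_n => (j < k)%N) by move=> b a c; exact: ltn_trans.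
  by have /allP := order_path_min tr sS; apply.
rewrite [k \in _](negbTE (Pj _ ki)); apply: IH => //; exact: path_sorted sS.
Qed.

Section parallel.
Variables (R : realType) (V : finType) (x : 'I_#|V| -> nat -> V).
Local Notation I := 'I_#|V|.
Local Notation one := (fun _ _ => 1 : R).

Lemma ring_time_one (i : I) k : ring_time one i k = k%:R :> R.
Proof. by rewrite /ring_time sumr_const card_ord. Qed.

Section round.
Variables (s : state V) (t : nat).
Hypothesis s_t : forall i, i \notin s.2 -> s.1 i = t.

Let c : {ffun I -> nat} := [ffun i => if i \in s.2 then s.1 i else (s.1 i).+1].
Let on_free i := (i \notin s.2) && (x i (c i) \notin occupied x s).
Let settles i := on_free i && [forall j, on_free j && (x j (c j) == x i (c i)) ==> (i <= j)%N].

(* The state in the middle of a parallel round, when the particles of index less than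
   [k] have jumped one after the other. *)
Let part (k : nat) : state V :=
  ([ffun i : I => if (i < k)%N then c i else s.1 i],
   (s.2 :|: [set i : I | (i < k)%N && settles i])%SET).

Let occupied_part k (u : V) : (u \in occupied x (part k)) =
  (u \in occupied x s) || [exists i : I, [&& (i < k)%N, settles i & u == x i (c i)]].
Proof.
apply/imsetP/orP => [[i]|].
  rewrite !inE ffunE => /orP[iS ->|/andP[ik si] ->].
    left; apply/imsetP; exists i => //; rewrite /c ffunE iS; by case: ifP.
  by right; apply/existsP; exists i; rewrite ik si /=.
case=> [/imsetP[i iS ->]|/existsP[i /and3P[ik si /eqP->]]].
  exists i; rewrite ?inE ?iS//= ffunE /c ffunE iS; by case: ifP.
by exists i; [rewrite !inE ik si orbT|rewrite [in RHS]ffunE ik].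
Qed.

(** Unsettled particles that have yet to jump in this round ring at [t + 1], the others at [t + 2];
    among the former, [pick] selects the smallest index, which is [k]. *)
Let part_step (k : I) : k \notin s.2 -> cunif_step x one (part k) = part k.+1.
Proof.
move=> kS; have kU : k \notin (part k).2 by rewrite !inE (negbTE kS) ltnn.
have kt : (part k).1 k = t by rewrite ffunE ltnn s_t.
have ct i : i \notin s.2 -> c i = t.+1 by move=> iS; rewrite ffunE (negbTE iS) s_t.
have nk : next_particle one (part k) = Some k.
  apply: pick_ord_first => [|j jk].
    rewrite kU; apply/forallP => j; apply/implyP => jU.
    rewrite !ring_time_one ler_nat ltnS kt ffunE.
    have jS : j \notin s.2 by apply: contraNN jU; rewrite inE => ->.
    by case: ifP => _; rewrite ?ct// s_t.
  apply/negP => /andP[jU /forallP/(_ k)/implyP/(_ kU)].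
  rewrite !ring_time_one ler_nat ltnS kt ffunE jk.
  have jS : j \notin s.2 by apply: contraNN jU; rewrite inE => ->.
  by rewrite ct// ltnn.
rewrite /cunif_step nk kt -(ct k kS); congr pair.
  apply/ffunP => j; rewrite [LHS]ffunE [RHS]ffunE [(j < _)%N]ltnS leq_eqVlt.
  case: (eqVneq j k) => [->|jk]; first by rewrite eqxx.
  by rewrite (_ : (j == k :> nat) = false) ?ffunE//; apply/negbTE.
rewrite occupied_part.
(* The target of [k] is taken either before the round or by a smaller index during it, that is,
   exactly when [k] is not the least index reaching that free vertex. The minimum below provides the
   particle that took it. *)
have -> : (x k (c k) \in occupied x s) || [exists i : I, [&& (i < k)%N, settles i & x k (c k) == x i (c i)]]
    = ~~ settles k.
  rewrite /settles; have [yo|yo] := boolP (x k (c k) \in _); first by rewrite /on_free yo andbF.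
  have fk : on_free k by rewrite /on_free kS.
  rewrite fk negb_forall /=; apply/existsP/existsP => -[j].
    move=> /and3P[jk /andP[fj _] /eqP yE]; exists j.
    by rewrite negb_imply fj yE eqxx -ltnNge.
  rewrite negb_imply -ltnNge => /andP[/andP[fj yE] jk].
  case: (@arg_minnP _ j (fun i => on_free i && (x i (c i) == x k (c k))) (fun i => nat_of_ord i)).
    by rewrite fj.
  move=> i /andP[fi /eqP yi] imin; exists i; rewrite yi eqxx andbT fi.
  rewrite (leq_ltn_trans (imin j _)) ?fj//=.
  by apply/forallP => l; apply/implyP => H; apply: imin.
apply/finset.setP => j.
have ltE : j != k -> (j < k.+1)%N = (j < k)%N.
  by move=> jk; rewrite ltnS leq_eqVlt (_ : (j == k :> nat) = false)//; apply/negbTE.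
case: ifP => /= [nsk|/negbFE sk]; rewrite !inE; case: (eqVneq j k) => [->|/ltE->//].
  by rewrite (negbTE nsk) !andbF.
by rewrite ltnSn sk !orbT.
Qed.

Let part_skip (k : I) : k \in s.2 -> part k.+1 = part k.
Proof.
move=> kS; congr pair.
  apply/ffunP => j; rewrite !ffunE ltnS leq_eqVlt.
  case: (eqVneq j k) => [->|jk]; first by rewrite eqxx ltnn kS.
  by rewrite (_ : (j == k :> nat) = false)//; apply/negbTE.
apply/finset.setP => j; rewrite !inE ltnS leq_eqVlt.
case: (eqVneq j k) => [->|jk]; first by rewrite kS.
by rewrite (_ : (j == k :> nat) = false)//; apply/negbTE.
Qed.

Lemma par_step_cunif : exists m, par_step x s = iter m (cunif_step x one) s.
Proof.
have H k : (k <= #|V|)%N -> exists m, part k = iter m (cunif_step x one) s.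
  elim: k => [_|k IH kn].
    exists 0%N; rewrite /= /part; case: s => s1 s2 /=; congr pair.
      by apply/ffunP => i; rewrite ffunE.
    by apply/finset.setP => i; rewrite !inE orbF.
  have [m mE] := IH (ltnW kn).
  have [kS|kS] := boolP (Ordinal kn \in s.2).
    by exists m; rewrite -mE (part_skip kS).
  by exists m.+1; rewrite iterS -mE (part_step kS).
have [m E] := H _ (leqnn _); exists m; rewrite -E; congr pair.
  by apply/ffunP => i; rewrite [RHS]ffunE ltn_ord.
by apply/finset.setP => i; rewrite !inE ltn_ord.
Qed.

End round.

Lemma par_state_count t i :
  ((par_state x t).1 i <= t)%N /\ (i \notin (par_state x t).2 -> (par_state x t).1 i = t).
Proof.
elim: t => [|t [IH1 IH2]]; first by rewrite ffunE.
rewrite /par_state iterS -/(par_state x t) /= ffunE; split.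
  by case: ifP => _; [exact: leqW|rewrite ltnS].
by rewrite !inE negb_or => /andP[iS _]; rewrite (negbTE iS) IH2.
Qed.

Lemma par_state_cunif t : exists m, par_state x t = cunif_state x one m.
Proof.
elim: t => [|t [m IH]]; first by exists 0%N.
have [m' E] := par_step_cunif (fun i => (par_state_count t i).2).
by exists (m' + m)%N; rewrite /par_state iterS -/(par_state x t) E IH /cunif_state iterD.
Qed.

End parallel.

Section span.
Variables (R : realType) (V : finType).
Local Notation I := 'I_#|V|.
Implicit Types (x : I -> nat -> V) (a r : I -> nat -> R).
Local Notation one := (fun _ _ => 1 : R).

Definition last_ring x a r m : R :=
  \big[Num.max/0]_i ring_time r i ((cunif_state x a m).1 i).

(* The time, as measured by the clocks [r], at which the last particle settles
   when the clocks [a] determine the order of the jumps. *)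
Definition span x a r : \bar R :=
  ereal_inf [set (last_ring x a r m)%:E |
             m in [set m | (cunif_state x a m).2 = [set: I]%SET]].

Lemma last_ring_ge0 x a r m : 0 <= last_ring x a r m.
Proof. by apply: bigmax_ge_id. Qed.

Lemma last_ring_le x a r m t : (last_ring x a r m <= t) =
  (0 <= t) && [forall i, ring_time r i ((cunif_state x a m).1 i) <= t].
Proof.
apply/bigmax_leP/andP => [[t0 H]|[t0 /forallP H]]; split => //.
by apply/forallP => i; exact: H.
Qed.

Lemma span_settled x a r m : (cunif_state x a m).2 = [set: I]%SET ->
  span x a r = (last_ring x a r m)%:E.
Proof.
move=> sT; rewrite /span (_ : [set _ | _ in _] = [set (last_ring x a r m)%:E]).
  exact: ereal_inf1.
apply/seteqP; split => [_ [m' /= sT' <-]|_ ->]; last by exists m.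
congr (_%:E); rewrite /last_ring; have [mm'|/ltnW m'm] := leqP m m'.
  by rewrite (cunif_state_settled mm').
by rewrite (cunif_state_settled m'm).
Qed.

Lemma span_unsettled x a r : (forall m, (cunif_state x a m).2 <> [set: I]%SET) ->
  span x a r = +oo%E.
Proof.
move=> sT; rewrite /span (_ : [set _ | _ in _] = set0) ?ereal_inf0//.
by apply/seteqP; split => // y [m' /= sT' _]; have := sT _ sT'.
Qed.

Lemma spanP x a r : (exists2 m, (cunif_state x a m).2 = [set: I]%SET &
    span x a r = (last_ring x a r m)%:E) \/
  ((forall m, (cunif_state x a m).2 <> [set: I]%SET) /\ span x a r = +oo%E).
Proof.
have [[m sT]|ns] := pselect (exists m, (cunif_state x a m).2 = [set: I]%SET).
  by left; exists m => //; exact: span_settled.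
have H m : (cunif_state x a m).2 <> [set: I]%SET by move=> sT; apply: ns; exists m.
by right; split => //; exact: span_unsettled.
Qed.

Lemma span_ge0 x a r : (0 <= span x a r)%E.
Proof. by have [[m _ ->]|[_ ->]] := spanP x a r; rewrite ?lee_fin ?last_ring_ge0 ?leey. Qed.

(** A particle unsettled after [t] rounds has jumped exactly [t] times, so the number of rounds is
    the largest jump count, and with unit clocks a ring time is a jump count. *)
Lemma tau_parE x : tau_par x = span x one one.
Proof.
have one_nat m : last_ring x one one m = (\max_i (cunif_state x one m).1 i)%N%:R.
  apply/eqP; rewrite eq_le last_ring_le ler0n/=; apply/andP; split.
    by apply/forallP => i; rewrite ring_time_one ler_nat leq_bigmax.
  rewrite /last_ring; case: (posnP (\max_i (cunif_state x one m).1 i)%N) => [->|M0].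
    exact: bigmax_ge_id.
  have I0 : (0 < #|{: I}|)%N by apply: contraTT M0; rewrite -!eqn0Ngt => /eqP I0; rewrite big_pred0// => i; have := fintype0 i I0.
  have [i ->] := @bigop.eq_bigmax _ (fun i : I => (cunif_state x one m).1 i) I0.
  by rewrite -(ring_time_one R i); apply: (@le_bigmax _ _ _ 0 (fun i => ring_time one i ((cunif_state x one m).1 i))).
apply/eqP; rewrite eq_le; apply/andP; split.
  apply: le_ereal_inf_tmp => _ [m /= sT <-].
  rewrite one_nat; set M := (\max_i _)%N.
  suff pT : (par_state x M).2 = [set: I]%SET by apply: ereal_inf_lbound; exists M.
  apply/eqP; apply: contraT => /negP nT.
  have [i iU] : exists i, i \notin (par_state x M).2.
    apply: contrapT => H; apply: nT; apply/eqP/finset.setP => i; rewrite inE.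
    by apply: contraT => iU; exfalso; apply: H; exists i.
  have cE : (par_state x M.+1).1 i = M.+1.
    by rewrite /par_state iterS -/(par_state x M) /= ffunE (negbTE iU) (par_state_count x M i).2.
  have [m' E] := par_state_cunif R x M.+1.
  have h1 : ((cunif_state x one m').1 i <= (cunif_state x one (maxn m m')).1 i)%N.
    by apply: cunif_state_count; exact: leq_maxr.
  have h2 : ((cunif_state x one m).1 i <= M)%N by exact: leq_bigmax.
  move: h1; rewrite -E cE (cunif_state_settled (leq_maxl _ _) sT) => h1.
  by have := leq_trans h1 h2; rewrite ltnn.
apply: le_ereal_inf_tmp => _ [t /= pT <-].
have [m E] := par_state_cunif R x t.
apply: (@le_trans _ _ (last_ring x one one m)%:E).
  by apply: ereal_inf_lbound; exists m => //=; rewrite -E.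
rewrite lee_fin last_ring_le ler0n/=; apply/forallP => i.
by rewrite ring_time_one ler_nat -E (par_state_count x t i).1.
Qed.

(** The order [a] is the same on both sides, hence so are the jump counts; only the conversion of
    counts into times changes. *)
Lemma span_compare x a r r' (c K : R) (psi : \bar R) :
  0 < c -> 0 <= K -> (0 <= psi)%E ->
  (forall i k, ((ring_time r i k - (c * ring_time r' i k + K))%:E <= psi)%E) ->
  (span x a r <= c%:E * span x a r' + K%:E + psi)%E.
Proof.
move=> c0 K0 psi0 H.
have [[m sT E]|[nT E]] := spanP x a r'; last first.
  have -> : (c%:E * span x a r' + K%:E = +oo)%E by rewrite E gt0_muley ?lte_fin.
  by case: psi psi0 {H} => [p _| _|]; rewrite ?leey.
rewrite (span_settled _ sT) E; case: psi psi0 H => [p||]//; last by move=> _ _; rewrite -EFinM -EFinD leey.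
rewrite lee_fin -!EFinM -!EFinD => p0 H; rewrite lee_fin last_ring_le.
apply/andP; split; first by rewrite !addr_ge0// mulr_ge0 ?last_ring_ge0// ltW.
apply/forallP => i; have := H i ((cunif_state x a m).1 i); rewrite lee_fin lerBlDl => h.
apply: (le_trans h); rewrite lerD2r lerD2r ler_wpM2l ?(ltW c0)//.
by rewrite /last_ring; apply: (@le_bigmax _ _ _ 0 (fun i => ring_time r' i ((cunif_state x a m).1 i))).
Qed.

End span.

Section span_measurable.
Variables (R : realType) (V : finType).
Local Notation I := 'I_#|V|.
Variables (d : measure_display) (O : measurableType d).
Variables (x : I -> nat -> O -> V) (a r : I -> nat -> O -> R).
Hypothesis mx : forall i t u, measurable [set w | x i t w = u].
Hypothesis ma : forall i k, measurable_fun setT (a i k).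
Hypothesis mr : forall i k, measurable_fun setT (r i k).
Local Notation spanw := (fun w =>
  span (fun i t => x i t w) (fun i k => a i k w) (fun i k => r i k w)).

Lemma measurable_span : measurable_fun setT spanw.
Proof.
apply: (measurability _ (ErealGenInftyO.measurableE R)) => _ /= [_ [t ->] <-].
rewrite setTI (_ : _ @^-1` _ = \bigcup_m ([set w | (cunif_state (fun i t => x i t w)
    (fun i k => a i k w) m).2 = [set: I]%SET] `&`
   [set w | last_ring (fun i t => x i t w) (fun i k => a i k w) (fun i k => r i k w) m < t])).
  apply: bigcupT_measurable => m; apply: measurableI; first exact: measurable_settled.
  have [t0|t0] := ltP 0 t; last first.
    rewrite (_ : [set w | _] = set0)//; apply/seteqP; split => w //=.
    by rewrite ltNge (le_trans t0)// last_ring_ge0.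
  rewrite (_ : [set w | _] = [set w | forall i, ring_time (fun i k => r i k w) i
     ((cunif_state (fun i t => x i t w) (fun i k => a i k w) m).1 i) < t]).
    exact: measurable_last_ring_lt.
  apply/seteqP; split => w /=; rewrite /last_ring; first by move/bigmax_ltP => [_ H] i; exact: H.
  by move=> H; apply/bigmax_ltP; split.
apply/seteqP; split => w /=.
  rewrite in_itv/=.
  have [[m sT ->]|[_ ->]] := spanP (fun i t => x i t w) (fun i k => a i k w) (fun i k => r i k w);
    last by rewrite ltNge leey.
  by rewrite lte_fin; exists m.
by move=> [m _ [/= sT]]; rewrite in_itv/= (span_settled _ sT) lte_fin.
Qed.

End span_measurable.

Section span_dominance.
Variables (R : realType) (V : finType) (e : rel V) (v : V).
Local Notation I := 'I_#|V|.
Variables (d : measure_display) (O : measurableType d) (P : probability O R).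
Variables (Y : I -> nat -> O -> V) (S : I -> nat -> O -> R).
Hypothesis YS : indep_walks_clocks P e v Y S.
Local Notation sp b b' w := (span (fun i l => Y i l w) (clk S b w) (clk S b' w)).

Lemma measurable_span_clk b b' : measurable_fun setT (fun w => sp b b' w).
Proof.
have [mY _ _] := YS.
by apply: (measurable_span mY) => i k; exact: (measurable_clk YS).
Qed.

(** The bound on the number of jumps is removed: the events on the left increase with [m]. *)
Lemma span_dominance b b' (t : R) :
  (P [set w | (sp b b w < t%:E)%E] <= P [set w | (sp b' b w <= t%:E)%E])%E.
Proof.
have [t0|t0] := ltP 0 t; last first.
  rewrite (_ : [set w | _] = set0) ?measure0//; apply/seteqP; split => w //=.
  by rewrite ltNge (@le_trans _ _ 0%E)// span_ge0.
have [mY _ _] := YS; have mc := measurable_clk YS.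
pose A m := [set w | (cunif_state (fun i l => Y i l w) (clk S b w) m).2 = [set: I]%SET] `&`
  [set w | forall i, ring_time (clk S b w) i
         ((cunif_state (fun i l => Y i l w) (clk S b w) m).1 i) < t].
have mA m : measurable (A m).
  apply: measurableI; first by apply: measurable_settled => // i k; exact: mc.
  by apply: measurable_last_ring_lt => // i k; exact: mc.
have -> : [set w | (sp b b w < t%:E)%E] = \bigcup_m A m.
  apply/seteqP; split => w /=.
    have [[m sT ->]|[_ ->]] := spanP (fun i l => Y i l w) (clk S b w) (clk S b w);
      last by rewrite ltNge leey.
    rewrite lte_fin => /bigmax_ltP[_ H]; exists m => //; split => // i; exact: H.
  move=> [m _ [/= sT H]]; rewrite (span_settled _ sT) lte_fin.
  by apply/bigmax_ltP; split.
have ndA : {homo A : n m / (n <= m)%N >-> (n <= m)%O}.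
  move=> n m nm; apply/subsetPset => w [/= sT H].
  by rewrite /A/= !(cunif_state_settled nm).
have cA := nondecreasing_cvg_mu mA (bigcupT_measurable A mA) ndA (mu := P).
rewrite -(cvg_lim _ cA)//; apply: lime_le; first by apply/cvg_ex; eexists; exact: cA.
apply: nearW => m /=; apply: (le_trans (clk_dominance_strict YS b b' m t)).
apply: le_measure; rewrite ?inE.
- by apply: measurable_done_by => // i k; exact: mc.
- rewrite -[X in measurable X]setTI.
  apply: emeasurable_fun_le => //; exact: measurable_span_clk.
- move=> w /= /andP[/eqP sT H]; rewrite (span_settled _ sT) lee_fin last_ring_le H andbT.
  exact: ltW.
Qed.

End span_dominance.

(** * Expectations, and the integrability of the parallel settling time *)

Section tail_sums.
Variable R : realType.
Implicit Types T : \bar R.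

Lemma le_tail_sum T (h : R) : 0 < h ->
  (T <= h%:E * \sum_(0 <= k <oo) (((k%:R * h)%:E < T)%E%:R)%:E)%E.
Proof.
move=> h0; pose f k : \bar R := (((k%:R * h)%:E < T)%E%:R)%:E.
have f0 k : (0 <= f k)%E by rewrite lee_fin.
have lb N : (forall k, (k < N)%N -> ((k%:R * h)%:E < T)%E) ->
    ((N%:R * h)%:E <= h%:E * \sum_(0 <= k <oo) f k)%E.
  move=> H; rewrite mulrC EFinM; apply: lee_wpmul2l; first by rewrite lee_fin ltW.
  apply: le_trans (nneseries_lim_ge N _); last by move=> k _ _.
  rewrite /f big_nat (eq_bigr (fun=> 1%E)); last by move=> k /andP[_ /H ->].
  by rewrite -big_nat sumEFin sumr_const_nat subn0.
case: T @f f0 lb => [r||] f f0 lb; last 2 first.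
- rewrite leye_eq; apply/eqP/eqyP => A A0.
  apply: le_trans (lb (Num.truncn (A / h)).+1 _); last by move=> k _; rewrite ltry.
  rewrite lee_fin -ler_pdivrMr// ltW// -truncn_lt_nat// divr_ge0// ltW//.
- by rewrite leNye.
have [m rm] : exists m : nat, r <= m%:R * h.
  by exists (Num.truncn (r / h)).+1; rewrite -ler_pdivrMr// ltW// truncnS_gt.
have [N rN Nmin] := ex_minnP (ex_intro (fun m : nat => r <= m%:R * h) m rm).
apply: le_trans (lb N _); first by rewrite lee_fin.
move=> k kN; rewrite lte_fin ltNge; apply/negP => /Nmin.
by rewrite leqNgt kN.
Qed.

Lemma tail_sum_le T : (0 <= T)%E ->
  (\sum_(0 <= k <oo) ((k.+1%:R%:E <= T)%E%:R)%:E <= T)%E.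
Proof.
move=> T0; apply: lime_le.
  by apply: is_cvg_nneseries => k _ _; rewrite lee_fin.
apply: nearW; elim => [|N IH]; first by rewrite big_geq.
rewrite big_nat_recr//=; case: (boolP (_ <= T)%E) => [NT|_]; last by rewrite adde0.
apply: le_trans NT; rewrite -natr1 EFinD leeD//.
rewrite sumEFin lee_fin.
apply: (@le_trans _ _ (\sum_(0 <= k < N) 1)); first by apply: ler_sum => k _; case: (_ <= _)%E.
by rewrite sumr_const_nat subn0.
Qed.

Lemma bool_indicE (O : Type) (b : O -> bool) w : (b w)%:R = \1_[set w | b w] w :> R.
Proof. by rewrite indicE; congr ((_ : bool)%:R); apply/idP/idP; rewrite inE. Qed.

Lemma measurable_bool d (O : measurableType d) (b : O -> bool) :
  measurable [set w | b w] -> measurable_fun setT (fun w => ((b w)%:R)%:E : \bar R).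
Proof.
move=> mb; apply/measurable_EFinP; rewrite (_ : (fun w => _) = \1_[set w | b w]).
  exact: measurable_indic.
by apply/funext => w; exact: bool_indicE.
Qed.

Lemma integral_bool d (O : measurableType d) (P : probability O R) (b : O -> bool) :
  measurable [set w | b w] -> (\int[P]_w ((b w)%:R)%:E = P [set w | b w])%E.
Proof.
move=> mb; under eq_integral do rewrite bool_indicE.
by rewrite integral_indic// setIT.
Qed.

(** [X] is at most the number of [k >= 0] with [k < X], and [Y] at least the number of [k >= 1] with
    [k <= Y]; the term [k = 0] accounts for the 1. *)
Lemma expectation_le_of_tails d1 d2 (O1 : measurableType d1) (O2 : measurableType d2)
    (P1 : probability O1 R) (P2 : probability O2 R) (X : O1 -> \bar R) (Y : O2 -> \bar R) :
  measurable_fun setT X -> measurable_fun setT Y -> (forall w, 0 <= Y w)%E ->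
  (forall k : nat, (P1 [set w | (k%:R%:E < X w)%E] <= P2 [set w | (k%:R%:E <= Y w)%E])%E) ->
  (forall w, 0 <= X w)%E ->
  (\int[P1]_w X w <= 1 + \int[P2]_w Y w)%E.
Proof.
move=> mX mY Y0 XY X0.
have mXk k : measurable [set w | (k%:R%:E < X w)%E].
  by rewrite -[X in measurable X]setTI; apply: emeasurable_fun_lt.
have mYk k : measurable [set w | (k%:R%:E <= Y w)%E].
  by rewrite -[X in measurable X]setTI; apply: emeasurable_fun_le.
have intX k := integral_bool P1 (mXk k); have intY k := integral_bool P2 (mYk k).
have mXi k := measurable_bool (mXk k); have mYi k := measurable_bool (mYk k).
apply: (@le_trans _ _ (\int[P1]_w (\sum_(0 <= k <oo) ((k%:R%:E < X w)%E%:R)%:E))%E).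
  apply: ge0_le_integral => //.
  - by apply: ge0_emeasurable_sum => // k w _ _; rewrite lee_fin.
  - move=> w _; have := le_tail_sum (X w) (@ltr01 R); rewrite mul1e.
    by under eq_eseriesr do rewrite mulr1.
rewrite integral_nneseries//.
apply: (@le_trans _ _ (\sum_(0 <= k <oo) P2 [set w | (k%:R%:E <= Y w)%E])%E).
  by apply: lee_nneseries => [k _|k _]; rewrite intX.
rewrite nneseries_recl//; apply: leeD; first exact: probability_le1.
apply: (@le_trans _ _ (\int[P2]_w (\sum_(0 <= k <oo) ((k.+1%:R%:E <= Y w)%E%:R)%:E))%E); last first.
  apply: ge0_le_integral => //.
  - by move=> w _; apply: nneseries_ge0 => k _ _; rewrite lee_fin.
  - by apply: ge0_emeasurable_sum => // k w _ _; rewrite lee_fin.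
  - by move=> w _; exact: tail_sum_le.
rewrite integral_nneseries//.
rewrite -(@nneseries_addn _ _ 1)//.
rewrite le_eqVlt; apply/orP; left; apply/eqP; apply: eq_eseriesr => k _.
by rewrite intY addn1.
Qed.

End tail_sums.

(** * A single walk avoids a given vertex with geometrically small probability *)

Section hitting.
Variables (R : realType) (V : finType) (e : rel V) (u : V).
Hypothesis eG : connected_graph e.
Hypothesis V1 : (1 < #|V|)%N.
Local Notation n := #|V|.

(* Probability that the walk started at [x] avoids [u] at times 1, ..., k. *)
Fixpoint avoid (k : nat) (x : V) : R :=
  if k is k'.+1 then \sum_(y | y != u) srw e x y * avoid k' y else 1.

Lemma avoid_bounds k x : 0 <= avoid k x <= 1.
Proof.
elim: k x => [|k IH] x /=; first by rewrite ler01 lexx.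
rewrite sumr_ge0/=; last by move=> y _; rewrite mulr_ge0 ?srw_ge0//; have /andP[] := IH y.
apply: (@le_trans _ _ (\sum_y srw e x y)); last by rewrite srw_sum1.
rewrite [leRHS](bigID (fun y => y != u))/= -[leLHS]addr0; apply: lerD.
  by apply: ler_sum => y _; rewrite ler_piMr ?srw_ge0//; have /andP[] := IH y.
by rewrite sumr_ge0// => y _; exact: srw_ge0.
Qed.

Lemma srw_edge x y : e x y -> n%:R^-1 <= srw e x y :> R.
Proof.
move=> exy; have d0 : (0 < deg e x)%N by apply/card_gt0P; exists y.
rewrite /srw gtn_eqF// exy mul1r lef_pV2 ?posrE ?ltr0n//; last by rewrite (ltn_trans _ V1).
by rewrite ler_nat max_card.
Qed.

(** Following [p] is one way of hitting [u], and each of its edges is taken with probability at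
    least [1 / n]. *)
Lemma avoid_path k x p : path e x p -> p != [::] -> last x p = u -> (size p <= k)%N ->
  avoid k x <= 1 - n%:R^-1 ^+ size p.
Proof.
have n0 : 0 < n%:R :> R by rewrite ltr0n (ltn_trans _ V1).
have n1 : n%:R^-1 <= 1 :> R by rewrite invf_le1// ler1n (ltn_trans _ V1).
elim: k x p => [|k IH] x [|y p]//= /andP[exy pyp] _ lu pk.
have E1 : \sum_(z | z != u) srw e x z * avoid k z <= 1 - srw e x u.
  rewrite lerBrDl -(srw_sum1 R e x) [leRHS](bigD1 u)//= lerD2l.
  by apply: ler_sum => z _; rewrite ler_piMr ?srw_ge0//; have /andP[] := avoid_bounds k z.
have [yu|yu] := eqVneq y u.
  apply: (le_trans E1); rewrite lerD2l lerN2 -yu; apply: le_trans (srw_edge exy).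
  rewrite exprS; apply: ler_piMr; first by rewrite invr_ge0 ltW.
  by apply: exprn_ile1 => //; rewrite invr_ge0 ltW.
have pn : p != [::] by apply: contraNN yu => /eqP p0; rewrite p0/= in lu; rewrite lu.
have h := IH y p pyp pn lu pk.
rewrite (bigD1 y)//=; apply: (@le_trans _ _ (srw e x y * (1 - n%:R^-1 ^+ size p) + (1 - srw e x y))).
  apply: lerD; first by rewrite ler_wpM2l ?srw_ge0.
  rewrite lerBrDl -(srw_sum1 R e x) [leRHS](bigD1 y)//= lerD2l big_mkcondl/=.
  apply: ler_sum => z _; case: ifP => // _; rewrite ?srw_ge0//.
  by rewrite ler_piMr ?srw_ge0//; have /andP[] := avoid_bounds k z.
have -> : srw e x y * (1 - n%:R^-1 ^+ size p) + (1 - srw e x y) =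
    1 - srw e x y * n%:R^-1 ^+ size p :> R by ring.
by rewrite lerD2l lerN2 exprS ler_wpM2r ?srw_edge// exprn_ge0// invr_ge0 ltW.
Qed.

(* Some nonempty path to [u] has at most [n] edges, each of probability at least [1 / n]. *)
Definition hit_prob : R := n%:R^-1 ^+ n.

Lemma hit_prob_bounds : 0 < hit_prob <= 1.
Proof.
have n0 : 0 < n%:R :> R by rewrite ltr0n (ltn_trans _ V1).
rewrite exprn_gt0 ?invr_gt0//=; apply: exprn_ile1; first by rewrite invr_ge0 ltW.
by rewrite invf_le1// ler1n (ltn_trans _ V1).
Qed.

Lemma avoid_le x : avoid n x <= 1 - hit_prob.
Proof.
have [esym eirr econ] := eG.
have [p [pP p0 pl pn]] : exists p, [/\ path e x p, p != [::], last x p = u & (size p <= n)%N].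
  (* Avoidance is counted from time 1, so from [u] itself a return is needed: to a neighbour and
     back, two edges, within the bound since [n > 1]. *)
  have [->|xu] := eqVneq x u.
    have [y yu] : exists y, y != u.
      apply: contrapT => H; move: V1; rewrite ltnNge => /negP; apply.
      rewrite -(card1 u); apply: subset_leq_card; apply/fintype.subsetP => y _.
      by rewrite inE; apply: contraT => yu; exfalso; apply: H; exists y.
    have /connectP[[|z q] /= ] := econ u y; first by move=> _ yE; rewrite yE eqxx in yu.
    move=> /andP[uz _] _; exists [:: z; u]; split => //=.
    by rewrite uz esym uz.
  have /connectP[q qP qu] := econ x u.
  case/shortenP: qP qu => q' q'P q'U _ q'u; exists q'; split => //.
    by apply: contraNN xu => /eqP q0; rewrite q0/= in q'u; rewrite q'u.
  by rewrite ltnW//; have := max_card (mem (x :: q')); rewrite (card_uniqP q'U).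
apply: le_trans (avoid_path pP p0 pl pn) _; rewrite lerD2l lerN2.
have n0 : 0 < n%:R :> R by rewrite ltr0n (ltn_trans _ V1).
have n1 : 0 <= n%:R^-1 :> R by rewrite invr_ge0 ltW.
rewrite /hit_prob -[X in _ ^+ X](subnK pn) exprD; apply: ler_piMl; first exact: exprn_ge0.
by apply: exprn_ile1 => //; rewrite invf_le1// ler1n (ltn_trans _ V1).
Qed.

End hitting.

Section walk_law.
Variables (R : realType) (V : finType) (e : rel V) (v : V).
Variables (d : measure_display) (O : measurableType d) (P : probability O R).
Variables (I : finType) (X : I -> nat -> O -> V).
Hypothesis XW : indep_walks P e v X.

Lemma path_prob_ge0 m p : 0 <= path_prob e v m p :> R.
Proof. by rewrite mulr_ge0// prodr_ge0// => t _; exact: srw_ge0. Qed.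

Lemma eq_path_prob m p p' : (forall t, (t <= m)%N -> p t = p' t) ->
  path_prob e v m p = path_prob e v m p' :> R.
Proof.
move=> pp'; rewrite /path_prob pp'//; congr (_ * _); apply: eq_bigr => t _.
by rewrite !pp'// ltnW.
Qed.

Lemma measurable_path i m (p : nat -> V) : measurable [set w | forall t, (t <= m)%N -> X i t w = p t].
Proof.
have [mX _] := XW.
rewrite (_ : [set w | _] = \bigcap_(t in [set t | (t <= m)%N]) [set w | X i t w = p t]).
  by apply: bigcap_measurableType => t _; exact: mX.
by apply/seteqP; split.
Qed.

Lemma single_walk_law i m (p : nat -> V) :
  P [set w | forall t, (t <= m)%N -> X i t w = p t] = (path_prob e v m p)%:E.
Proof.
have [mX PX] := XW.
pose Rw := {ffun 'I_m.+1 -> V}.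
pose rows w : {ffun I -> Rw} := [ffun j => [ffun t : 'I_m.+1 => X j t w]].
pose pp (r : Rw) : R := path_prob e v m (fun t => r (inord t)).
have rowsE U : [set w | rows w = U] =
    [set w | forall j t, (t <= m)%N -> X j t w = U j (inord t)].
  apply/seteqP; split => w /= H; first by move=> j t tm; rewrite -H !ffunE inordK.
  by apply/ffunP => j; apply/ffunP => t; rewrite !ffunE H ?inord_val// -ltnS.
have mrows U : measurable [set w | rows w = U].
  rewrite rowsE (_ : [set w | _] = \bigcap_(j in setT)
     [set w | forall t, (t <= m)%N -> X j t w = U j (inord t)]).
    by apply: fin_bigcap_measurable => [|j _]; [exact: finite_finset|exact: measurable_path].
  by apply/seteqP; split => w H j; [move=> _|]; exact: H.
have Prows (Q : pred Rw) j : P [set w | Q (rows w j)] =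
    ((\sum_r pp r * (Q r)%:R) * \prod_(k | k != j) \sum_r pp r)%:E.
  rewrite (probability_finType (X := rows) P (fun U : {ffun I -> Rw} => Q (U j)))//.
  rewrite (eq_bigr (fun U : {ffun I -> Rw} => (\prod_k pp (U k))%:E)); last first.
    by move=> U _; rewrite -PX -rowsE.
  rewrite sumEFin; congr (_%:E).
  pose F k (r : Rw) : R := pp r * (if k == j then (Q r)%:R else 1).
  transitivity (\sum_(U : {ffun I -> Rw}) \prod_k F k (U k)).
    rewrite big_mkcond; apply: eq_bigr => U _.
    have -> : \prod_k F k (U k) = (\prod_k pp (U k)) * (Q (U j))%:R.
      rewrite big_split/=; congr (_ * _); rewrite (bigD1 j)//= eqxx big1 ?mulr1//.
      by move=> k /negbTE ->.
    by case: (Q (U j)); rewrite ?mulr1 ?mulr0.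
  rewrite -bigA_distr_bigA (bigD1 j)//=; congr (_ * _).
    by apply: eq_bigr => r _; rewrite /F eqxx.
  by apply: eq_bigr => k /negbTE kj; apply: eq_bigr => r _; rewrite /F kj mulr1.
have pp0 : 0 <= \sum_r pp r by apply: sumr_ge0 => r _; exact: path_prob_ge0.
(* Total probability says that a positive power of this nonnegative sum is 1. *)
have pp1 : \sum_r pp r = 1.
  have := Prows xpredT i; rewrite (_ : [set w | _] = setT)//; last exact/seteqP.
  rewrite probability_setT => H; move: (congr1 fine (esym H)) => /= {H}.
  rewrite (eq_bigr pp); last by move=> r _; rewrite mulr1.
  by rewrite prodr_const -exprS => /eqP; rewrite pexpr_eq1// => /eqP.
rewrite (_ : [set w | _] = [set w | rows w i == [ffun t : 'I_m.+1 => p t]]).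
  rewrite (Prows (pred1 [ffun t : 'I_m.+1 => p t])); congr (_%:E).
  rewrite [X in _ * X]big1 ?mulr1; last by move=> k _; exact: pp1.
  rewrite (bigD1 [ffun t : 'I_m.+1 => p t])//= eqxx mulr1 big1 ?addr0; last first.
    by move=> r /negbTE ->; rewrite mulr0.
  by apply: eq_path_prob => t tm; rewrite ffunE inordK.
apply/seteqP; split => w /=.
  by move=> H; apply/eqP/ffunP => t; rewrite !ffunE H// -ltnS.
by move=> /eqP H t tm; have := congr1 (fun f : Rw => f (inord t)) H; rewrite !ffunE inordK.
Qed.

Variables (i : I) (u : V).

Definition avoids t (w : O) : Prop := forall l, (0 < l <= t)%N -> X i l w <> u.

Let mass t y : R := fine (P [set w | X i t w = y /\ avoids t w]).

Let Rw t := {ffun 'I_t.+1 -> V}.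
Let row t w : Rw t := [ffun l : 'I_t.+1 => X i l w].
Let rp t (r : Rw t) : R := path_prob e v t (fun l => r (inord l)).
Let av t (r : Rw t) := [forall l : 'I_t.+1, (0 < l)%N ==> (r l != u)].

Let rowE t w r : row t w = r <-> (forall l, (l <= t)%N -> X i l w = r (inord l)).
Proof.
split=> [<- l lt|H]; first by rewrite ffunE inordK.
by apply/ffunP => l; rewrite ffunE H ?inord_val// -ltnS.
Qed.

Let measurable_row t r : measurable [set w | row t w = r].
Proof.
rewrite (_ : [set w | _] = [set w | forall l, (l <= t)%N -> X i l w = r (inord l)]).
  exact: measurable_path.
by apply/seteqP; split => w /= /rowE.
Qed.

Let avP t w : av (row t w) <-> avoids t w.
Proof.
split=> [/forallP H l /andP[l0 lt] lu|H].
  have ltt : (l < t.+1)%N by [].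
  by have := H (Ordinal ltt); rewrite /= l0 ffunE lu eqxx.
by apply/forallP => l; apply/implyP => l0; rewrite ffunE; apply/eqP; apply: H; rewrite l0 -ltnS/=.
Qed.

Lemma measurable_avoids t : measurable [set w | avoids t w].
Proof.
rewrite (_ : [set w | _] = [set w | av (row t w)]); first exact: (measurable_finType_pred (fun r => av r) (@measurable_row t)).
by apply/seteqP; split => w /= /avP.
Qed.

Let massE t y : mass t y = \sum_(r | av r && (r ord_max == y)) rp (t := t) r.
Proof.
rewrite /mass (_ : [set w | _] = [set w | av (row t w) && (row t w ord_max == y)]).
  rewrite (probability_finType P (fun r => av r && (r ord_max == y)) (measurable_row (t := t))).
  under eq_bigr => r _.
    rewrite (_ : [set w | _] = [set w | forall l, (l <= t)%N -> X i l w = r (inord l)]).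
      rewrite single_walk_law; over.
    by apply/seteqP; split => w /= /rowE.
  by rewrite sumEFin.
apply/seteqP; split => w /=.
  by move=> [Xy /avP ->]; rewrite ffunE/= Xy eqxx.
by move=> /andP[/avP ? /eqP]; rewrite ffunE.
Qed.

Let massS t y : mass t.+1 y = (y != u)%:R * \sum_x mass t x * srw e x y.
Proof.
have [mX _] := XW.
have [->|yu] := eqVneq y u.
  rewrite mul0r /mass (_ : [set w | _] = set0) ?measure0//.
  by apply/seteqP; split => // w [/= Xu] /(_ t.+1); rewrite leqnn /= => /(_ isT).
rewrite mul1r [LHS]/mass (_ : [set w | X i t.+1 w = y /\ _] = [set w | av (row t w) && (X i t.+1 w == y)]); last first.
  apply/seteqP; split => w /=.
    move=> [Xy A]; rewrite Xy eqxx andbT; apply/avP => l /andP[l0 lt].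
    by apply: A; rewrite l0 leqW.
  move=> /andP[/avP A /eqP Xy]; split => // l /andP[l0]; rewrite leq_eqVlt => /orP[/eqP->|lt].
    by rewrite Xy; exact/eqP.
  by apply: A; rewrite l0.
have mrX (z : Rw t * V) : measurable [set w | (row t w, X i t.+1 w) = z].
  case: z => r z; rewrite (_ : [set w | _] = [set w | row t w = r] `&` [set w | X i t.+1 w = z]).
    by apply: measurableI; [exact: measurable_row|exact: mX].
  by apply/seteqP; split => w /=; [case=> <- <-|move=> [<- <-]].
have := @probability_finType _ _ _ P _ (fun w => (row t w, X i t.+1 w))
  (fun z => av z.1 && (z.2 == y)) mrX.
move=> /= ->.
have zE z : P [set w | (row t w, X i t.+1 w) = z] = (rp z.1 * srw e (z.1 ord_max) z.2)%:E.
  case: z => r z /=.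
  rewrite (_ : [set w | _] = [set w | forall l, (l <= t.+1)%N ->
      X i l w = (if (l <= t)%N then r (inord l) else z)]).
    rewrite single_walk_law; congr (_%:E).
    rewrite /path_prob/= /rp /path_prob big_ord_recr/= leqnn ltnn -mulrA; congr (_ * (_ * _)).
      by apply: eq_bigr => l _; rewrite (ltnW (ltn_ord l)) ltn_ord.
    by congr (srw _ (r _) _); apply: val_inj; rewrite /= inordK.
  apply/seteqP; split => w /=.
    case=> /rowE H <- l; rewrite leq_eqVlt => /orP[/eqP->|]; first by rewrite ltnn.
    by rewrite ltnS => lt; rewrite lt H.
  move=> H; congr pair; last by rewrite H// ltnn.
  by apply/rowE => l lt; rewrite H ?leqW// lt.
under eq_bigr => z _ do rewrite zE.
rewrite sumEFin/= -(pair_big (fun r => av r) (fun z => z == y) (fun r z => rp r * srw e (r ord_max) z))/=.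
under eq_bigr do rewrite big_pred1_eq.
rewrite (partition_big (fun r : Rw t => r ord_max) xpredT)//=; apply: eq_bigr => x _.
rewrite massE mulr_suml; apply: eq_bigr => r /andP[_ /eqP->].
by [].
Qed.

Let mass_ge0 t y : 0 <= mass t y. Proof. exact: fine_ge0. Qed.

(** The Markov property at time [t]: [mass t] is the law of the position at time [t], restricted to
    the walks that have avoided [u]. *)
Let mass_avoid t k : \sum_x mass (t + k) x = \sum_x mass t x * avoid R e u k x.
Proof.
elim: k t => [|k IH] t; first by rewrite addn0; apply: eq_bigr => x _; rewrite mulr1.
rewrite addnS -addSn IH /=.
under eq_bigr => x _ do rewrite massS.
under [RHS]eq_bigr => x _ do rewrite mulr_sumr.
rewrite exchange_big/= [RHS]big_mkcond/=; apply: eq_bigr => y _.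
case: ifP => yu; last by rewrite !mul0r.
by rewrite mul1r mulr_suml; apply: eq_bigr => x _; rewrite mulrA.
Qed.

Let massT t : P [set w | avoids t w] = (\sum_x mass t x)%:E.
Proof.
have [mX _] := XW.
have mXa y : measurable [set w | X i t w = y /\ avoids t w].
  by apply: measurableI; [exact: mX|exact: measurable_avoids].
rewrite -sumEFin; under eq_bigr => x _ do rewrite fineK ?fin_num_measure//.
rewrite (_ : [set w | avoids t w] = \bigcup_(y in setT) [set w | X i t w = y /\ avoids t w]).
  rewrite measure_fin_bigcup//; [|exact: finite_finset|].
    rewrite (@fsbigE _ _ _ _ _ (enum V)) ?enum_uniq//; last by move=> x _; rewrite mem_enum.
    by rewrite big_enum_cond/=; apply: eq_bigl => x; rewrite in_setT.
  apply/trivIsetP => y y' _ _ yy'; apply/seteqP; split => // w [[/= yE _] [y'E _]].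
  by move: yy'; rewrite -yE -y'E eqxx.
by apply/seteqP; split => w; [move=> A; exists (X i t w)|move=> [y _ []]].
Qed.

Lemma avoids_geometric k : connected_graph e -> (1 < #|V|)%N ->
  (P [set w | avoids (k * #|V|) w] <= ((1 - hit_prob R V) ^+ k)%:E)%E.
Proof.
move=> eG V1; rewrite massT lee_fin; elim: k => [|k IH].
  by rewrite expr0 -lee_fin -massT probability_le1//; exact: measurable_avoids.
rewrite mulSn addnC mass_avoid exprSr; apply: (@le_trans _ _ (\sum_x mass (k * #|V|) x * (1 - hit_prob R V))).
  by apply: ler_sum => x _; rewrite ler_wpM2l// avoid_le.
rewrite -mulr_suml ler_wpM2r// subr_ge0.
by have /andP[] := @hit_prob_bounds R V V1.
Qed.

End walk_law.

Lemma probability_union_le d (O : measurableType d) (R : realType)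
    (P : probability O R) (J : finType) (A : set O) (B : J -> set O) :
  measurable A -> (forall j, measurable (B j)) ->
  (forall w, A w -> exists j, B j w) -> (P A <= \sum_j P (B j))%E.
Proof.
move=> mA mB AB.
have H (s : seq J) : measurable (\big[setU/set0]_(j <- s) B j) /\
    (P (\big[setU/set0]_(j <- s) B j) <= \sum_(j <- s) P (B j))%E.
  elim: s => [|j s [IH1 IH2]]; first by rewrite !big_nil measure0.
  rewrite !big_cons; split; first exact: measurableU.
  by apply: le_trans (leeD2l _ IH2); exact: measureU2.
have [m1 m2] := H (enum J).
rewrite -big_enum/=; apply: le_trans m2; apply: le_measure; rewrite ?inE//.
move=> w /AB[j Bj]; rewrite -bigcup_seq; exists j => //=.
by rewrite mem_enum.
Qed.

Section parallel_avoid.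
Variables (V : finType) (x : 'I_#|V| -> nat -> V).
Local Notation I := 'I_#|V|.

(** If the vertex was free when [i] stepped on it, the least index arriving there at the same time
    has settled on it. *)
Lemma par_visited t (i : I) l : i \notin (par_state x t).2 -> (0 < l <= t)%N ->
  x i l \in occupied x (par_state x t).
Proof.
elim: t i l => [|t IH] i l; first by case: l.
rewrite /par_state iterS -/(par_state x t); set s := par_state x t in IH *.
have mono y : y \in occupied x s -> y \in occupied x (par_step x s).
  move=> /imsetP[j js ->]; apply/imsetP; exists j; first by rewrite !inE js.
  by rewrite ffunE js.
move=> iU /andP[l0]; rewrite leq_eqVlt => /orP[/eqP lt|lt]; last first.
  have iS : i \notin s.2 by move: iU; rewrite !inE negb_or => /andP[].
  by apply/mono/IH => //; rewrite l0.
have iS : i \notin s.2 by move: iU; rewrite !inE negb_or => /andP[].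
have [yo|yo] := boolP (x i l \in occupied x s); first exact: mono.
pose c : {ffun I -> nat} := [ffun i => if i \in s.2 then s.1 i else (s.1 i).+1].
pose on_free i := (i \notin s.2) && (x i (c i) \notin occupied x s).
have ci : c i = l by rewrite ffunE (negbTE iS) (par_state_count x t i).2.
have fi : on_free i && (x i (c i) == x i l) by rewrite /on_free iS ci yo eqxx.
case: (@arg_minnP _ i (fun j => on_free j && (x j (c j) == x i l)) (fun j => nat_of_ord j) fi).
move=> j /andP[fj /eqP jl] jmin; apply/imsetP; exists j; last by rewrite /= -jl.
rewrite !inE; apply/orP; right; rewrite -/c -/(on_free j) fj /=.
apply/forallP => k; apply/implyP => /andP[fk /eqP kj]; apply: jmin.
by apply/andP; split; rewrite // -jl -kj.
Qed.

(** There are as many particles as vertices, so an unsettled particle leaves a vertex unoccupied,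
    and by [par_visited] that particle has never stepped on it. *)
Lemma par_unsettled_avoids t : (par_state x t).2 != [set: I]%SET ->
  exists i u, forall l, (0 < l <= t)%N -> x i l <> u.
Proof.
move=> nT; have [i iU] : exists i, i \notin (par_state x t).2.
  apply: contrapT => H; move/negP: nT; apply; apply/eqP/finset.setP => i.
  by rewrite inE; apply: contraT => iU; exfalso; apply: H; exists i.
have [u uo] : exists u, u \notin occupied x (par_state x t).
  apply: contrapT => H.
  have oT : #|occupied x (par_state x t)| = #|V|.
    rewrite -cardsT; congr #|pred_of_set _|; apply/finset.setP => u; rewrite inE.
    by apply: contraT => uo; exfalso; apply: H; exists u.
  have h1 : (#|V| <= #|(par_state x t).2|)%N by rewrite -[leqLHS]oT; exact: leq_imset_card.
  have : (par_state x t).2 \proper [set: I]%SET.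
    by rewrite finset.properT.
  by move/proper_card; rewrite cardsT card_ord ltnNge h1.
exists i, u => l lt xu; move: uo; rewrite -xu => /negP; apply.
exact: par_visited.
Qed.

End parallel_avoid.

Section tau_par_tail.
Variables (R : realType) (V : finType) (e : rel V) (v : V).
Variables (d : measure_display) (O : measurableType d) (P : probability O R).
Local Notation I := 'I_#|V|.
Local Notation n := #|V|.
Variables (X : I -> nat -> O -> V).
Hypothesis XW : indep_walks P e v X.
Hypotheses (eG : connected_graph e) (V1 : (1 < n)%N).
Local Notation T := (fun w => tau_par (fun i t => X i t w) : \bar R).

Lemma measurable_tau_par : measurable_fun setT T.
Proof.
rewrite (_ : T = fun w => span (fun i t => X i t w) (fun _ _ => 1) (fun _ _ => 1)).
  by have [mX _] := XW; apply: (measurable_span mX).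
by apply/funext => w; rewrite tau_parE.
Qed.

Lemma tau_par_ge0 w : (0 <= T w)%E.
Proof. by rewrite /= tau_parE span_ge0. Qed.

Lemma tau_par_tail k :
  (P [set w | ((k * n)%:R%:E < T w)%E] <= (n%:R ^+ 2 * (1 - hit_prob R V) ^+ k)%:E)%E.
Proof.
pose B (p : I * V) := [set w | avoids X p.1 p.2 (k * n) w].
have mB p : measurable (B p) by exact: (measurable_avoids XW).
apply: (@le_trans _ _ (\sum_p P (B p))%E).
  apply: probability_union_le => //.
    rewrite -[X in measurable X]setTI; apply: emeasurable_fun_lt => //.
    exact: measurable_tau_par.
  move=> w /= kT; have [i [u H]] : exists i u, forall l, (0 < l <= k * n)%N -> X i l w <> u.
    apply: (@par_unsettled_avoids _ (fun i t => X i t w)); apply/negP => /eqP pT.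
    move: kT; apply/negP; rewrite -leNgt; apply: ereal_inf_lbound.
    by exists (k * n)%N.
  by exists (i, u).
apply: (@le_trans _ _ (\sum_(p : I * V) ((1 - hit_prob R V) ^+ k)%:E)%E).
  by apply: lee_sum => p _; apply: (avoids_geometric XW).
by rewrite sumEFin lee_fin sumr_const card_prod card_ord -[leLHS]mulr_natl natrM -expr2.
Qed.

(** The factors are the mesh [n], the [n ^ 2] pairs of a particle and a vertex it avoids, and the
    geometric series, equal to [1 / hit_prob = n ^ n]. *)
Lemma integral_tau_par_le :
  (\int[P]_w T w <= (n%:R ^+ 3 * n%:R ^+ n)%:E)%E.
Proof.
have n0 : 0 < n%:R :> R by rewrite ltr0n (ltn_trans _ V1).
have /andP[c0 c1] := @hit_prob_bounds R V V1.
have mk k : measurable [set w | ((k%:R * n%:R)%:E < T w)%E].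
  rewrite -[X in measurable X]setTI; apply: emeasurable_fun_lt => //.
  exact: measurable_tau_par.
apply: (@le_trans _ _ (\int[P]_w (n%:R%:E * \sum_(0 <= k <oo) ((((k%:R * n%:R)%:E < T w)%E)%:R)%:E))%E).
  apply: ge0_le_integral => //.
  - by move=> w _; exact: tau_par_ge0.
  - exact: measurable_tau_par.
  - apply: measurable_funeM; apply: ge0_emeasurable_sum => k; last by move=> _; exact: measurable_bool.
    by move=> w _ _; rewrite lee_fin.
  - by move=> w _; exact: le_tail_sum.
rewrite ge0_integralZl//; last 2 first.
- apply: ge0_emeasurable_sum => k; last by move=> _; exact: measurable_bool.
  by move=> w _ _; rewrite lee_fin.
- by move=> w _; apply: nneseries_ge0 => k _ _; rewrite lee_fin.
rewrite integral_nneseries//; last by move=> k; exact: measurable_bool.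
rewrite [in leRHS]exprS -mulrA EFinM; apply: lee_wpmul2l; first by rewrite lee_fin ltW.
apply: (@le_trans _ _ (\sum_(0 <= k <oo) (n%:R ^+ 2)%:E * ((1 - hit_prob R V) ^+ k)%:E)%E).
  apply: lee_nneseries => k *; first by apply: integral_ge0 => w _; rewrite lee_fin.
  by rewrite integral_bool// -EFinM -natrM; exact: tau_par_tail.
rewrite nneseriesZl; last by move=> k _; rewrite lee_fin exprn_ge0// subr_ge0.
rewrite [leRHS]EFinM; apply: lee_wpmul2l; first by rewrite lee_fin exprn_ge0// ltW.
have h : 0 <= 1 - hit_prob R V < 1 by rewrite subr_ge0 c1 ltrBlDr ltrDl.
apply: le_trans (nneseries_geometric_le h) _.
by rewrite lee_fin opprB addrC subrK /hit_prob exprVn invrK.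
Qed.

End tau_par_tail.

(** * Quantile coupling *)

Section unif.
Variable R : realType.

Definition unif (A : set R) : \bar R := lebesgue_measure (A `&` `[0, 1]).

Let mI : measurable (`[0, 1]%classic : set (measurableTypeR R)).
Proof. exact: measurable_itv. Qed.
Let mu := mrestr (@lebesgue_measure R) mI.
Let unif0 : unif set0 = 0%E. Proof. by rewrite /unif set0I measure0. Qed.
Let unif_ge0 A : (0 <= unif A)%E. Proof. exact: measure_ge0. Qed.
Let unif_sigma : semi_sigma_additive unif.
Proof. exact: (@measure_semi_sigma_additive _ _ _ mu). Qed.
HB.instance Definition _ := isMeasure.Build _ _ _ unif unif0 unif_ge0 unif_sigma.
Let unifT : unif setT = 1%E.
Proof.
by rewrite /unif setTI lebesgue_measure_itv/= lte_fin ltr01 oppr0 adde0.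
Qed.
HB.instance Definition _ := Measure_isProbability.Build _ _ R unif unifT.

Lemma unif_gt (c : R) : 0 <= c <= 1 -> unif `]c, +oo[ = (1 - c)%:E.
Proof.
move=> /andP[c0 c1]; rewrite /unif (_ : _ `&` _ = `]c, 1]%classic); last first.
  apply/seteqP; split => x /=; rewrite !in_itv/= andbT.
    by move=> [-> /andP[_ ->]].
  by move=> /andP[cx x1]; rewrite cx x1 (le_trans c0 (ltW cx)).
rewrite lebesgue_measure_itv/= lte_fin; have [//|c1'] := ltP c 1.
by have -> : c = 1 by [apply/eqP; rewrite eq_le c1 c1']; rewrite subrr.
Qed.

Lemma unif_itv_le (a b eps : R) : 0 <= eps -> b <= a + eps -> (unif `]a, b] <= eps%:E)%E.
Proof.
move=> e0 ab; apply: (@le_trans _ _ (lebesgue_measure `]a, b])).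
  by apply: le_measure => //; rewrite inE; [apply: measurableI|]; exact: measurable_itv.
rewrite lebesgue_measure_itv/= lte_fin; case: ifP => _; last by rewrite lee_fin.
by rewrite -EFinB lee_fin lerBlDl.
Qed.

End unif.
Arguments unif R : clear implicits.

Section quantile.
Variables (R : realType) (d : measure_display) (O : measurableType d).
Variables (P : probability O R) (T : O -> \bar R).
Hypothesis mT : measurable_fun setT T.

Definition cdfe (t : \bar R) : R := fine (P [set w | (T w <= t)%E]).

Lemma measurable_le_cst t : measurable [set w | (T w <= t)%E].
Proof. by rewrite -[X in measurable X]setTI; apply: emeasurable_fun_le. Qed.

Lemma cdfeE t : P [set w | (T w <= t)%E] = (cdfe t)%:E.
Proof. by rewrite fineK// fin_num_measure//; exact: measurable_le_cst. Qed.

Lemma cdfe_bounds t : 0 <= cdfe t <= 1.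
Proof. by rewrite -!lee_fin -cdfeE measure_ge0 probability_le1//; exact: measurable_le_cst. Qed.

Lemma cdfe_mono s t : (s <= t)%E -> cdfe s <= cdfe t.
Proof.
move=> jump_state; rewrite -lee_fin -!cdfeE; apply: le_measure; rewrite ?inE; try exact: measurable_le_cst.
by move=> w /= Ts; exact: le_trans jump_state.
Qed.

(** Right continuity of the distribution function, which makes [quantile_le] an equivalence. *)
Lemma cdfe_right (t u : R) : cdfe t%:E < u -> exists2 s, t < s & cdfe s%:E < u.
Proof.
move=> tu; pose F k := [set w | (T w <= (t + k.+1%:R^-1)%:E)%E].
have mF k : measurable (F k) by exact: measurable_le_cst.
have FT : \bigcap_k F k = [set w | (T w <= t%:E)%E].
  apply/seteqP; split => w /= H; last first.
    by move=> k _; apply: le_trans H _; rewrite lee_fin lerDl.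
  apply/lee_addgt0Pr => eps e0.
  have := H (Num.truncn eps^-1) Logic.I; rewrite /F/= => /le_trans; apply.
  rewrite -EFinD lee_fin lerD2l -[leRHS]invrK lef_pV2 ?posrE ?invr_gt0//.
  by rewrite ltW// truncnS_gt.
have cF : (P \o F) k @[k --> \oo] --> P (\bigcap_k F k).
  apply: nonincreasing_cvg_mu => //.
  - by rewrite (le_lt_trans (probability_le1 _ _))// ltry.
  - exact: bigcap_measurableType.
  - move=> k l kl; apply/subsetPset => w /= H; apply: le_trans H _.
    by rewrite lee_fin lerD2l lef_pV2 ?posrE// ler_nat.
rewrite FT cdfeE in cF.
have [k H] : exists k, (P (F k) < u%:E)%E.
  apply: contrapT => H; move: tu; apply/negP; rewrite -leNgt -lee_fin.
  rewrite -(cvg_lim _ cF)//; apply: lime_ge; first by apply/cvg_ex; eexists; exact: cF.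
  by apply: nearW => k /=; rewrite leNgt; apply/negP => Hk; apply: H; exists k.
exists (t + k.+1%:R^-1); first by rewrite ltrDl.
by rewrite -lte_fin -cdfeE.
Qed.

Definition quantile (u : R) : \bar R := ereal_inf [set t | u <= cdfe t].

Lemma quantile_le (u t : R) : (quantile u <= t%:E)%E = (u <= cdfe t%:E).
Proof.
apply/idP/idP => [|ut]; last exact: ereal_inf_lbound.
apply: contraTT; rewrite -!ltNge => /cdfe_right[s ts su].
apply: (@lt_le_trans _ _ s%:E); first by rewrite lte_fin.
apply: le_ereal_inf_tmp => x /= ux; rewrite leNgt; apply/negP => /ltW/cdfe_mono xs.
by have := le_lt_trans (le_trans ux xs) su; rewrite ltxx.
Qed.

Lemma quantile_gt (t : R) : [set u | (t%:E < quantile u)%E] = `]cdfe t%:E, +oo[%classic.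
Proof. by apply/seteqP; split => u /=; rewrite in_itv/= andbT !ltNge quantile_le. Qed.

Lemma measurable_quantile : measurable_fun setT quantile.
Proof.
apply: (measurability _ (ErealGenOInfty.measurableE R)) => _ /= [_ [t ->] <-].
rewrite setTI (_ : _ @^-1` _ = `]cdfe t%:E, +oo[%classic)//.
by rewrite -quantile_gt; apply/seteqP; split => u /=; rewrite in_itv/= andbT.
Qed.

End quantile.

Lemma ereal_measure_unique (R : realType) (m1 m2 : probability (\bar R) R) :
  (forall t : R, m1 [set x | (t%:E < x)%E] = m2 [set x | (t%:E < x)%E]) ->
  forall B, measurable B -> m1 B = m2 B.
Proof.
move=> m12 B mB.
pose G : set (set (\bar R)) := [set A | A = setT \/ exists t : R, A = [set x | (t%:E < x)%E]].
have mt (t : R) : measurable [set x : \bar R | (t%:E < x)%E].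
  by rewrite -[X in measurable X]setTI; apply: emeasurable_fun_lt.
apply: (@g_sigma_algebra_measure_unique _ _ _ G _ (fun=> setT)) => //.
- by move=> _ [->|[t ->]].
- by move=> _; left.
- by rewrite bigcup_const//; exists 0%N.
- move=> _ _ [->|[t ->]] [->|[s ->]]; rewrite ?setTI ?setIT; first by left.
  + by right; exists s.
  + by right; exists t.
  + right; exists (Num.max t s); apply/seteqP; split => x /=.
      by move=> [h1 h2]; rewrite EFin_max gt_max h1.
    by rewrite EFin_max gt_max => /andP.
- move=> _ [->|[t ->]]; last exact: m12.
  by rewrite [LHS](probability_setT m1) [RHS](probability_setT m2).
- by move=> _; rewrite (le_lt_trans (probability_le1 _ _))// ltry.
- have mB' : emeasurable (@ocitv R) B by exact: mB.
  rewrite ErealGenOInfty.measurableE in mB'; move: B {mB} mB'.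
  apply: sub_smallest2r; first exact: smallest_sigma_algebra.
  move=> _ [t ->]; right; exists t; apply/seteqP; split => x /=; by rewrite in_itv/= andbT.
Qed.

Section quantile_coupling.
Variables (R : realType) (d1 d2 : measure_display).
Variables (O1 : measurableType d1) (O2 : measurableType d2).
Variables (P1 : probability O1 R) (P2 : probability O2 R).
Variables (T1 : O1 -> \bar R) (T2 : O2 -> \bar R).
Hypotheses (mT1 : measurable_fun setT T1) (mT2 : measurable_fun setT T2).

Let q12 (u : R) := (quantile P1 T1 u, quantile P2 T2 u).
Let mq12 : measurable_fun setT q12.
Proof. by apply: measurable_fun_pair; exact: measurable_quantile. Qed.
Let Q12 : {mfun R >-> (\bar R * \bar R)%type} := HB.pack q12
  (isMeasurableFun.Build _ _ _ _ q12 mq12).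

Let law_quantile d (O : measurableType d) (P : probability O R) (T : O -> \bar R) B :
  measurable_fun setT T -> measurable B -> unif R (quantile P T @^-1` B) = P (T @^-1` B).
Proof.
move=> mT mB.
pose q : {mfun R >-> \bar R} := HB.pack (quantile P T)
  (isMeasurableFun.Build _ _ _ _ (quantile P T) (measurable_quantile P mT)).
pose T' : {mfun O >-> \bar R} := HB.pack T (isMeasurableFun.Build _ _ _ _ T mT).
apply: (@ereal_measure_unique _ (distribution (unif R) q) (distribution P T')) => // t.
transitivity (unif R [set u | (t%:E < quantile P T u)%E]); first by [].
rewrite quantile_gt// unif_gt ?cdfe_bounds// EFinB -cdfeE// -probability_setC; last exact: measurable_le_cst.
congr (P _); apply/seteqP; split => w /=; rewrite ltNge => /negP //.
Qed.

(** Both variables are quantiles of one uniform [u]. Each event says that [u] lies between two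
    values of the distribution functions, an interval of length at most [eps] by hypothesis. *)
Lemma quantile_coupling : exists Q : probability (\bar R * \bar R)%type R,
  [/\ coupling P1 P2 T1 T2 Q,
    forall (s s' eps : R), 0 <= eps ->
      (P1 [set w | (T1 w <= s%:E)%E] <= P2 [set w | (T2 w <= s'%:E)%E] + eps%:E)%E ->
      (Q [set z | (z.1 <= s%:E)%E /\ (s'%:E < z.2)%E] <= eps%:E)%E &
    forall (s s' eps : R), 0 <= eps ->
      (P2 [set w | (T2 w <= s%:E)%E] <= P1 [set w | (T1 w <= s'%:E)%E] + eps%:E)%E ->
      (Q [set z | (z.2 <= s%:E)%E /\ (s'%:E < z.1)%E] <= eps%:E)%E].
Proof.
exists (distribution (unif R) Q12); split.
- move=> B mB; split.
    transitivity (unif R (quantile P1 T1 @^-1` B)); last exact: law_quantile.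
    by congr (unif R _); apply/seteqP; split => u //= [].
  transitivity (unif R (quantile P2 T2 @^-1` B)); last exact: law_quantile.
  by congr (unif R _); apply/seteqP; split => u //= [].
- move=> s s' eps e0; rewrite !cdfeE// -EFinD lee_fin => H.
  apply: le_trans (unif_itv_le e0 H); rewrite le_eqVlt; apply/orP; left; apply/eqP.
  congr (unif R _); apply/seteqP; split => u /=; rewrite in_itv/= !ltNge !quantile_le//.
    by move=> [-> ->].
  by move=> /andP[].
- move=> s s' eps e0; rewrite !cdfeE// -EFinD lee_fin => H.
  apply: le_trans (unif_itv_le e0 H); rewrite le_eqVlt; apply/orP; left; apply/eqP.
  congr (unif R _); apply/seteqP; split => u /=; rewrite in_itv/= !ltNge !quantile_le//.
    by move=> [-> ->].
  by move=> /andP[].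
Qed.

End quantile_coupling.

(** * Comparison on one graph *)

Lemma eq_par_state (V : finType) (x x' : 'I_#|V| -> nat -> V) t :
  (forall i l, (l <= t)%N -> x i l = x' i l) -> par_state x t = par_state x' t.
Proof.
elim: t => [//|t IH] xx'.
rewrite /par_state !iterS -!/(par_state _ t) -IH; last by move=> i l lt; rewrite xx'// leqW.
set s := par_state x t.
have oE : occupied x s = occupied x' s.
  by apply: eq_occupied => i _; rewrite xx'// leqW//; have [] := par_state_count x t i.
rewrite /par_step -oE; congr pair.
have cE i : x i ((if i \in s.2 then s.1 i else (s.1 i).+1)) = x' i (if i \in s.2 then s.1 i else (s.1 i).+1).
  by apply: xx'; case: ifP => _; rewrite ?ltnS ?leqW//; have [] := par_state_count x t i.
congr (_ :|: _)%SET; apply/finset.setP => i; rewrite !inE !ffunE -cE.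
by congr (_ && _); apply: eq_forallb => j; rewrite !ffunE -cE.
Qed.

Lemma indep_walks_of_clocks (R : realType) d (O : measurableType d) (P : probability O R)
    (V : finType) (e : rel V) v (I : finType) (Y : I -> nat -> O -> V) (S : I -> nat -> O -> R) :
  indep_walks_clocks P e v Y S -> indep_walks P e v Y.
Proof.
move=> [mY mS H]; split => // m p.
have := H m p (fun _ _ => setT) (fun _ _ => measurableT).
rewrite [X in (_ * X)%E]big1 ?mule1; last by move=> i _; rewrite big1// => k _; rewrite expo_setT.
by move=> <-; congr (P _); apply/seteqP; split => w //= [].
Qed.

(** * The parallel settling time has the same law for both families of walks *)

Section same_law.
Variables (R : realType) (V : finType) (e : rel V) (v : V).
Local Notation I := 'I_#|V|.

Let data d (O : measurableType d) (X : I -> nat -> O -> V) k w : {ffun I * 'I_k.+1 -> V} :=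
  [ffun p : I * 'I_k.+1 => X p.1 p.2 w].

Let data_law d (O : measurableType d) (P : probability O R) (X : I -> nat -> O -> V) k u :
  indep_walks P e v X -> measurable [set w | data X k w = u] /\
  P [set w | data X k w = u] = (\prod_i path_prob e v k (fun t => u (i, inord t)))%:E.
Proof.
move=> XW; have [mX PX] := XW.
have E : [set w | data X k w = u] = [set w | forall i t, (t <= k)%N -> X i t w = u (i, inord t)].
  apply/seteqP; split => w /= H; first by move=> i t tk; rewrite -H ffunE/= inordK.
  by apply/ffunP => -[i t]; rewrite ffunE/= H ?inord_val// -ltnS.
split; last by rewrite E PX.
rewrite E (_ : [set w | _] = \bigcap_(i in setT) [set w | forall t, (t <= k)%N -> X i t w = u (i, inord t)]).
  apply: fin_bigcap_measurable => [|i _]; first exact: finite_finset.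
  exact: (measurable_path XW i k (fun t => u (i, inord t))).
by apply/seteqP; split => w H i; [move=> _|]; exact: H.
Qed.

Let settled_data d (O : measurableType d) (X : I -> nat -> O -> V) k :
  [set w | (par_state (fun i t => X i t w) k).2 == [set: I]%SET] =
  [set w | (par_state (fun i t => data X k w (i, inord t)) k).2 == [set: I]%SET].
Proof.
have E w : par_state (fun i t => X i t w) k = par_state (fun i t => data X k w (i, inord t)) k.
  by apply: eq_par_state => i l lk; rewrite ffunE/= inordK.
by apply/seteqP; split => w /=; rewrite E.
Qed.

(** Each tail event is thus decided by finitely many positions, whose joint law is prescribed. *)
Lemma tau_par_gt (x : I -> nat -> V) (t : R) : 0 <= t ->
  (t%:E < tau_par x)%E = ((par_state x (Num.truncn t)).2 != [set: I]%SET).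
Proof.
move=> t0; have /andP[t1 t2] := truncn_itv t0; apply/idP/idP => [h|nT].
  apply/negP => /eqP pT; move: h; apply/negP; rewrite -leNgt.
  apply: (@le_trans _ _ (Num.truncn t)%:R%:E); last by rewrite lee_fin.
  by apply: ereal_inf_lbound; exists (Num.truncn t).
apply: (@lt_le_trans _ _ (Num.truncn t).+1%:R%:E); first by rewrite lte_fin.
apply: le_ereal_inf_tmp => _ [k /= kT <-]; rewrite lee_fin ler_nat ltnNge.
apply: contraNN nT => kt; apply/eqP.
rewrite -(subnKC kt); elim: (_ - _)%N => [|d IH]; first by rewrite addn0.
rewrite addnS /par_state iterS -/(par_state x _) /= IH.
by apply/finset.setP => i; rewrite !inE.
Qed.

Variables (d1 d2 : measure_display) (O1 : measurableType d1) (O2 : measurableType d2).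
Variables (P1 : probability O1 R) (P2 : probability O2 R).
Variables (X1 : I -> nat -> O1 -> V) (X2 : I -> nat -> O2 -> V).
Hypotheses (XW1 : indep_walks P1 e v X1) (XW2 : indep_walks P2 e v X2).
Let T1 w : \bar R := tau_par (fun i t => X1 i t w).
Let T2 w : \bar R := tau_par (fun i t => X2 i t w).

Let T1' : {mfun O1 >-> \bar R} := HB.pack T1
  (isMeasurableFun.Build _ _ _ _ T1 (@measurable_tau_par R _ _ _ _ _ _ _ XW1)).
Let T2' : {mfun O2 >-> \bar R} := HB.pack T2
  (isMeasurableFun.Build _ _ _ _ T2 (@measurable_tau_par R _ _ _ _ _ _ _ XW2)).

Lemma tau_par_same_law B : measurable B -> P1 (T1 @^-1` B) = P2 (T2 @^-1` B).
Proof.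
apply: (@ereal_measure_unique _ (distribution P1 T1') (distribution P2 T2')) => t.
transitivity (P1 [set w | (t%:E < T1 w)%E]); first by [].
transitivity (P2 [set w | (t%:E < T2 w)%E]); last by [].
have [t0|t0] := leP 0 t; last first.
  rewrite (_ : [set w | _] = setT); last first.
    by apply/seteqP; split => w //= _; rewrite (@lt_le_trans _ _ 0%E)// /T1 tau_parE span_ge0.
  rewrite (_ : [set w | (t%:E < T2 w)%E] = setT); last first.
    by apply/seteqP; split => w //= _; rewrite (@lt_le_trans _ _ 0%E)// /T2 tau_parE span_ge0.
  by rewrite !probability_setT.
pose k := Num.truncn t.
have E d (O : measurableType d) (P : probability O R) (X : I -> nat -> O -> V) :
    indep_walks P e v X ->
    P [set w | (t%:E < tau_par (fun i t => X i t w))%E] =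
    (\sum_(u : {ffun I * 'I_k.+1 -> V} |
        (par_state (fun i t => u (i, inord t)) k).2 != [set: I]%SET)
        (\prod_i path_prob e v k (fun t => u (i, inord t)))%:E)%E.
  move=> XW.
  rewrite (_ : [set w | _] = [set w | (fun u : {ffun I * 'I_k.+1 -> V} =>
      (par_state (fun i t => u (i, inord t)) k).2 != [set: I]%SET) (data X k w)]).
    rewrite (probability_finType P (fun u : {ffun I * 'I_k.+1 -> V} =>
      (par_state (fun i t => u (i, inord t)) k).2 != [set: I]%SET)).
      by apply: eq_bigr => u _; rewrite (data_law u XW).2.
    by move=> u; exact: (data_law u XW).1.
  have := settled_data X k => /(congr1 setC) SE.
  rewrite (_ : [set w | _] = ~` [set w | (par_state (fun i t => X i t w) k).2 == [set: I]%SET]).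
    by rewrite SE; apply/seteqP; split => w /= /negP.
  by apply/seteqP; split => w /=; rewrite tau_par_gt// => /negP.
by rewrite /T1 /T2 (E _ _ _ _ XW1) (E _ _ _ _ XW2).
Qed.

Lemma tau_par_same_integral : (\int[P1]_w T1 w = \int[P2]_w T2 w)%E.
Proof.
have m1 : measurable_fun setT (fun x : \bar R => maxe x 0).
  exact: measurable_maxe.
have E d (O : measurableType d) (P : probability O R) (T : {mfun O >-> \bar R}) :
    (* The change of variables asks for a function that is nonnegative on all of [\bar R], whence
       [maxe x 0] in place of the identity. *)
    (forall w, 0 <= T w)%E -> (\int[P]_w T w = \int[distribution P T]_x maxe x 0)%E.
  move=> T0; rewrite ge0_integral_distribution//.
    by apply: eq_integral => w _ /=; rewrite (max_idPl _).
  by move=> y; rewrite le_max lexx orbT.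
rewrite -[LHS]/(\int[P1]_w T1' w)%E -[RHS]/(\int[P2]_w T2' w)%E !E.
- by apply: eq_measure_integral => A mA _; exact: tau_par_same_law.
- by move=> w /=; rewrite /T2 tau_parE span_ge0.
- by move=> w /=; rewrite /T1 tau_parE span_ge0.
Qed.

End same_law.

Section comparison.
Variables (R : realType) (V : finType) (e : rel V) (v : V).
Local Notation I := 'I_#|V|.
Variables (d1 d2 : measure_display) (O1 : measurableType d1) (O2 : measurableType d2).
Variables (P1 : probability O1 R) (P2 : probability O2 R).
Variables (X : I -> nat -> O1 -> V) (Y : I -> nat -> O2 -> V) (S : I -> nat -> O2 -> R).
Hypotheses (XW : indep_walks P1 e v X) (YS : indep_walks_clocks P2 e v Y S).
Variables (dl K : R).
Hypotheses (dl01 : 0 < dl < 1) (K0 : 0 <= K).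

Definition Tpar w : \bar R := tau_par (fun i t => X i t w).
Definition Tcu w : \bar R := tau_cunif (fun i t => Y i t w) (fun i k => S i k w).
(* Bounds the expectation of the deviation term, hence also the probability that it
   exceeds 1. *)
Definition eta : R := expR (- theta dl * K) / theta dl * (#|V|%:R * cdev dl).

Local Notation sp b b' w := (span (fun i l => Y i l w) (clk S b w) (clk S b' w)).
Let psi w : \bar R := ((expR (- theta dl * K) / theta dl)%:E * total_dev S dl w)%E.

Let YW : indep_walks P2 e v Y. Proof. exact: indep_walks_of_clocks YS. Qed.
Let Tpar2 w : \bar R := tau_par (fun i t => Y i t w).

Let Tpar2_sp w : Tpar2 w = sp false false w. Proof. exact: tau_parE. Qed.

Let msp b b' : measurable_fun setT (fun w => sp b b' w).
Proof. exact: measurable_span_clk YS b b'. Qed.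

Let psi_c0 : 0 <= expR (- theta dl * K) / theta dl.
Proof. by rewrite divr_ge0 ?expR_ge0// ltW// theta_gt0. Qed.

Let psi0 w : (0 <= psi w)%E.
Proof. by rewrite mule_ge0// ?lee_fin// total_dev_ge0. Qed.

Let mpsi : measurable_fun setT psi.
Proof. by apply: measurable_funeM; exact: (measurable_total_dev YS). Qed.

Lemma eta_ge0 : 0 <= eta.
Proof. by rewrite mulr_ge0// mulr_ge0// cdev_ge0. Qed.

Let integral_psi : (\int[P2]_w psi w <= eta%:E)%E.
Proof.
rewrite ge0_integralZl//; first 1 last.
- exact: (measurable_total_dev YS).
- by move=> w _; exact: total_dev_ge0.
by rewrite /eta [leRHS]EFinM; apply: lee_wpmul2l; [rewrite lee_fin|exact: (integral_total_dev YS)].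
Qed.

Let psi_gt1 : (P2 [set w | (1 < psi w)%E] <= eta%:E)%E.
Proof.
have m1 : measurable [set w | (1 < psi w)%E].
  by rewrite -[X in measurable X]setTI; apply: emeasurable_fun_lt.
apply: le_trans integral_psi; rewrite -integral_bool//.
apply: ge0_le_integral => //; first exact: measurable_bool.
by move=> w _; case: (ltP 1%E (psi w)) => [/ltW//|_]; exact: psi0.
Qed.

Lemma Tcu_ge0 w : (0 <= Tcu w)%E. Proof. exact: span_ge0. Qed.
Lemma Tpar_ge0 w : (0 <= Tpar w)%E. Proof. by rewrite /Tpar tau_parE span_ge0. Qed.
Lemma measurable_Tcu : measurable_fun setT Tcu. Proof. exact: (msp true true). Qed.
Lemma measurable_Tpar : measurable_fun setT Tpar. Proof. exact: measurable_tau_par XW. Qed.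

(** The order of the exponential clocks is kept and the time becomes a jump count. The intermediate
    [sp true false] is then dominated in law by [sp false false], which is the parallel time. *)
Let Tcu_le w : (Tcu w <= (1 + dl)%:E * sp true false w + K%:E + psi w)%E.
Proof.
have /andP[p0 p1] := dl01.
apply: span_compare => //; first by rewrite addr_gt0.
move=> i k; rewrite /clk ring_time_one.
by have [] := ring_time_dev S dl01 i k w K.
Qed.

Local Notation c := ((1 - dl)^-1).

Let c0 : 0 < c. Proof. by have /andP[p0 p1] := dl01; rewrite invr_gt0 subr_gt0. Qed.

Let Tpar2_le w : (Tpar2 w <= c%:E * sp false true w + (c * K)%:E + c%:E * psi w)%E.
Proof.
have /andP[p0 p1] := dl01; rewrite Tpar2_sp.
apply: span_compare => //.
- by rewrite mulr_ge0// ltW.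
- by rewrite mule_ge0// lee_fin ltW.
move=> i k; rewrite /clk ring_time_one.
have [_ H] := ring_time_dev S dl01 i k w K.
rewrite (_ : k%:R - _ = c * ((1 - dl) * k%:R - ring_time (fun i k => S i k w) i k - K)).
  by rewrite EFinM; apply: lee_wpmul2l => //; rewrite lee_fin ltW.
rewrite !mulrBr mulrA mulVf ?mul1r ?opprD ?addrA// gt_eqF// subr_gt0//.
Qed.

Let Tpar_law (B : set (\bar R)) : measurable B -> P1 (Tpar @^-1` B) = P2 (Tpar2 @^-1` B).
Proof. exact: (tau_par_same_law XW YW). Qed.

Let dominance_gt b b' (t : R) :
  (P2 [set w | (t%:E < sp b' b w)%E] <= P2 [set w | (t%:E <= sp b b w)%E])%E.
Proof.
have m1 : measurable [set w | (sp b b w < t%:E)%E].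
  rewrite -[X in measurable X]setTI; apply: emeasurable_fun_lt => //; exact: (msp b b).
have m2 : measurable [set w | (sp b' b w <= t%:E)%E].
  rewrite -[X in measurable X]setTI; apply: emeasurable_fun_le => //; exact: (msp b' b).
rewrite (_ : [set w | (t%:E < _)%E] = ~` [set w | (sp b' b w <= t%:E)%E]); last first.
  by apply/seteqP; split => w /=; rewrite ltNge => /negP.
rewrite (_ : [set w | (t%:E <= _)%E] = ~` [set w | (sp b b w < t%:E)%E]); last first.
  by apply/seteqP; split => w /=; rewrite leNgt => /negP.
rewrite !probability_setC//; apply: leeB => //; exact: (span_dominance YS).
Qed.

Let mge (T : O2 -> \bar R) (t : R) : measurable_fun setT T -> measurable [set w | (t%:E <= T w)%E].
Proof. by move=> mT; rewrite -[X in measurable X]setTI; apply: emeasurable_fun_le. Qed.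

Let mgt (T : O2 -> \bar R) (t : R) : measurable_fun setT T -> measurable [set w | (t%:E < T w)%E].
Proof. by move=> mT; rewrite -[X in measurable X]setTI; apply: emeasurable_fun_lt. Qed.

Let union_le (A B C : set O2) : measurable A -> measurable B -> measurable C ->
  A `<=` B `|` C -> (P2 A <= P2 B + P2 C)%E.
Proof.
move=> mA mB mC AB; apply: le_trans (measureU2 _ mB mC).
by apply: le_measure; rewrite ?inE//; exact: measurableU.
Qed.

(** The 1 in the threshold pays for [psi], which exceeds 1 with probability at most [eta]. *)
Lemma Tcu_tail (s : R) : 0 <= s ->
  (P2 [set w | (((1 + dl) * s + K + 1)%:E < Tcu w)%E] <=
   P1 [set w | (s%:E <= Tpar w)%E] + eta%:E)%E.
Proof.
move=> s0; have /andP[p0 p1] := dl01.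
have -> : P1 [set w | (s%:E <= Tpar w)%E] = P2 [set w | (s%:E <= sp false false w)%E].
  rewrite (_ : [set w | _] = Tpar @^-1` [set x | (s%:E <= x)%E])//.
  rewrite Tpar_law; last first.
    by rewrite -[X in measurable X]setTI; apply: emeasurable_fun_le.
  by congr (P2 _); apply/seteqP; split => w /=; rewrite Tpar2_sp.
apply: (@le_trans _ _ (P2 [set w | (s%:E < sp true false w)%E] + P2 [set w | (1 < psi w)%E])%E).
  apply: union_le; [exact: mgt measurable_Tcu|exact: mgt (msp true false)|exact: mgt mpsi|].
  move=> w /= H; apply: contrapT => /not_orP[/negP]; rewrite -leNgt => h1 /negP.
  rewrite -leNgt => h2; move: H; apply/negP; rewrite -leNgt.
  apply: (le_trans (Tcu_le w)); rewrite !EFinD EFinM.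
  by apply: leeD => //; apply: leeD => //; apply: lee_wpmul2l => //; rewrite lee_fin addr_ge0// ltW.
by apply: leeD => //; exact: dominance_gt.
Qed.

Lemma Tpar_tail (s : R) : 0 <= s ->
  (P1 [set w | ((c * (s + K + 1))%:E < Tpar w)%E] <=
   P2 [set w | (s%:E <= Tcu w)%E] + eta%:E)%E.
Proof.
move=> s0; have /andP[p0 p1] := dl01.
have -> : P1 [set w | ((c * (s + K + 1))%:E < Tpar w)%E] =
    P2 [set w | ((c * (s + K + 1))%:E < sp false false w)%E].
  rewrite (_ : [set w | _] = Tpar @^-1` [set x | ((c * (s + K + 1))%:E < x)%E])//.
  rewrite Tpar_law; last first.
    by rewrite -[X in measurable X]setTI; apply: emeasurable_fun_lt.
  by congr (P2 _); apply/seteqP; split => w /=; rewrite Tpar2_sp.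
apply: (@le_trans _ _ (P2 [set w | (s%:E < sp false true w)%E] + P2 [set w | (1 < psi w)%E])%E).
  apply: union_le; [exact: mgt (msp false false)|exact: mgt (msp false true)|exact: mgt mpsi|].
  move=> w /= H; apply: contrapT => /not_orP[/negP]; rewrite -leNgt => h1 /negP.
  rewrite -leNgt => h2; move: H; apply/negP; rewrite -leNgt -Tpar2_sp.
  apply: (le_trans (Tpar2_le w)); rewrite !mulrDr mulr1 !EFinD !EFinM.
  apply: leeD; last by rewrite -[leRHS]mule1; apply: lee_wpmul2l => //; rewrite lee_fin ltW.
  by apply: leeD => //; apply: lee_wpmul2l => //; rewrite lee_fin ltW.
by apply: leeD => //; exact: dominance_gt.
Qed.

Let ETpar : (\int[P1]_w Tpar w = \int[P2]_w sp false false w)%E.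
Proof.
rewrite (tau_par_same_integral XW YW); apply: eq_integral => w _; exact: Tpar2_sp.
Qed.

Lemma Tcu_expectation :
  (\int[P2]_w Tcu w <= (1 + dl)%:E * (1 + \int[P1]_w Tpar w) + K%:E + eta%:E)%E.
Proof.
have /andP[p0 p1] := dl01; have p1' : 0 <= 1 + dl by rewrite addr_ge0// ltW.
rewrite ETpar.
apply: (@le_trans _ _ (\int[P2]_w ((1 + dl)%:E * sp true false w + K%:E + psi w))%E).
  apply: ge0_le_integral => //.
  - by move=> w _; exact: Tcu_ge0.
  - exact: measurable_Tcu.
  - by apply: emeasurable_funD => //; apply: emeasurable_funD => //; apply: measurable_funeM; exact: msp.
rewrite ge0_integralD//; first 1 last.
- by move=> w _; rewrite !adde_ge0// ?lee_fin// mule_ge0// ?lee_fin// span_ge0.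
- by apply: emeasurable_funD => //; apply: measurable_funeM; exact: msp.
apply: leeD; last exact: integral_psi.
rewrite ge0_integralD//; first 1 last.
- by move=> w _; rewrite mule_ge0// ?lee_fin// span_ge0.
- by apply: measurable_funeM; exact: msp.
apply: leeD; last by rewrite integral_cst//= probability_setT mule1.
rewrite ge0_integralZl//; first 1 last.
- by move=> w _; exact: span_ge0.
apply: lee_wpmul2l; first by rewrite lee_fin.
apply: expectation_le_of_tails.
- exact: msp.
- exact: msp.
- by move=> w; exact: span_ge0.
- by move=> k; exact: dominance_gt.
- by move=> w; exact: span_ge0.
Qed.

Lemma Tpar_expectation :
  (\int[P1]_w Tpar w <= c%:E * (1 + \int[P2]_w Tcu w) + (c * K)%:E + (c * eta)%:E)%E.
Proof.
have c0' := ltW c0; rewrite ETpar.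
apply: (@le_trans _ _ (\int[P2]_w (c%:E * sp false true w + (c * K)%:E + c%:E * psi w))%E).
  apply: ge0_le_integral => //.
  - by move=> w _; exact: span_ge0.
  - by apply: emeasurable_funD => //; [apply: emeasurable_funD => //; apply: measurable_funeM; exact: (msp false true)|exact: measurable_funeM].
  - by move=> w _; rewrite -Tpar2_sp; exact: Tpar2_le.
have cK : 0 <= c * K by rewrite mulr_ge0.
rewrite ge0_integralD//; first 1 last.
- by move=> w _; rewrite !adde_ge0// ?lee_fin// mule_ge0// ?lee_fin// span_ge0.
- by apply: emeasurable_funD => //; apply: measurable_funeM; exact: (msp false true).
- by move=> w _; rewrite mule_ge0// lee_fin.
- exact: measurable_funeM.
apply: leeD; last first.
  by rewrite ge0_integralZl// EFinM; apply: lee_wpmul2l; [rewrite lee_fin|exact: integral_psi].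
rewrite ge0_integralD//; first 1 last.
- by move=> w _; rewrite mule_ge0// ?lee_fin// span_ge0.
- by apply: measurable_funeM; exact: (msp false true).
apply: leeD; last by rewrite integral_cst//= probability_setT mule1.
rewrite ge0_integralZl//; first 1 last.
- by move=> w _; exact: span_ge0.
apply: lee_wpmul2l; first by rewrite lee_fin.
apply: expectation_le_of_tails.
- exact: (msp false true).
- exact: (msp true true).
- by move=> w; exact: span_ge0.
- by move=> k; exact: dominance_gt.
- by move=> w; exact: span_ge0.
Qed.

End comparison.

Lemma geometric_grid (R : realType) (s0 rho x : R) N :
  s0 <= x < s0 * rho ^+ N -> exists2 k : 'I_N, s0 * rho ^+ k <= x & x < s0 * rho ^+ k.+1.
Proof.
move=> /andP[x0 xN].
have [m xm mmin] := ex_minnP (ex_intro (fun m => x < s0 * rho ^+ m) N xN).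
case: m xm mmin => [|k] xm mmin; first by move: xm; rewrite mulr1 ltNge x0.
have kN : (k < N)%N by exact: mmin.
exists (Ordinal kN) => //=; rewrite leNgt; apply/negP => /mmin.
by rewrite ltnn.
Qed.

(** * From tails to a coupling event, by a union bound over a geometric grid *)

Section grid.
Variables (R : realType) (d1 d2 : measure_display).
Variables (O1 : measurableType d1) (O2 : measurableType d2).
Variables (P1 : probability O1 R) (P2 : probability O2 R).
Variables (T1 : O1 -> \bar R) (T2 : O2 -> \bar R).
Hypotheses (mT1 : measurable_fun setT T1) (mT2 : measurable_fun setT T2).
Variable Q : probability (\bar R * \bar R)%type R.
Hypothesis Qc : coupling P1 P2 T1 T2 Q.
Hypothesis Q12 : forall (s s' eps : R), 0 <= eps ->
  (P1 [set w | (T1 w <= s%:E)%E] <= P2 [set w | (T2 w <= s'%:E)%E] + eps%:E)%E ->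
  (Q [set z | (z.1 <= s%:E)%E /\ (s'%:E < z.2)%E] <= eps%:E)%E.
Hypothesis Q21 : forall (s s' eps : R), 0 <= eps ->
  (P2 [set w | (T2 w <= s%:E)%E] <= P1 [set w | (T1 w <= s'%:E)%E] + eps%:E)%E ->
  (Q [set z | (z.2 <= s%:E)%E /\ (s'%:E < z.1)%E] <= eps%:E)%E.

Definition close_pairs (dl : R) : set (\bar R * \bar R) :=
  [set z | ((1 - dl)%:E * z.1 <= z.2)%E /\ (z.2 <= (1 + dl)%:E * z.1)%E].

Lemma measurable_close_pairs dl : measurable (close_pairs dl).
Proof.
apply: measurableI; rewrite -[X in measurable X]setTI; apply: emeasurable_fun_le => //;
  by apply: measurable_funeM.
Qed.

Variables (dl K eta s0 : R) (N : nat).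
Hypotheses (dl0 : 0 < dl) (dl1 : dl < 1 / 8) (eta0 : 0 <= eta).
Hypotheses (s00 : 0 < s0) (Ks0 : K + 1 <= dl * s0).
Hypothesis tail12 : forall s : R, 0 <= s ->
  (P2 [set w | (((1 + dl) * s + K + 1)%:E < T2 w)%E] <=
   P1 [set w | (s%:E <= T1 w)%E] + eta%:E)%E.
Hypothesis tail21 : forall s : R, 0 <= s ->
  (P1 [set w | (((1 - dl)^-1 * (s + K + 1))%:E < T1 w)%E] <=
   P2 [set w | (s%:E <= T2 w)%E] + eta%:E)%E.

Let rho := 1 + dl.
Let sk k := s0 * rho ^+ k.

Let rho1 : 1 < rho. Proof. by rewrite ltrDl. Qed.
Let rho0 : 0 < rho. Proof. exact: lt_trans rho1. Qed.
Let sk_ge k : s0 <= sk k.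
Proof. by rewrite ler_peMr ?(ltW s00)// exprn_ege1// ltW. Qed.
Let sk_gt0 k : 0 < sk k. Proof. exact: lt_le_trans (sk_ge k). Qed.
Let skS k : sk k.+1 = rho * sk k. Proof. by rewrite /sk exprS mulrCA. Qed.
Let Ksk k : K + 1 <= dl * sk k.
Proof. by apply: le_trans Ks0 _; rewrite ler_wpM2l// ltW. Qed.

Let gtC d (O : measurableType d) (P : probability O R) (T : O -> \bar R) (t : R) :
  measurable_fun setT T ->
  P [set w | (t%:E < T w)%E] = (1 - P [set w | (T w <= t%:E)%E])%E.
Proof.
move=> mT; rewrite -probability_setC; last exact: measurable_le_cst.
by congr (P _); apply/seteqP; split => w /=; rewrite ltNge => /negP.
Qed.

Let mgt d (O : measurableType d) (T : O -> \bar R) (t : R) :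
  measurable_fun setT T -> measurable [set w | (t%:E < T w)%E].
Proof. by move=> mT; rewrite -[X in measurable X]setTI; apply: emeasurable_fun_lt. Qed.

Let mge d (O : measurableType d) (T : O -> \bar R) (t : R) :
  measurable_fun setT T -> measurable [set w | (t%:E <= T w)%E].
Proof. by move=> mT; rewrite -[X in measurable X]setTI; apply: emeasurable_fun_le. Qed.

(** The gap [a < s] turns [s <= T] into [a < T], whose complement is the event of the distribution
    function at [a]. *)
Let swap_tails d d' (O : measurableType d) (O' : measurableType d')
    (P : probability O R) (P' : probability O' R) (T : O -> \bar R) (T' : O' -> \bar R)
    (a b b' s : R) : measurable_fun setT T -> measurable_fun setT T' ->
  a < s -> b' <= b ->
  (P' [set w | (b'%:E < T' w)%E] <= P [set w | (s%:E <= T w)%E] + eta%:E)%E ->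
  (P [set w | (T w <= a%:E)%E] <= P' [set w | (T' w <= b%:E)%E] + eta%:E)%E.
Proof.
move=> mT mT' as_ bb H.
have h1 : (P' [set w | (b%:E < T' w)%E] <= P' [set w | (b'%:E < T' w)%E])%E.
  apply: le_measure; rewrite ?inE; try exact: mgt.
  by move=> w /=; apply: le_lt_trans; rewrite lee_fin.
have h2 : (P [set w | (s%:E <= T w)%E] <= P [set w | (a%:E < T w)%E])%E.
  apply: le_measure; rewrite ?inE; [exact: mge|exact: mgt|].
  by move=> w /=; apply: lt_le_trans; rewrite lte_fin.
have := le_trans h1 (le_trans H (leeD2r eta%:E h2)).
rewrite !gtC// !cdfeE// -!EFinB -!EFinD !lee_fin; lra.
Qed.

(* Outside of these events, [z.1] lies between two consecutive points of the grid and
   [z.2] within the bounds attached to them. *)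
Let B (j : bool + bool * 'I_N) : set (\bar R * \bar R) := match j with
  | inl true => [set z | (z.1 < s0%:E)%E]
  | inl false => [set z | (((s0 * rho ^+ N)%:E) <= z.1)%E]
  | inr (true, k) => [set z | (z.1 <= (sk k.+1)%:E)%E /\ (((1 + 8 * dl) * sk k)%:E < z.2)%E]
  | inr (false, k) => [set z | (z.2 <= ((1 - 8 * dl) * sk k.+1)%:E)%E /\ ((rho^-1 * sk k)%:E < z.1)%E]
  end.

Let mB j : measurable (B j).
Proof.
case: j => [[]|[[] k]]/=.
- by rewrite -[X in measurable X]setTI; apply: emeasurable_fun_lt.
- by rewrite -[X in measurable X]setTI; apply: emeasurable_fun_le.
- apply: measurableI; rewrite -[X in measurable X]setTI.
    exact: emeasurable_fun_le.
  exact: emeasurable_fun_lt.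
- apply: measurableI; rewrite -[X in measurable X]setTI.
    exact: emeasurable_fun_le.
  exact: emeasurable_fun_lt.
Qed.

Let far_cover z : ~ close_pairs (8 * dl) z -> exists j, B j z.
Proof.
case: z => x y /= far.
have [xs0|xs0] := ltP x s0%:E; first by exists (inl true).
have [xN|xN] := leP (s0 * rho ^+ N)%:E x; first by exists (inl false).
case: x xs0 xN far => [x||]//; rewrite ?lee_fin ?lte_fin => xs0 xN far.
have [k k1 k2] := @geometric_grid R s0 rho x N (introT andP (conj xs0 xN)).
have d8 : 0 < 1 - 8 * dl by move: dl1; lra.
have /not_andP[/negP|/negP] := far; rewrite -ltNge/= -EFinM => h.
  exists (inr (false, k)) => /=; split.
    by apply: ltW; apply: (lt_le_trans h); rewrite lee_fin ler_wpM2l ?(ltW k2)// ltW.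
  rewrite lte_fin; apply: lt_le_trans k1; rewrite gtr_pMl ?sk_gt0//.
  by rewrite invf_lt1.
exists (inr (true, k)) => /=; split; first by rewrite lee_fin ltW.
by apply: le_lt_trans h; rewrite lee_fin ler_wpM2l// addr_ge0// mulr_ge0// ltW.
Qed.

Let QB_inl b : Q (B (inl b)) = if b then P1 [set w | (T1 w < s0%:E)%E]
  else P1 [set w | ((s0 * rho ^+ N)%:E <= T1 w)%E].
Proof.
case: b => /=.
  rewrite (_ : [set z | (z.1 < s0%:E)%E] = [set x | (x < s0%:E)%E] `*` setT).
    rewrite (Qc _).1//; rewrite -[X in measurable X]setTI; exact: emeasurable_fun_lt.
  by apply/seteqP; split => z //= [].
rewrite (_ : [set z | (_ <= z.1)%E] = [set x | ((s0 * rho ^+ N)%:E <= x)%E] `*` setT).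
  rewrite (Qc _).1//; rewrite -[X in measurable X]setTI; exact: emeasurable_fun_le.
by apply/seteqP; split => z //= [].
Qed.

Let dsq : 0 <= dl * dl <= dl * (1 / 8).
Proof. by rewrite mulr_ge0 ?(ltW dl0)//= ler_wpM2l ?(ltW dl0)// ltW. Qed.
Let dcu : 0 <= dl * dl * dl <= dl * dl.
Proof.
rewrite !mulr_ge0 ?(ltW dl0)//= ler_piMr ?mulr_ge0 ?(ltW dl0)//.
by apply/ltW/(lt_trans dl1); lra.
Qed.
Let dqu : 0 <= dl * dl * dl * dl. Proof. by rewrite !mulr_ge0 ?(ltW dl0). Qed.

(** The tail at [sk k.+2] is used, as [swap_tails] needs a level strictly above [sk k.+1]; this
    makes two factors [rho] besides the factor [1 + dl]. The additive error is absorbed in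
    [dl * s]. *)
Let up_arith s : 0 < s -> K + 1 <= dl * s ->
  (1 + dl) * (rho * (rho * s)) + K + 1 <= (1 + 8 * dl) * s.
Proof.
move=> sp Ks; apply: (@le_trans _ _ ((1 + dl) * (rho * (rho * s)) + dl * s)).
  by rewrite -addrA lerD2l.
have -> : (1 + dl) * (rho * (rho * s)) + dl * s =
    (1 + 4 * dl + 3 * (dl * dl) + dl * dl * dl) * s by rewrite /rho; ring.
rewrite ler_wpM2r ?(ltW sp)//; move: dsq dcu dl0 => /andP[? ?] /andP[? ?] ?; lra.
Qed.

(** To first order the three factors [rho], the factor [1 - dl] and the term [K + 1] cost [5 dl];
    the constant 8 leaves room for the higher powers. *)
Let lo_arith s : 0 < s -> K + 1 <= dl * s ->
  (1 - dl)^-1 * (rho * ((1 - 8 * dl) * (rho * s)) + K + 1) <= rho^-1 * s.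
Proof.
move=> sp Ks; have p1 : 0 < 1 - dl by move: dl1; lra.
rewrite ler_pdivrMl// [leRHS]mulrCA ler_pdivlMl// mulrC [leRHS]mulrC.
apply: (@le_trans _ _ ((rho * ((1 - 8 * dl) * (rho * s)) + dl * s) * rho)).
  by rewrite ler_wpM2r ?(ltW rho0)// -addrA lerD2l.
have -> : (rho * ((1 - 8 * dl) * (rho * s)) + dl * s) * rho =
   (1 - 4 * dl - 20 * (dl * dl) - 23 * (dl * dl * dl) - 8 * (dl * dl * dl * dl)) * s.
  by rewrite /rho; ring.
rewrite (mulrC s) ler_wpM2r ?(ltW sp)//.
move: dsq dcu dqu dl0 => /andP[? ?] /andP[? ?] ? ?; lra.
Qed.

Let QB_inr p : (Q (B (inr p)) <= eta%:E)%E.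
Proof.
case: p => -[] k /=.
- apply: Q12 => //.
  apply: (swap_tails mT1 mT2 _ _ (tail12 (ltW (sk_gt0 k.+2)))).
  + by rewrite [ltRHS]skS ltr_pMl.
  + by rewrite !skS; exact: up_arith.
- have a0 : 0 < (1 - 8 * dl) * sk k.+1 by rewrite mulr_gt0//; move: dl1; lra.
  apply: Q21 => //.
  apply: (swap_tails mT2 mT1 _ _ (tail21 (ltW (mulr_gt0 rho0 a0)))).
  + by rewrite ltr_pMl.
  + by rewrite !skS; exact: lo_arith.
Qed.

Lemma far_pairs_le :
  (Q (~` close_pairs (8 * dl)) <= P1 [set w | (T1 w < s0%:E)%E] +
     P1 [set w | ((s0 * (1 + dl) ^+ N)%:E <= T1 w)%E] + (2 * N%:R * eta)%:E)%E.
Proof.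
apply: (@le_trans _ _ (\sum_j Q (B j))%E).
  apply: probability_union_le => //.
  by apply: measurableC; exact: measurable_close_pairs.
rewrite big_sumType big_bool !QB_inl; apply: leeD => //.
apply: (@le_trans _ _ (\sum_(j : bool * 'I_N) eta%:E)%E); last first.
  by rewrite sumEFin lee_fin sumr_const card_prod card_bool card_ord -[leLHS]mulr_natl natrM.
by apply: lee_sum => p _; exact: QB_inr.
Qed.

End grid.

(** * Asymptotics *)

Section asymptotics.
Variable R : realType.
Implicit Types (dl alpha beta x M eps : R) (n : nat).

Lemma nat_powR_large alpha M : 0 < alpha -> \forall n \near \oo, M <= n%:R `^ alpha.
Proof.
move=> a0; near=> n.
apply: (@le_trans _ _ ((Num.max M 1) `^ alpha^-1 `^ alpha)).
  rewrite -powRrM mulVf ?gt_eqF// powRr1 ?le_max ?lexx ?ler01 ?orbT//.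
rewrite ge0_ler_powR ?(ltW a0)// ?nnegrE ?powR_ge0//.
by near: n; exact: nbhs_infty_ger.
Unshelve. all: by end_near. Qed.

Lemma nat_powRN_small beta eps : 0 < beta -> 0 < eps ->
  \forall n \near \oo, n%:R `^ (- beta) <= eps.
Proof.
move=> b0 e0; near=> n.
have H : eps^-1 <= n%:R `^ beta by near: n; exact: nat_powR_large.
rewrite powRN -[leRHS]invrK lef_pV2// ?posrE ?invr_gt0//.
by apply: lt_le_trans H; rewrite invr_gt0.
Unshelve. all: by end_near. Qed.

Lemma ln_le_powR alpha n : 0 < alpha -> ln (n%:R : R) <= alpha^-1 * n%:R `^ alpha.
Proof.
case: n => [|n] a0.
  by rewrite ln0// mulr_ge0 ?powR_ge0// invr_ge0 ltW.
rewrite mulrC ler_pdivlMr// mulrC -ln_powR.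
have p0 : 0 < n.+1%:R `^ alpha by exact: powR_gt0.
rewrite -[leRHS](lnK p0); apply: le_trans (expR_ge1Dx _); by rewrite lerDr.
Qed.

(** With [y = n ^ (alpha / 2)] the logarithm is [O(y)], while the right side is [dl * y ^ 2]. *)
Lemma affine_ln_small alpha c dl : 0 < alpha -> 0 <= c -> 0 < dl ->
  \forall n \near \oo, c * ln n%:R + 1 <= dl * n%:R `^ alpha.
Proof.
move=> a0 c0 d0; have h0 : 0 < alpha / 2 by rewrite divr_gt0.
near=> n.
have y1 : 1 <= n%:R `^ (alpha / 2) :> R by near: n; exact: nat_powR_large.
have yM : (c * (alpha / 2)^-1 + 1) / dl <= n%:R `^ (alpha / 2) by near: n; exact: nat_powR_large.
set y : R := n%:R `^ (alpha / 2) in y1 yM *.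
have -> : n%:R `^ alpha = y * y.
  rewrite -powRD; first by congr powR; lra.
  by rewrite gt_eqF//; lra.
rewrite ler_pdivrMr// in yM.
have yln := ln_le_powR n h0; rewrite -/y in yln.
apply: (@le_trans _ _ ((c * (alpha / 2)^-1 + 1) * y)).
  by rewrite mulrDl mul1r; apply: lerD => //; rewrite -mulrA ler_wpM2l.
by rewrite mulrA (mulrC dl) ler_wpM2r// (le_trans ler01).
Unshelve. all: by end_near. Qed.

Lemma bernoulli_le x n : 0 <= x -> 1 + n%:R * x <= (1 + x) ^+ n.
Proof.
move=> x0; elim: n => [|n IH]; first by rewrite mul0r addr0 expr0.
rewrite exprS; apply: (@le_trans _ _ ((1 + x) * (1 + n%:R * x))).
  rewrite mulrDr mulr1 -natr1 mulrDl mul1r (addrC (n%:R * x)) addrA lerD2l.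
  by rewrite ler_peMl ?mulr_ge0// lerDl.
by rewrite ler_wpM2l// addr_ge0.
Qed.

(** By Bernoulli, about [n / dl] factors [1 + dl] already exceed [n]; this is repeated [n + 4] times
    to reach [n ^ (n + 4)]. The size is [O(n^2)] for fixed [dl]. *)
Definition grid_size dl n := (Num.bound dl^-1 * n * (n + 4))%N.

Lemma grid_size_large dl n : 0 < dl -> (n%:R : R) ^+ (n + 4) <= (1 + dl) ^+ grid_size dl n.
Proof.
move=> d0; rewrite /grid_size exprM lerXn2r// ?nnegrE ?exprn_ge0 ?addr_ge0 ?(ltW d0)//.
apply: le_trans (bernoulli_le _ (ltW d0)).
apply: (@le_trans _ _ ((Num.bound dl^-1 * n)%N%:R * dl)); last by rewrite lerDr.
rewrite natrM mulrAC ler_peMl//.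
rewrite -[leLHS](@mulVf _ dl) ?gt_eqF// ler_wpM2r ?(ltW d0)// ltW//.
by have := archi_boundP (_ : 0 <= dl^-1); rewrite invr_ge0 ltW// => /(_ erefl).
Qed.

Lemma grid_error_small dl c eps : 0 <= c -> 0 < eps ->
  \forall n \near \oo,
    n%:R^-1 + 2 * (grid_size dl n)%:R * (c * n%:R ^- 3) <= eps.
Proof.
move=> c0 e0; pose b : R := (Num.bound dl^-1)%:R.
near=> n; have n0 : (0 < n)%N by near: n; exists 1%N.
have nR : 1 <= n%:R :> R by rewrite ler1n.
have nR0 : 0 < n%:R :> R by rewrite ltr0n.
have nM : (1 + 10 * b * c) / eps <= n%:R by near: n; exact: nbhs_infty_ger.
apply: (@le_trans _ _ ((1 + 10 * b * c) / n%:R)); last first.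
  by rewrite ler_pdivrMr// [leRHS]mulrC -ler_pdivrMr.
rewrite [leRHS]mulrDl mul1r lerD2l ler_pdivlMr// /grid_size !natrM -/b natrD.
rewrite [leLHS](_ : _ = 2 * b * c * ((n%:R + 4) / n%:R)); last first.
  by field; rewrite gt_eqF.
rewrite [leRHS](_ : _ = 2 * b * c * 5); last by ring.
rewrite ler_wpM2l ?mulr_ge0//.
by rewrite ler_pdivrMr//; lra.
Unshelve. all: by end_near. Qed.

End asymptotics.

(** At stage [g] the finest precision [r j] with [j <= g] that is already achieved is used. Each
    precision is eventually achieved, so [J g] tends to infinity. The maximum is 0 when no [j]
    qualifies, which [okJ] excludes for large [g]. *)
Lemma diagonal_rate (R : realType) (F : nat -> R -> \bar R) :
  (forall g d, F g d <= 1)%E ->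
  (forall d, 0 < d < 1 -> \forall g \near \oo, ((1 - d)%:E <= F g d)%E) ->
  exists delta : nat -> R, delta g @[g --> \oo] --> 0 /\
    F g (delta g) @[g --> \oo] --> 1%E.
Proof.
move=> F1 FH; pose r j : R := j.+2%:R^-1.
have r01 j : 0 < r j < 1 by rewrite invr_gt0 ltr0n invf_lt1// ?ltr1n.
pose ok g (j : 'I_g.+1) := ((1 - r j)%:E <= F g (r j))%E.
pose J g := \max_(j < g.+1 | ok g j) j.
have J_large j : \forall g \near \oo, (j <= J g)%N.
  have H := FH _ (r01 j); near=> g.
  have jg : (j < g.+1)%N by rewrite ltnS; near: g; exact: nbhs_infty_ge.
  apply: (bigop.leq_bigmax_cond (Ordinal jg)); rewrite /ok/=.
  by near: g.
have okJ : \forall g \near \oo, ((1 - r (J g))%:E <= F g (r (J g)))%E.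
  have H := FH _ (r01 0%N); near=> g.
  have [|j jo Jj] := @bigop.eq_bigmax_cond _ [pred j | ok g j] (fun j : 'I_g.+1 => nat_of_ord j).
    by apply/card_gt0P; exists ord0; rewrite inE /ok/=; near: g.
  by rewrite (_ : J g = j) ?(Jj : J g = j)//; move: jo; rewrite inE.
have d0 : r (J g) @[g --> \oo] --> 0.
  apply/cvgrPdist_le => eps e0; near=> g; rewrite sub0r normrN ger0_norm; last first.
    by have /andP[/ltW] := r01 (J g).
  have : (Num.bound eps^-1 <= J g)%N by near: g; exact: J_large.
  move=> h; rewrite /r -[leRHS]invrK lef_pV2 ?posrE ?invr_gt0// ?ltr0n//.
  apply: (@le_trans _ _ (Num.bound eps^-1)%:R); last by rewrite ler_nat (leq_trans h)// leqW.
  by have := archi_boundP (_ : 0 <= eps^-1); rewrite invr_ge0 ltW// => /(_ erefl)/ltW.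
exists (fun g => r (J g)); split => //.
apply: (@squeeze_cvge _ _ _ _ (fun g => (1 - r (J g))%:E) _ (cst 1%E)).
- near=> g; rewrite F1 andbT; by near: g.
- apply: cvg_EFin; first by near=> g.
  rewrite -[X in _ --> X](subr0 (1 : R)); apply: cvgB => //; exact: cvg_cst.
- exact: cvg_cst.
Unshelve. all: by end_near. Qed.

Lemma markov_ereal d (O : measurableType d) (R : realType) (P : probability O R)
    (T : O -> \bar R) (a : R) : 0 < a -> measurable_fun setT T -> (forall w, 0 <= T w)%E ->
  (a%:E * P [set w | (a%:E <= T w)%E] <= \int[P]_w T w)%E.
Proof.
move=> a0 mT T0.
have m1 : measurable [set w | (a%:E <= T w)%E].
  by rewrite -[X in measurable X]setTI; apply: emeasurable_fun_le.
rewrite -integral_bool// -ge0_integralZl//; last 2 first.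
- exact: measurable_bool.
- by rewrite lee_fin ltW.
apply: ge0_le_integral => //.
- by move=> w _; rewrite mule_ge0// lee_fin ltW.
- by apply: measurable_funeM; exact: measurable_bool.
by move=> w _; case: (leP a%:E (T w)) => h; rewrite ?mule1 ?mule0.
Qed.

Section one_graph.
Variables (R : realType) (V : finType) (e : rel V) (v : V).
Local Notation I := 'I_#|V|.
Variables (d1 d2 : measure_display) (O1 : measurableType d1) (O2 : measurableType d2).
Variables (P1 : probability O1 R) (P2 : probability O2 R).
Variables (X : I -> nat -> O1 -> V) (Y : I -> nat -> O2 -> V) (S : I -> nat -> O2 -> R).
Hypotheses (XW : indep_walks P1 e v X) (YS : indep_walks_clocks P2 e v Y S).
Hypothesis eG : connected_graph e.
Local Notation n := #|V|.
Local Notation T1 := (Tpar R X).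
Local Notation T2 := (Tcu Y S).

(** The coupling is chosen before [dl], [K], [s0] and [N]: one coupling serves all precisions, as
    [diagonal_rate] requires. The term [1 / n] is Markov's inequality at level [n ^ (n + 4)]. *)
Lemma close_coupling : exists2 Q : probability (\bar R * \bar R)%type R,
  coupling P1 P2 T1 T2 Q &
  forall dl K s0 N, 0 < dl -> dl < 1 / 8 -> 0 <= K -> 0 < s0 -> K + 1 <= dl * s0 ->
    (1 < n)%N -> n%:R ^+ (n + 4) <= s0 * (1 + dl) ^+ N ->
    (Q (~` close_pairs (8 * dl)) <=
     P1 [set w | (T1 w < s0%:E)%E] + (n%:R^-1 + 2 * N%:R * eta V dl K)%:E)%E.
Proof.
have mT1 := measurable_Tpar XW; have mT2 := measurable_Tcu YS.
have [Q [Qc Q12 Q21]] := quantile_coupling P1 P2 mT1 mT2.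
exists Q => // dl K s0 N dl0 dl1 K0 s00 Ks0 V1 sN.
have dl01 : 0 < dl < 1 by rewrite dl0/=; move: dl1; lra.
apply: le_trans (@far_pairs_le _ _ _ _ _ _ _ _ _ mT1 mT2 Q Qc Q12 Q21 dl K (eta V dl K)
  s0 N dl0 dl1 (eta_ge0 V K dl01) s00 Ks0 (Tcu_tail XW YS dl01 K0) (Tpar_tail XW YS dl01 K0)) _.
rewrite EFinD addeA; apply: leeD => //; apply: leeD => //.
have n0 : 0 < n%:R :> R by rewrite ltr0n (ltn_trans _ V1).
have a0 : 0 < s0 * (1 + dl) ^+ N by rewrite mulr_gt0// exprn_gt0// addr_gt0.
have := le_trans (markov_ereal P1 a0 mT1 (Tpar_ge0 R X)) (integral_tau_par_le XW eG V1).
rewrite -lee_pdivlMl// => /le_trans; apply; rewrite -EFinM lee_fin mulrC ler_pdivrMr//.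
apply: le_trans (_ : n%:R^-1 * n%:R ^+ (n + 4) <= _); last by rewrite ler_wpM2l// invr_ge0 ltW.
by rewrite -exprD addnS exprS mulKf ?gt_eqF// addnC.
Qed.

Hypothesis V1 : (1 < n)%N.
Local Notation A := (fine (\int[P1]_w T1 w)).
Local Notation B := (fine (\int[P2]_w T2 w)).

Let finA : (\int[P1]_w T1 w = A%:E)%E.
Proof.
rewrite fineK// ge0_fin_numE; last by apply: integral_ge0 => w _; exact: Tpar_ge0.
by apply: le_lt_trans (integral_tau_par_le XW eG V1) _; exact: ltry.
Qed.

Let Tcu_le_A dl K : 0 < dl < 1 -> 0 <= K ->
  (\int[P2]_w T2 w <= ((1 + dl) * (1 + A) + K + eta V dl K)%:E)%E.
Proof.
by move=> dl01 K0; have := Tcu_expectation XW YS dl01 K0; rewrite finA.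
Qed.

Let finB : (\int[P2]_w T2 w = B%:E)%E.
Proof.
rewrite fineK// ge0_fin_numE; last by apply: integral_ge0 => w _; exact: Tcu_ge0.
(* Only finiteness is at stake, so any admissible constants do. *)
by apply: le_lt_trans (@Tcu_le_A (1 / 2) 0 _ _) _; rewrite ?ltry//; lra.
Qed.

(** Markov's inequality gives [A >= s0 / 2], so [K + 1] and [eta + 1] are each at most [2 * dl * A];
    with the relative error [dl * A] this makes [5 * dl * A]. *)
Lemma expectation_ratio_close dl K s0 : 0 < dl < 1 -> 0 <= K -> 0 < s0 ->
  K + 1 <= dl * s0 -> eta V dl K + 1 <= dl * s0 ->
  ((1 / 2)%:E <= P1 [set w | (s0%:E <= T1 w)%E])%E ->
  `|B / A - 1| <= 5 * dl.
Proof.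
move=> dl01 K0 s00 Ks0 es0 half; have /andP[p0 p1] := dl01.
have As0 : s0 / 2 <= A.
  rewrite -lee_fin -finA; apply: le_trans (markov_ereal P1 s00 (measurable_Tpar XW) (Tpar_ge0 R X)).
  by rewrite EFinM; apply: lee_wpmul2l; rewrite ?lee_fin ?(ltW s00)//; move: half; rewrite mul1r.
have A0 : 0 < A by apply: lt_le_trans As0; rewrite divr_gt0.
have h1 : B <= (1 + dl) * (1 + A) + K + eta V dl K.
  by rewrite -lee_fin -finB; exact: Tcu_le_A.
have h2 : (1 - dl) * A <= 1 + B + K + eta V dl K.
  have : A <= (1 - dl)^-1 * (1 + B) + (1 - dl)^-1 * K + (1 - dl)^-1 * eta V dl K.
    by rewrite -lee_fin; have := Tpar_expectation XW YS dl01 K0; rewrite finA finB.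
  have q0 : 0 < 1 - dl by lra.
  by rewrite -!mulrDr mulrC ler_pdivlMr// mulrC.
have -> : B / A - 1 = (B - A) / A by field; rewrite gt_eqF.
have dA : dl * s0 <= 2 * dl * A.
  by rewrite -mulrA mulrCA ler_wpM2l ?(ltW p0)//; lra.
rewrite normrM (gtr0_norm (_ : 0 < A^-1)) ?invr_gt0// ler_pdivrMr// ler_norml.
apply/andP; split; lra.
Qed.

End one_graph.

(** The 4 in this [K] makes the exponential factor [n^-4]; one power of [n] is lost to the number of
    particles, and [n^-3] beats the [O(n^2)] points of the grid. *)
Lemma eta_ln (R : realType) (V : finType) (dl : R) : 0 < dl < 1 -> (0 < #|V|)%N ->
  eta V dl (4 / theta dl * ln #|V|%:R) = cdev dl / theta dl * #|V|%:R ^- 3.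
Proof.
move=> dl01 V0; have t0 := theta_gt0 dl01.
have n0 : 0 < #|V|%:R :> R by rewrite ltr0n.
rewrite /eta (_ : - theta dl * _ = - (ln #|V|%:R *+ 4)); last first.
  by rewrite -mulr_natl; field; rewrite gt_eqF.
rewrite -lnXn// expRN lnK ?posrE ?exprn_gt0//.
by field; rewrite !gt_eqF.
Qed.

Theorem theorem4p8 (R : realType) (alpha beta : R)
  (V : nat -> finType) (e : forall g, rel (V g)) (v : forall g, V g)
  (* realizations of the Parallel-IDLA *)
  (d1 : nat -> measure_display) (O1 : forall g, measurableType (d1 g))
  (P1 : forall g, probability (O1 g) R)
  (X : forall g, 'I_#|V g| -> nat -> O1 g -> V g)
  (* realizations of the continuous-time Uniform-IDLA *)
  (d2 : nat -> measure_display) (O2 : forall g, measurableType (d2 g))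
  (P2 : forall g, probability (O2 g) R)
  (Y : forall g, 'I_#|V g| -> nat -> O2 g -> V g)
  (S : forall g, 'I_#|V g| -> nat -> O2 g -> R) :
  let Tpar g (w : O1 g) : \bar R := tau_par (fun i t => X g i t w) in
  let Tcu g (w : O2 g) : \bar R :=
    tau_cunif (fun i t => Y g i t w) (fun i k => S g i k w) in
  0 < alpha -> 0 < beta ->
  (forall g, connected_graph (e g)) ->
  #|V g| @[g --> \oo] --> \oo ->
  (forall g, indep_walks (P1 g) (e g) (v g) (X g)) ->
  (forall g, indep_walks_clocks (P2 g) (e g) (v g) (Y g) (S g)) ->
  (forall g, ((1 - #|V g|%:R `^ (- beta))%:E <=
     P1 g [set w | ((#|V g|%:R `^ alpha)%:E <= Tpar g w)%E])%E) ->
  (exists (Q : forall g, probability (\bar R * \bar R)%type R)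
          (delta : nat -> R),
    [/\ forall g, coupling (P1 g) (P2 g) (Tpar g) (Tcu g) (Q g),
        delta g @[g --> \oo] --> 0 &
        Q g [set z | ((1 - delta g)%:E * z.1 <= z.2)%E /\
                     (z.2 <= (1 + delta g)%:E * z.1)%E] @[g --> \oo]
          --> 1%E]) /\
  fine (\int[P2 g]_w Tcu g w) / fine (\int[P1 g]_w Tpar g w)
    @[g --> \oo] --> (1 : R).
Proof.
move=> T1 T2 a0 b0 eG Voo XW YS hyp.
have nearV (p : nat -> Prop) : (\forall n \near \oo, p n) -> \forall g \near \oo, p #|V g|.
  exact: Voo.
have V1 : \forall g \near \oo, (1 < #|V g|)%N by apply: (nearV (fun n => (1 < n)%N)); exists 2%N.
pose s0 g : R := #|V g|%:R `^ alpha.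
pose K dl g : R := 4 / theta dl * ln #|V g|%:R.
pose C dl : R := cdev dl / theta dl.
have C0 dl : 0 < dl < 1 -> 0 <= C dl.
  by move=> dl01; rewrite divr_ge0 ?cdev_ge0// ltW// theta_gt0.
have K0 dl g : 0 < dl < 1 -> (1 < #|V g|)%N -> 0 <= K dl g.
  move=> dl01 g1; apply: mulr_ge0; first by rewrite divr_ge0// ltW// theta_gt0.
  by rewrite ln_ge0// ler1n ltnW.
have Ks dl : 0 < dl < 1 -> \forall g \near \oo, K dl g + 1 <= dl * s0 g.
  move=> dl01; have /andP[p0 _] := dl01.
  apply: (nearV (fun n => 4 / theta dl * ln n%:R + 1 <= dl * n%:R `^ alpha)).
  by apply: affine_ln_small => //; rewrite divr_ge0// ltW// theta_gt0.
have s00 g : (1 < #|V g|)%N -> 0 < s0 g.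
  by move=> g1; rewrite powR_gt0// ltr0n ltnW.
have mT1 g : measurable_fun setT (T1 g) := measurable_Tpar (XW g).
have mge g : measurable [set w | ((s0 g)%:E <= T1 g w)%E].
  by rewrite -[X in measurable X]setTI; apply: emeasurable_fun_le.
split.
  have /choice[Q HQ] g : exists Q : probability (\bar R * \bar R)%type R,
    coupling (P1 g) (P2 g) (T1 g) (T2 g) Q /\
    forall dl K s0 N, 0 < dl -> dl < 1 / 8 -> 0 <= K -> 0 < s0 -> K + 1 <= dl * s0 ->
      (1 < #|V g|)%N -> #|V g|%:R ^+ (#|V g| + 4) <= s0 * (1 + dl) ^+ N ->
      (Q (~` close_pairs (8 * dl)) <=
       P1 g [set w | (T1 g w < s0%:E)%E] + (#|V g|%:R^-1 + 2 * N%:R * eta (V g) dl K)%:E)%E.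
    by have [Q h1 h2] := close_coupling (XW g) (YS g) (eG g); exists Q.
  have [||delta [d0 d1']] := @diagonal_rate R (fun g d => Q g (close_pairs d)).
  - by move=> g d; apply: probability_le1; exact: measurable_close_pairs.
  - move=> d /andP[p0 p1].
    (* [d / 8] because the grid loses a factor 8 in precision. The allowed failure probability [d]
       is split evenly between a parallel time below [n ^ alpha] and the error of the grid. *)
    have dl01 : 0 < d / 8 < 1 by lra.
    have /andP[q0 q1] := dl01.
    have h1 : \forall g \near \oo, #|V g|%:R `^ (- beta) <= d / 2.
      by apply: (nearV (fun n => n%:R `^ (- beta) <= d / 2)); apply: nat_powRN_small; lra.
    have h2 : \forall g \near \oo, #|V g|%:R^-1 +
        2 * (grid_size (d / 8) #|V g|)%:R * (C (d / 8) * #|V g|%:R ^- 3) <= d / 2.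
      apply: (nearV (fun n => n%:R^-1 + 2 * (grid_size (d / 8) n)%:R *
        (C (d / 8) * n%:R ^- 3) <= d / 2)).
      by apply: grid_error_small; [exact: C0|lra].
    have h3 : \forall g \near \oo, 1 <= s0 g.
      by apply: (nearV (fun n => 1 <= n%:R `^ alpha)); exact: nat_powR_large.
    have h4 := Ks _ dl01.
    near=> g; have g1 : (1 < #|V g|)%N by near: g.
    have mc := @measurable_close_pairs R d.
    rewrite -[close_pairs d]setCK probability_setC; last exact: measurableC.
    rewrite EFinB; apply: leeB => //.
    have [_ /(_ (d / 8) (K (d / 8) g) (s0 g) (grid_size (d / 8) #|V g|))] := HQ g.
    rewrite (_ : 8 * (d / 8) = d); last by field.
    move=> /(_ q0 _ (K0 _ _ dl01 g1) (s00 _ g1) _ g1) H.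
    apply: le_trans (H _ _ _) _; first lra.
    + by near: g.
    + apply: le_trans (grid_size_large _ q0) _.
      rewrite ler_peMl ?exprn_ge0 ?addr_ge0 ?(ltW q0)//.
      by near: g.
    rewrite eta_ln// ?(ltnW g1)// -/(C _).
    rewrite (_ : [set w | (T1 g w < (s0 g)%:E)%E] = ~` [set w | ((s0 g)%:E <= T1 g w)%E]); last first.
      by apply/seteqP; split => w /=; rewrite ltNge => /negP.
    rewrite probability_setC// [leRHS](_ : _ = (d / 2)%:E + (d / 2)%:E)%E; last first.
      by rewrite -EFinD; congr EFin; field.
    apply: leeD; last by rewrite lee_fin; near: g.
    apply: (@le_trans _ _ (1 - (1 - #|V g|%:R `^ (- beta))%:E)%E); first exact: leeB.
    by rewrite -EFinB lee_fin opprB addrC subrK; near: g.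
  - exists Q, delta; split => //.
    by move=> g; exact: (HQ g).1.
apply/cvgrPdist_le => eps e0.
(* The 5 is that of [expectation_ratio_close]; the minimum with [1 / 2] ensures [dl < 1]. *)
pose dl := Num.min (eps / 5) (1 / 2).
have dl01 : 0 < dl < 1.
  apply/andP; split; first by rewrite lt_min; apply/andP; split; lra.
  by rewrite gt_min; apply/orP; right; lra.
have /andP[p0 p1] := dl01.
have dle : 5 * dl <= eps by rewrite mulrC -ler_pdivlMr// ge_min lexx.
have h1 : \forall g \near \oo, #|V g|%:R `^ (- beta) <= 1 / 2.
  by apply: (nearV (fun n => n%:R `^ (- beta) <= 1 / 2)); apply: nat_powRN_small; lra.
have h2 : \forall g \near \oo, (C dl + 1) / dl <= s0 g.
  by apply: (nearV (fun n => (C dl + 1) / dl <= n%:R `^ alpha)); exact: nat_powR_large.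
have h4 := Ks _ dl01.
near=> g; have g1 : (1 < #|V g|)%N by near: g.
rewrite distrC; apply: le_trans dle.
apply: (expectation_ratio_close (XW g) (YS g) (eG g) g1 dl01 (K0 _ _ dl01 g1) (s00 _ g1)).
- by near: g.
- rewrite eta_ln// ?(ltnW g1)// -/(C _).
  apply: (@le_trans _ _ (C dl + 1)); last by rewrite mulrC -ler_pdivrMr//; near: g.
  rewrite lerD2r ler_piMr ?C0// invf_le1 ?exprn_gt0 ?ltr0n ?(ltnW g1)//.
  by rewrite exprn_ege1// ler1n ltnW.
apply: le_trans (hyp g); rewrite lee_fin.
have : #|V g|%:R `^ (- beta) <= 1 / 2 by near: g.
lra.
Unshelve. all: by end_near. Qed.
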